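(* Let $d\ge1$. Assume that $u\le0$, that $\inf u=u(0)>-\infty$, and that for any $\varepsilon>0$ there exists $R_\varepsilon>0$ such that $\operatorname{ess\,sup}_{B(R_\varepsilon)}u\le u(0)+\varepsilon$. Then for any $p\ge1$, $$\lim_{t\uparrow\infty}t^{-(1+d/\theta)}\log\mathbb{E}_\theta[v_\xi(t;x_0)^p]=c_-(d,\theta,p\,u(0)),$$ uniformly in $x_0\in\Lambda_1$, where, for $K\in\mathbb{R}$, $$c_-(d,\theta,K)=\frac{2\pi^{d/2}\,\theta\,|K|^{1+d/\theta}}{d(d+\theta)\Gamma(d/2)}.$$
   Context: Model. Let $\theta>0$, $\alpha>d$ and $C_0<0$. The nonpositive function $u:\mathbb{R}^d\to(-\infty,0]$ satisfies $u(x)=C_0|x|^{-\alpha}(1+o(1))$ as $|x|\to\infty$. The random vectors $\xi=(\xi_q)_{q\in\mathbb{Z}^d}$ are i.i.d. with values in $\mathbb{Z}^d$ and law $\mathbb{P}_\theta(\xi_q=p)=Z(d,\theta)^{-1}\exp(-|p|^\theta)$, $p\in\mathbb{Z}^d$, where $Z(d,\theta)$ is the normalizing constant; $\mathbb{E}_\theta$ is the corresponding expectation. Set $V_\xi(x)=\sum_{q\in\mathbb{Z}^d}u(x-q-\xi_q)$ and $$v_\xi(t;x_0)=E_{x_0}\Bigl[\exp\Bigl\{-\int_0^tV_\xi(B_s)\,ds\Bigr\}\Bigr],$$ where $(B_s)_{s\ge0}$ is standard Brownian motion on $\mathbb{R}^d$ and $E_{x_0}$ is expectation for the motion started at $x_0$.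 $B(R)$ is the ball of radius $R$ centered at $0$, and $\Lambda_1=[-1/2,1/2]^d$. *)

(* Defs.v *)
From HB Require Import structures.
From mathcomp Require Import all_boot all_order all_algebra finmap.
From mathcomp Require Import all_classical all_reals all_analysis.

Set Implicit Arguments.
Unset Strict Implicit.
Unset Printing Implicit Defensive.

Import Order.TTheory GRing.Theory Num.Theory.
Import numFieldNormedType.Exports.

Local Open Scope classical_set_scope.
Local Open Scope ring_scope.

Section euclidean_space.
Context {R : realType} {d : nat}.
Implicit Types (x a b : 'rV[R]_d) (A : set 'rV[R]_d).

(* The canonical norm of ['rV_d] is the sup norm, hence a Euclidean one. *)
Definition enorm x : R := Num.sqrt (\sum_(i < d) x 0 i ^+ 2).

Definition eball (r : R) : set 'rV[R]_d := [set x | enorm x < r].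

Definition enorm_infty : set_system 'rV[R]_d :=
  filter_from setT (fun M : R => [set x | M < enorm x]).

(* [-1/2, 1/2]^d *)
Definition unit_cube : set 'rV[R]_d :=
  [set x | forall i : 'I_d, - 2^-1 <= x 0 i <= 2^-1].

Definition lattice_point (q : 'rV[int]_d) : 'rV[R]_d := map_mx intr q.

Definition box a b : set 'rV[R]_d :=
  [set x | forall i : 'I_d, a 0 i <= x 0 i <= b 0 i].

(* d-dimensional Lebesgue outer measure: coverings by countably many boxes. *)
Definition lebesgue_outer A : \bar R :=
  ereal_inf [set (\sum_(0 <= k <oo) (\prod_(i < d) ((ab k).2 0 i - (ab k).1 0 i))%:E)%E
            | ab in [set ab : nat -> 'rV[R]_d * 'rV[R]_d |
                (forall k (i : 'I_d), (ab k).1 0 i <= (ab k).2 0 i) /\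
                A `<=` \bigcup_k box (ab k).1 (ab k).2]].

Definition lebesgue_measurable_fun (f : 'rV[R]_d -> R) :=
  forall Y : set R, measurable Y ->
    lebesgue_outer.-caratheodory (f @^-1` Y).

Definition ess_sup_on A (f : 'rV[R]_d -> R) : \bar R :=
  ereal_inf [set y | lebesgue_outer [set x | A x /\ (y < (f x)%:E)%E] = 0%E].

Definition borel : set_system 'rV[R]_d := <<s [set A | open A] >>.

End euclidean_space.

Section independence.
Context {R : realType} {dO : measure_display} {O : measurableType dO}.
Variable P : probability O R.

(* [G] is the sigma-algebra on the common target space [T]. *)
Definition independent_family {I : choiceType} {T : Type}
    (G : set_system T) (X : I -> O -> T) :=
  forall (J : {fset I}) (A : I -> set T), (forall i, G (A i)) ->
    P (\bigcap_(i in [set` J]) X i @^-1` A i) =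
    (\prod_(i <- J) P (X i @^-1` A i))%E.

End independence.

Section brownian_motion.
Context {R : realType} {d : nat} {dO : measure_display} {O : measurableType dO}.

(* Standard d-dimensional Brownian motion started at x0, for the law P; times
   are reals and only the nonnegative ones matter.  The second argument of
   [normal_prob] is the standard deviation. *)
Record brownian_motion (P : probability O R) (x0 : 'rV[R]_d)
    (B : R -> O -> 'rV[R]_d) : Prop := {
  bm_measurable : forall t, 0 <= t ->
    forall A, borel A -> measurable (B t @^-1` A) ;
  bm_start : {ae P, forall w, B 0 w = x0} ;
  bm_continuous :
    {ae P, forall w, {within `[0, +oo[, continuous (fun t => B t w)}} ;
  bm_independent_increments : forall tau : nat -> R, 0 <= tau 0%N ->
    {homo tau : i j / (i < j)%N >-> i < j} ->
    independent_family P borel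
      (fun (i : nat) w => B (tau i.+1) w - B (tau i) w) ;
  bm_independent_coordinates : forall s t, 0 <= s -> s < t ->
    independent_family P measurable
      (fun (i : 'I_d) w => B t w 0 i - B s w 0 i) ;
  bm_gaussian : forall s t (i : 'I_d), 0 <= s -> s < t ->
    forall Y : set R, measurable Y ->
    P [set w | Y (B t w 0 i - B s w 0 i)] =
    normal_prob 0 (Num.sqrt (t - s)) Y }.

End brownian_motion.

Section perturbed_lattice.
Context {R : realType} {d : nat}.

Definition lattice_weight (theta : R) (p : 'rV[int]_d) : R :=
  expR (- (enorm (@lattice_point R d p) `^ theta)).

Definition partition_function (theta : R) : R :=
  fine (\esum_(p in [set: 'rV[int]_d]) (lattice_weight theta p)%:E).

Record lattice_perturbation {dX : measure_display} {X : measurableType dX}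
    (P : probability X R) (theta : R)
    (xi : 'rV[int]_d -> X -> 'rV[int]_d) : Prop := {
  lp_measurable : forall q (A : set 'rV[int]_d), measurable (xi q @^-1` A) ;
  lp_independent : independent_family P [set: set 'rV[int]_d] xi ;
  lp_law : forall q p, P [set w | xi q w = p] =
    ((partition_function theta)^-1 * lattice_weight theta p)%:E }.

(* [\esum] only sums nonnegative terms, hence the two opposites for u <= 0;
   the value may be -oo. *)
Definition potential (u : 'rV[R]_d -> R) (z : 'rV[int]_d -> 'rV[int]_d)
    (x : 'rV[R]_d) : \bar R :=
  (- \esum_(q in [set: 'rV[int]_d])
       (- (u (x - lattice_point q - lattice_point (z q)))%:E))%E.

Definition feynman_kac {dO : measure_display} {O : measurableType dO}
    (P : probability O R) (B : R -> O -> 'rV[R]_d)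
    (V : 'rV[R]_d -> \bar R) (t : R) : \bar R :=
  (\int[P]_w expeR (- \int[lebesgue_measure]_(s in `[0%R, t]) V (B s w)))%E.

End perturbed_lattice.

Definition Gamma {R : realType} (a : R) : R :=
  (\int[lebesgue_measure]_(x in `]0%R, +oo[) (x `^ (a - 1) * expR (- x)))%R.

Definition c_minus {R : realType} (d : nat) (theta K : R) : R :=
  2 * pi `^ (d%:R / 2) * theta * `|K| `^ (1 + d%:R / theta) /
  (d%:R * (d%:R + theta) * Gamma (d%:R / 2)).

(* Main.v *)
Require Import Defs.
From mathcomp Require Import all_boot all_order all_algebra finmap.
From mathcomp Require Import all_classical all_reals all_analysis.
From mathcomp Require Import measurable_realfun.
From mathcomp Require Import ring lra.

(** Why the limit holds. Write [M = - u 0 > 0], [g = 1 + d / theta], and call a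
    site the position q + xi_q of a displaced lattice point.  An obstacle gains
    most when the sites gather at one point: with L = p t M, bringing the site q
    to a given point z costs |z - q|^theta in the exponent and gains L, so it
    pays for the q with |z - q|^theta < L, and the total gain is

      [excess L] = sum over q of (L - |q|^theta)_+ .

    The moment is therefore of order exp (excess (p t M)), and the limit comes
    from [cvg_excess]: excess L / L^g tends to the constant c of the statement.

    Growth of the excess.  With h = L^(- 1/theta), excess L / L^g is h^d times
    the sum over q of f (exp (- |h q|^2)) for a fixed function f on [0, 1].  For
    f y = y^n the sum is the d-th power of a one-dimensional Gaussian sum, which
    is explicit up to a bounded error.  Karamata's argument ([karamata]) passes
    from monomials to f = y psi with psi continuous, by Bernstein polynomials,
    and the limit functional is an integral against the Gamma density, computed
    in [gamma_integral_test].

    Upper bound ([fk_moment_le]).  Jensen's inequality for exp, with respect to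
    the uniform law of the time s in [0, t], and then for the p-th power bound
    v^p by an average of exp (p t G z) over the lattice cells z visited by the
    motion, G z being a bound of - V on the cell of z.  The weights of the
    average depend on the motion only, so the moment is at most the supremum
    over z of the expectation of exp (p t G z).  As u decays faster than
    |x|^(-d), the sites that do not come much closer to z than |z - q|
    contribute a bounded amount to G z, and G z <= S + M N, where N counts the
    q that move by at least (1 - dl) |z - q|.  These are independent events, so
    the exponential moment of N is a product, and each factor 1 + e^L P(A_q) is
    at most the exponential of (L - k |z - q|^theta)_+ plus a summable error,
    with k close to 1 ([far_count_exp_moment]).

    Lower bound ([fk_moment_ge]).  Let finitely many q satisfy xi_q = - q; this
    has probability exp (- sum of |q|^theta) up to a lower order, and - V is
    then at least M - e times the number of these q near the origin, outside a
    null set where u may be larger.  Keeping the increments over a grid of mesh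
    1/m in tiny boxes confines the motion to a small cube during [1, t]; this
    has probability at least exp (- C t^beta), for any given beta > 1, when m is
    a small power of t, and beta < g suffices.  Between the grid times, and as
    regards the null set, the motion is controlled at each fixed time only, not
    at all times simultaneously.  This is enough, by Jensen's inequality for the
    time spent in the good set ([exp_occupation_ge]).

    The constants in both bounds do not depend on the starting point in the
    unit cube, which gives the uniformity. *)

Import Order.TTheory GRing.Theory Num.Theory.
Import numFieldNormedType.Exports.

Set Implicit Arguments.
Unset Strict Implicit.
Unset Printing Implicit Defensive.

Local Open Scope classical_set_scope.
Local Open Scope ring_scope.

(** * Lower integrals and unordered sums *)

(** The integral of a nonnegative function is a supremum over simple functions,
    so monotonicity needs no measurability.  This matters below: the integrands
    of the Feynman-Kac formula are Lebesgue measurable in space and involve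
    paths that are continuous only almost surely. *)
Lemma le_lower_integral {d} {T : measurableType d} {R : realType}
    (mu : {measure set T -> \bar R}) (D : set T) (f g : T -> \bar R) :
  (forall x, D x -> 0 <= f x)%E -> (forall x, D x -> f x <= g x)%E ->
  (\int[mu]_(x in D) f x <= \int[mu]_(x in D) g x)%E.
Proof.
move=> f0 fg; rewrite !ge0_integralE//; last by move=> x Dx; apply: le_trans (fg _ Dx); exact: f0.
apply: le_ereal_sup => _ [h /= hf <-]; exists h => //= x.
apply: le_trans (hf x) _; rewrite /patch; case: ifPn => // /[!inE]; exact: fg.
Qed.

Section esum_tools.
Context {R : realType}.

Lemma esumZ (T : choiceType) (I : set T) (f : T -> \bar R) (c : R) :
  0 <= c -> (forall i, I i -> (0 <= f i)%E) ->
  (\esum_(i in I) (c%:E * f i) = c%:E * \esum_(i in I) f i)%E.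
Proof.
have ub (a : R) (g : T -> \bar R) : 0 <= a -> (forall i, I i -> (0 <= g i)%E) ->
    (\esum_(i in I) (a%:E * g i) <= a%:E * \esum_(i in I) g i)%E.
  move=> a0 g0; apply: ge_ereal_sup => _ [X [finX XI] <-].
  pose g' i := if i \in I then g i else 0%E.
  rewrite (eq_fsbigr (fun i => a%:E * g' i)%E); last first.
    by move=> i /[!inE] /XI Ii; rewrite /g' mem_set.
  rewrite -ge0_mule_fsumr; last by move=> i; rewrite /g'; case: ifPn => // /[!inE] /g0.
  rewrite lee_wpmul2l ?lee_fin//.
  apply: ereal_sup_ubound; exists X => //; apply: eq_fsbigr => i /[!inE] /XI Ii.
  by rewrite /g' mem_set.
move=> c0 f0; have [->|cn0] := eqVneq c 0.
  by rewrite mul0e esum1// => i _; rewrite mul0e.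
have cp : 0 < c by rewrite lt_neqAle eq_sym cn0.
apply/eqP; rewrite eq_le ub//=.
rewrite -lee_pdivlMl//; apply: le_trans (ub _ _ _ _); rewrite ?invr_ge0//.
  apply: le_esum => i Ii; by rewrite muleA -EFinM mulVf// mul1e.
by move=> i Ii; rewrite mule_ge0 ?lee_fin ?f0.
Qed.

Lemma esum_rV_prod (d : nat) (g : int -> R) (s : R) : (forall k, 0 <= g k) ->
  \esum_(k in [set: int]) (g k)%:E = s%:E ->
  \esum_(q in [set: 'rV[int]_d]) (\prod_(i < d) g (q 0 i))%:E = (s ^+ d)%:E.
Proof.
move=> g0 gs; elim: d => [|d IH].
  rewrite (_ : [set: 'rV[int]_0] = [set 0]); last first.
    by apply/seteqP; split=> // x _ /=; apply/rowP => -[].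
  by rewrite esum_set1 ?big_ord0 ?expr0 ?lee_fin.
pose e (kq : int * 'rV[int]_d) : 'rV[int]_d.+1 := row_mx (kq.1%:M : 'rV_1) kq.2.
have be : set_bij ([set: int] `*`` (fun=> [set: 'rV[int]_d])) [set: 'rV[int]_d.+1] e.
  split=> //.
    move=> [k q] [k' q'] _ _ eq_e; have [] := @eq_row_mx _ 1 1 d _ _ _ _ eq_e; move=> /= /matrixP/(_ 0 0).
    by rewrite !mxE /= !mulr1n => -> ->.
  move=> v _; exists (v 0 0, rsubmx (v : 'rV_(1 + d))) => //.
  have vE : ((v 0 0)%:M : 'rV_1) = lsubmx (v : 'rV_(1 + d)).
    apply/rowP => i; rewrite !ord1 !mxE /= mulr1n; congr (v _ _); exact: val_inj.
  by rewrite /e [X in row_mx X _]vE; exact: (hsubmxK (v : 'rV_(1 + d))).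
rewrite (reindex_esum _ _ e _ be)//.
transitivity (\esum_(k in [set: int] `*`` (fun=> [set: 'rV[int]_d]))
   ((g k.1)%:E * (\prod_(i < d) g (k.2 0 i))%:E)%E).
  apply: eq_esum => -[k q] _ /=; rewrite -EFinM big_ord_recl; congr (_ * _)%:E.
    congr g; rewrite /e /=.
    rewrite (_ : ord0 = lshift d (0 : 'I_1)); last exact/val_inj.
    by have /= -> := row_mxEl (k%:M : 'rV[int]_1) q 0 0; rewrite mxE mulr1n.
  apply: eq_bigr => i _; congr g; rewrite /e /=.
  have -> : lift ord0 i = rshift 1 i by apply/val_inj.
  by have /= -> := row_mxEr (k%:M : 'rV[int]_1) q 0 i.
rewrite -(@esum_esum R _ _ [set: int] (fun=> [set: 'rV[int]_d])
  (fun k q => ((g k)%:E * (\prod_(i < d) g (q 0 i))%:E)%E)); last first.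
  by move=> k q _ _; rewrite mule_ge0 ?lee_fin ?prodr_ge0.
transitivity (\esum_(k in [set: int]) ((s ^+ d)%:E * (g k)%:E)%E).
  apply: eq_esum => k _; rewrite esumZ ?IH 1?muleC//.
  by move=> q _; rewrite lee_fin prodr_ge0.
have s0 : 0 <= s by rewrite -lee_fin -gs esum_ge0// => *; rewrite lee_fin.
by rewrite esumZ ?exprn_ge0 ?gs -?EFinM ?exprSr// => k _; rewrite lee_fin.
Qed.

Lemma esum_int (f : int -> \bar R) : (forall k, (0 <= f k)%E) ->
  (\esum_(k in [set: int]) f k =
   \sum_(n <oo) f n%:Z + \sum_(n <oo) f (- n.+1%:Z)%R)%E.
Proof.
move=> f0.
rewrite (esumID (range Posz)) ?setTI//; congr (_ + _)%E.
  rewrite (reindex_esum [set: nat] _ Posz)//.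
    by rewrite nneseries_esumT.
  split=> //; by move=> x y _ _ [].
rewrite (reindex_esum [set: nat] _ Negz)//.
  rewrite nneseries_esumT//; apply: eq_esum => n _; by rewrite NegzE.
split.
- by move=> n _ /= [].
- by move=> x y _ _ [].
- move=> [n|n] /= H; first by exfalso; apply: H; exists n.
  by exists n.
Qed.

End esum_tools.

(** * Gaussian sums over the integers *)

Section gaussian_sum.
Context {R : realType}.
Implicit Types b : R.

(** The Jacobi theta series. *)
Definition theta_sum b : R := fine (\esum_(k in [set: int]) (expR (- (b * k%:~R ^+ 2)))%:E).

Lemma integer_itv_cover : `[0%R, +oo[%classic = \bigcup_n `[n%:R, n.+1%:R[%classic :> set R.
Proof.
apply/seteqP; split=> x /=.
  rewrite in_itv/= andbT => x0; exists (Num.truncn x) => //=.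
  by rewrite in_itv/= truncn_le x0 truncnS_gt.
by move=> [n _] /=; rewrite !in_itv/= andbT => /andP[+ _]; exact: le_trans.
Qed.

Lemma trivIset_integer_itv : trivIset setT (fun n : nat => `[n%:R, n.+1%:R[%classic : set R).
Proof.
apply/trivIsetP => i j _ _ ij; rewrite -subset0 => x [] /=; rewrite !in_itv/= => /andP[ix xi] /andP[jx xj].
have := le_lt_trans ix xj; have := le_lt_trans jx xi; rewrite !ltr_nat !ltnS => ji ij'.
by move: ij; rewrite eqn_leq ji ij'.
Qed.

(** Comparison of the series with the integral of the Gaussian density over
    [0, +oo[, which is monotone there. *)
Lemma gaussian_series_bounds b : 0 < b ->
  exists a : R, [/\ (\sum_(n <oo) (expR (- (b * n.+1%:R ^+ 2)))%:E = a%:E)%E,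
    2 * Num.sqrt (b / pi) * a <= 1 &
    1 <= 2 * Num.sqrt (b / pi) * (a + 1)].
Proof.
move=> b0; pose s : R := (Num.sqrt (2 * b))^-1.
have b20 : 0 < 2 * b by rewrite mulr_gt0.
have s0 : s != 0 by rewrite invr_neq0// gt_eqF// sqrtr_gt0.
have s2 : s ^+ 2 *+ 2 = b^-1.
  rewrite exprVn sqr_sqrtr ?ltW// -mulr_natr invfM mulrAC mulVf ?mul1r//.
have peakE : normal_peak s = Num.sqrt (b / pi).
  rewrite /normal_peak -mulrnAl s2 -sqrtrV ?mulr_ge0 ?invr_ge0 ?pi_ge0 ?ltW//.
  by rewrite invfM invrK.
set c := Num.sqrt (b / pi) in peakE *.
have pdfE x : normal_pdf 0 s x = c * expR (- (b * x ^+ 2)).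
  by rewrite normal_pdfE// /normal_fun subr0 s2 invrK peakE mulNr [_ * b]mulrC.
have c0 : 0 < c by rewrite sqrtr_gt0 divr_gt0 ?pi_gt0.
have half : (\int[lebesgue_measure]_(x in `[0%R, +oo[) (normal_pdf 0 s x)%:E = (2^-1)%:E)%E.
  have := @integral_normal_pdf R 0 s.
  rewrite (@ge0_symfun_integralT R (normal_pdf 0 s)).
  - rewrite (_ : [set x | _] = `[0%R, +oo[%classic); last first.
      by apply/seteqP; split=> x /=; rewrite in_itv/= andbT.
    by move=> /(congr1 (fun z => (2^-1)%:E * z)%E); rewrite muleA -EFinM mulVf ?mul1e ?mule1//.
  - by move=> x; exact: normal_pdf_ge0.
  - exact: continuous_normal_pdf.
  - by move=> x; rewrite /= !pdfE sqrrN.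
pose P : probability (measurableTypeR R) R := normal_prob 0 s.
have Phalf : (\sum_(n <oo) P `[n%:R, n.+1%:R[%classic = (2^-1)%:E)%E.
  rewrite -half integer_itv_cover -[RHS]/(P _) measure_bigcup//; last exact: trivIset_integer_itv.
  by apply: eq_eseriesl => n; rewrite in_setT.
have mono (x y : R) : 0 <= x -> x <= y -> normal_pdf 0 s y <= normal_pdf 0 s x.
  move=> x0 xy; rewrite !pdfE ler_pM2l// ler_expR lerN2 ler_pM2l// ler_sqr ?nnegrE//.
  exact: le_trans xy.
have lebn n : lebesgue_measure (`[n%:R, n.+1%:R[%classic : set R) = 1%E.
  rewrite lebesgue_measure_itv /= lte_fin ltr_nat ltnSn -EFinD.
  by rewrite -natrB// subSnn.
have cst_int n (r : R) : (\int[lebesgue_measure]_(x in (`[n%:R, n.+1%:R[%classic : set R)) r%:E = r%:E)%E.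
  by rewrite integral_cst// [X in (_ * X)%E]lebn mule1.
have up n : (P `[n%:R, n.+1%:R[%classic <= (normal_pdf 0 s n%:R)%:E)%E.
  rewrite -[leRHS](cst_int n); apply: le_lower_integral.
    by move=> x _; rewrite lee_fin normal_pdf_ge0.
  by move=> x /=; rewrite in_itv/= => /andP[nx _]; rewrite lee_fin mono.
have lo n : ((normal_pdf 0 s n.+1%:R)%:E <= P `[n%:R, n.+1%:R[%classic)%E.
  rewrite -[leLHS](cst_int n); apply: le_lower_integral.
    by move=> x _; rewrite lee_fin normal_pdf_ge0.
  move=> x /=; rewrite in_itv/= => /andP[nx xn]; rewrite lee_fin mono ?(ltW xn)//.
  by apply: le_trans nx.
have A1 : (\sum_(n <oo) (normal_pdf 0 s n.+1%:R)%:E <= (2^-1)%:E)%E.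
  by rewrite -Phalf; apply: lee_nneseries => n *; [rewrite lee_fin normal_pdf_ge0|exact: lo].
have A2 : ((2^-1)%:E <= (normal_pdf 0 s 0)%:E + \sum_(n <oo) (normal_pdf 0 s n.+1%:R)%:E)%E.
  rewrite -Phalf (@le_trans _ _ (\sum_(n <oo) (normal_pdf 0 s n%:R)%:E)%E)//.
    by apply: lee_nneseries => n *; [exact: measure_ge0|exact: up].
  rewrite nneseries_recl//; last by move=> n; rewrite lee_fin normal_pdf_ge0.
  rewrite leeD2l//.
  rewrite -(nneseries_addn (f := fun n => (normal_pdf 0 s n%:R)%:E) 1)//.
    by under eq_eseriesr do rewrite addn1.
  by move=> i; rewrite lee_fin normal_pdf_ge0.
have AE : (\sum_(n <oo) (normal_pdf 0 s n.+1%:R)%:E = c%:E * \sum_(n <oo) (expR (- (b * n.+1%:R ^+ 2)))%:E)%E.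
  rewrite -nneseriesZl; last by move=> i _; rewrite lee_fin expR_ge0.
  by apply: eq_eseriesr => n _; rewrite pdfE EFinM.
have S0 : (0 <= \sum_(n <oo) (expR (- (b * n.+1%:R ^+ 2)))%:E)%E.
  by apply: nneseries_ge0 => n _ _; rewrite lee_fin expR_ge0.
case ES : (\sum_(n <oo) (expR (- (b * n.+1%:R ^+ 2)))%:E)%E S0 AE => [a||] // a0 AE.
- exists a; split=> //.
  + move: A1; rewrite AE -EFinM lee_fin; lra.
  + move: A2; rewrite AE pdfE expr0n/= mulr0 oppr0 expR0 -EFinM -EFinD lee_fin; lra.
- by move: A1; rewrite AE gt0_muley ?lte_fin// leye_eq.
Qed.

Lemma theta_sum_bounds b : 0 < b ->
  \esum_(k in [set: int]) (expR (- (b * k%:~R ^+ 2)))%:E = (theta_sum b)%:E /\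
  `|Num.sqrt (b / pi) * theta_sum b - 1| <= Num.sqrt (b / pi).
Proof.
move=> b0; have [a [aE a1 a2]] := gaussian_series_bounds b0.
have E : \esum_(k in [set: int]) (expR (- (b * k%:~R ^+ 2)))%:E = (2 * a + 1)%:E.
  rewrite esum_int; last by move=> k; rewrite lee_fin expR_ge0.
  rewrite nneseries_recl//.
  have -> : (\sum_(n <oo) (expR (- (b * (- n.+1%:Z)%:~R ^+ 2)))%:E = a%:E)%E.
    by rewrite -aE; apply: eq_eseriesr => n _; rewrite mulrNz sqrrN.
  rewrite -(nneseries_addn (f := fun n : nat => (expR (- (b * (n%:Z)%:~R ^+ 2)))%:E) 1)//.
  under eq_eseriesr do rewrite addn1.
  rewrite aE expr0n/= mulr0 oppr0 expR0 -!EFinD; congr EFin; lra.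
have gE : theta_sum b = 2 * a + 1 by rewrite /theta_sum E.
split; first by rewrite gE.
rewrite gE; set c := Num.sqrt _ in a1 a2 *.
rewrite ler_norml; apply/andP; split; lra.
Qed.

End gaussian_sum.

(** * Bernstein polynomials and Karamata's theorem *)

Section bernstein.
Context {R : realType}.
Implicit Types (g : nat -> R) (y : R) (psi : R -> R).

(** The expectation of g (S_n) for a binomial variable S_n of parameters n and y,
    by conditioning on the first trial.  This recursion avoids binomial
    coefficients, and makes it evident that the polynomial is a nonnegative
    combination of monomials y^a (1 - y)^b when g is nonnegative. *)
Fixpoint bernstein (n : nat) g y : R :=
  if n is m.+1 then y * bernstein m (g \o S) y + (1 - y) * bernstein m g y
  else g 0%N.

Lemma bernstein_le n g h y : 0 <= y <= 1 ->
  (forall k, (k <= n)%N -> g k <= h k) -> bernstein n g y <= bernstein n h y.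
Proof.
move=> /andP[y0 y1]; elim: n g h => [|n IH] g h gh /=; first exact: gh.
apply: lerD; apply: ler_wpM2l; rewrite ?subr_ge0//; apply: IH => k kn.
  exact: gh.
by apply: gh; rewrite (leq_trans kn).
Qed.

Lemma bernstein_cst n c y : bernstein n (fun=> c) y = c.
Proof. by elim: n => //= n IH; rewrite [X in y * bernstein n X y](_ : _ = fun=> c)// !IH; ring. Qed.

Lemma bernsteinD n g h y :
  bernstein n (fun k => g k + h k) y = bernstein n g y + bernstein n h y.
Proof.
elim: n g h => [//|n IH] g h /=; rewrite IH.
rewrite [X in y * bernstein n X y](_ : _ = fun k => (g \o S) k + (h \o S) k)// IH; ring.
Qed.

Lemma bernsteinZ n c g y : bernstein n (fun k => c * g k) y = c * bernstein n g y.
Proof.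
elim: n g => [//|n IH] g /=; rewrite IH.
rewrite [X in y * bernstein n X y](_ : _ = fun k => c * (g \o S) k)// IH; ring.
Qed.

(** The shift c makes the induction go through; c = 0 is the binomial variance. *)
Lemma bernstein_variance n c y :
  bernstein n (fun k => (k%:R - n%:R * y + c) ^+ 2) y = n%:R * y * (1 - y) + c ^+ 2.
Proof.
elim: n c => [|n IH] c /=; first by rewrite !mul0r subr0 !add0r.
rewrite [X in y * bernstein n X y](_ : _ = fun k => (k%:R - n%:R * y + (1 - y + c)) ^+ 2); last first.
  by apply/funext => k /=; rewrite -natr1 -[n.+1%:R]natr1; ring.
rewrite [X in (1 - y) * bernstein n X y](_ : _ = fun k => (k%:R - n%:R * y + (c - y)) ^+ 2); last first.
  by apply/funext => k /=; rewrite -[n.+1%:R]natr1; ring.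
rewrite !IH -[n.+1%:R]natr1; ring.
Qed.

(** Heine and Cantor, by the covering form of the compactness of [0, 1]. *)
Lemma uniformly_continuous01 psi : continuous psi -> forall eta : R, 0 < eta ->
  exists2 r : R, 0 < r & forall a b : R, 0 <= a <= 1 -> `|a - b| < r -> `|psi a - psi b| <= eta.
Proof.
move=> cpsi eta eta0.
pose P (r a : R) := forall b, `|a - b| < r -> `|psi a - psi b| <= eta.
have /compact_near_coveringP/(_ R (0 : R)^'+ P _) : compact `[0 : R, 1]%classic by exact: segment_compact.
case=> [x _|r r0 rP].
  have /cvgrPdist_lt/(_ _ (divr_gt0 eta0 (ltr0n _ 2))) [e /= e0 eP] := cpsi x.
  have e2 : 0 < e / 2 by rewrite divr_gt0.
  near=> a r => b /= ab.
  have xa : `|x - a| < e / 2 by near: a; exact: nbhsx_ballx.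
  have re : r < e / 2 by near: r; exact: nbhs_right_lt.
  have xb : `|x - b| < e by apply: le_lt_trans (ler_distD a _ _) _; lra.
  have := eP b xb; have : `|psi x - psi a| < eta / 2 by apply: eP => /=; lra.
  by rewrite /= distrC => ? ?; apply: le_trans (ler_distD (psi x) _ _) _; lra.
have r2 : 0 < r / 2 by rewrite divr_gt0.
exists (r / 2) => // a b a01; apply: (rP (r / 2)) => //=.
by rewrite sub0r normrN gtr0_norm// ltr_pdivrMr// ltr_pMr// ltr1n.
Unshelve. all: by end_near. Qed.

(** Chebyshev's proof of the Weierstrass theorem: psi varies by at most eta / 2
    near y, and by at most 2 K (k/n - y)^2 / dl^2 farther away. *)
Lemma bernstein_approx psi : continuous psi ->
  (exists K : R, forall a : R, 0 <= a <= 1 -> `|psi a| <= K) ->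
  forall eta : R, 0 < eta -> exists n, forall y, 0 <= y <= 1 ->
    `|bernstein n (fun k => psi (k%:R / n%:R)) y - psi y| <= eta.
Proof.
move=> cpsi [K psiK] eta eta0.
have [dl dl0 ucdl] := uniformly_continuous01 cpsi (divr_gt0 eta0 (ltr0n _ 2)).
have K0 : 0 <= K by apply: le_trans (psiK 0 _); rewrite ?lexx ?ler01.
pose c := 2 * K / dl ^+ 2; have c0 : 0 <= c by rewrite divr_ge0 ?mulr_ge0 ?exprn_ge0// ltW.
pose n := (Num.truncn (c * 2 / eta)).+1.
have n0 : 0 < n%:R :> R by rewrite ltr0n.
have nc : c / n%:R <= eta / 2.
  rewrite ler_pdivrMr// mulrC -ler_pdivrMr; last by rewrite divr_gt0.
  have := ltW (truncnS_gt (c * 2 / eta)); apply: le_trans.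
  by rewrite invf_div mulrA.
exists n => y y01; have /andP[y0 y1] := y01.
have key k : (k <= n)%N -> `|psi (k%:R / n%:R) - psi y| <=
    eta / 2 + c / n%:R ^+ 2 * (k%:R - n%:R * y + 0) ^+ 2.
  move=> kn; have k01 : 0 <= (k%:R / n%:R : R) <= 1.
    by rewrite divr_ge0 ?ler0n//= ler_pdivrMr// mul1r ler_nat.
  have [kd|kd] := ltP `|k%:R / n%:R - y| dl.
    apply: le_trans (ucdl _ _ k01 kd) _; rewrite lerDl mulr_ge0 ?sqr_ge0//.
    by rewrite divr_ge0// exprn_ge0// ltW.
  apply: (@le_trans _ _ (K + K)).
    apply: le_trans (ler_normB _ _) _; apply: lerD; exact: psiK.
  have -> : c / n%:R ^+ 2 * (k%:R - n%:R * y + 0) ^+ 2 = c * (k%:R / n%:R - y) ^+ 2.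
    by field; rewrite gt_eqF.
  apply: (@le_trans _ _ (c * dl ^+ 2)).
    by rewrite /c divfK ?expf_neq0 ?gt_eqF//; lra.
  apply: (@le_trans _ _ (c * (k%:R / n%:R - y) ^+ 2)); last by rewrite lerDr; lra.
  rewrite ler_wpM2l// -[leRHS]real_normK ?num_real// ler_sqr ?nnegrE// ltW//.
have tot : bernstein n (fun k => eta / 2 + c / n%:R ^+ 2 * (k%:R - n%:R * y + 0) ^+ 2) y <= eta.
  rewrite bernsteinD bernstein_cst bernsteinZ bernstein_variance.
  have : c / n%:R ^+ 2 * (n%:R * y * (1 - y) + 0 ^+ 2) <= c / n%:R.
    have -> : c / n%:R ^+ 2 * (n%:R * y * (1 - y) + 0 ^+ 2) = c / n%:R * (y * (1 - y)).
      by field; rewrite gt_eqF.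
    rewrite ler_piMr ?divr_ge0 ?ler0n//; nra.
  by move=> h; apply: le_trans (lerD (lexx _) (le_trans h nc)) _; lra.
rewrite ler_norml; apply/andP; split.
  rewrite lerNl opprB lerBlDr.
  have : bernstein n (fun=> psi y) y <= bernstein n (fun k => (eta / 2 + c / n%:R ^+ 2 * (k%:R - n%:R * y + 0) ^+ 2) + psi (k%:R / n%:R)) y.
    apply: bernstein_le => // k /key; rewrite ler_norml => /andP[+ _]; lra.
  rewrite bernstein_cst bernsteinD; lra.
have : bernstein n (fun k => psi (k%:R / n%:R)) y <= bernstein n (fun k => (eta / 2 + c / n%:R ^+ 2 * (k%:R - n%:R * y + 0) ^+ 2) + (fun=> psi y) k) y.
  apply: bernstein_le => // k /key; rewrite ler_norml => /andP[_ +]; lra.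
rewrite bernsteinD bernstein_cst; lra.
Qed.

End bernstein.

Section karamata.
Context {R : realType}.
Implicit Types (f g : R -> R).

(** The bound by C y restricts the functions to those whose sums over the lattice
    and integrals against the Gamma density converge, with y = e^{-s}. *)
Definition linearly_dominated f := measurable_fun setT f /\
  exists C, forall y, 0 <= y <= 1 -> 0 <= f y <= C * y.

Lemma linearly_dominatedD f g : linearly_dominated f -> linearly_dominated g -> linearly_dominated (fun y => f y + g y).
Proof.
move=> [mf [C fC]] [mg [C' gC]]; split; first exact: measurable_funD.
exists (C + C') => y y01; have /andP[? ?] := fC _ y01; have /andP[? ?] := gC _ y01.
by rewrite addr_ge0//= mulrDl lerD.
Qed.

Lemma linearly_dominatedZ c f : 0 <= c -> linearly_dominated f -> linearly_dominated (fun y => c * f y).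
Proof.
move=> c0 [mf [C fC]]; split; first exact: measurable_funM.
exists (c * C) => y y01; have /andP[? ?] := fC _ y01.
by rewrite mulr_ge0//= -mulrA ler_wpM2l.
Qed.

Lemma linearly_dominated_monomial a b : linearly_dominated (fun y => y ^+ a.+1 * (1 - y) ^+ b).
Proof.
split.
  apply: measurable_funM; first exact: measurable_funX.
  by apply: measurable_funX; apply: measurable_funB.
exists 1 => y /andP[y0 y1]; have y1' : 0 <= 1 - y by rewrite subr_ge0.
rewrite mulr_ge0 ?exprn_ge0//= mul1r exprS -mulrA ler_piMr// mulr_ile1 ?exprn_ge0 ?exprn_ile1//.
lra.
Qed.

(** Homogeneity is for nonnegative scalars because the functions of the domain are
    nonnegative on [0, 1]. *)
Record positive_functional (T : (R -> R) -> R) : Prop := {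
  pfD : forall f g, linearly_dominated f -> linearly_dominated g -> T (fun y => f y + g y) = T f + T g ;
  pfZ : forall c f, 0 <= c -> linearly_dominated f -> T (fun y => c * f y) = c * T f ;
  pf_le : forall f g, linearly_dominated f -> linearly_dominated g ->
    (forall y, 0 <= y <= 1 -> f y <= g y) -> T f <= T g }.

Context {I : Type} (F : set_system I) {FF : ProperFilter F}.
Variables (Th : I -> (R -> R) -> R) (T : (R -> R) -> R).
Hypothesis pTh : forall i, positive_functional (Th i).
Hypothesis pT : positive_functional T.
Hypothesis Thmono : forall n, Th i (fun y => y ^+ n.+1) @[i --> F] --> T (fun y => y ^+ n.+1).

Let cvgT f := Th i f @[i --> F] --> T f.

(** By induction on b, from y^a (1 - y)^(b+1) = y^a (1 - y)^b - y^(a+1) (1 - y)^b. *)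
Lemma cvg_monomial a b : cvgT (fun y => y ^+ a.+1 * (1 - y) ^+ b).
Proof.
elim: b a => [|b IH] a.
  have -> : (fun y : R => y ^+ a.+1 * (1 - y) ^+ 0) = (fun y => y ^+ a.+1).
    by apply/funext => y; rewrite expr0 mulr1.
  exact: Thmono.
pose f c y : R := y ^+ c.+1 * (1 - y) ^+ b.
have split_eq U : positive_functional U ->
    U (fun y => y ^+ a.+1 * (1 - y) ^+ b.+1) = U (f a) - U (f a.+1).
  move=> pU; apply/eqP; rewrite eq_sym subr_eq -pfD//; last 2 first.
  - exact: linearly_dominated_monomial.
  - exact: linearly_dominated_monomial.
  apply/eqP; congr (U _); apply/funext => y; rewrite /f exprS [in RHS]exprS !exprS; ring.
rewrite /cvgT split_eq//; under eq_fun do rewrite split_eq//.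
apply: cvgB; exact: IH.
Qed.

(** The prefactor y^(a+1) (1 - y)^b absorbs one factor at each step of the
    recursion that defines the polynomial. *)
Lemma cvg_bernstein n (g : nat -> R) a b : (forall k, 0 <= g k) ->
  linearly_dominated (fun y => y ^+ a.+1 * (1 - y) ^+ b * bernstein n g y) /\
  cvgT (fun y => y ^+ a.+1 * (1 - y) ^+ b * bernstein n g y).
Proof.
elim: n a b g => [|n IH] a b g g0 /=.
  have E : (fun y : R => y ^+ a.+1 * (1 - y) ^+ b * g 0%N) = (fun y => g 0%N * (y ^+ a.+1 * (1 - y) ^+ b)).
    by apply/funext => y; rewrite mulrC.
  rewrite E; split; first by apply: linearly_dominatedZ => //; exact: linearly_dominated_monomial.
  rewrite /cvgT pfZ//; last exact: linearly_dominated_monomial.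
  under eq_fun do (rewrite pfZ//; last exact: linearly_dominated_monomial).
  apply: cvgM; [exact: cvg_cst|exact: cvg_monomial].
have [d1 c1] := IH a.+1 b (g \o S) (fun k => g0 k.+1).
have [d2 c2] := IH a b.+1 g g0.
have E : (fun y : R => y ^+ a.+1 * (1 - y) ^+ b * (y * bernstein n (g \o S) y + (1 - y) * bernstein n g y))
  = (fun y => y ^+ a.+2 * (1 - y) ^+ b * bernstein n (g \o S) y + y ^+ a.+1 * (1 - y) ^+ b.+1 * bernstein n g y).
  by apply/funext => y; rewrite !exprS; ring.
rewrite E; split; first exact: linearly_dominatedD.
rewrite /cvgT pfD//; under eq_fun do rewrite pfD//.
exact: cvgD.
Qed.

(** Sandwich y psi between y (B - eta) and y (B + eta), with B a Bernstein
    polynomial of psi; positivity turns this into an error eta T(y), uniformly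
    along the filter because the functionals converge at y itself. *)
Lemma karamata (psi : R -> R) : continuous psi ->
  (exists K : R, forall a : R, 0 <= a <= 1 -> `|psi a| <= K) ->
  (forall a, 0 <= psi a) ->
  cvgT (fun y => y * psi y).
Proof.
move=> cpsi [K psiK] psi0.
have mpsi : measurable_fun setT psi by exact: continuous_measurable_fun.
pose id1 := fun y : R => y.
have d1 : linearly_dominated id1.
  split; first exact: measurable_id.
  by exists 1 => y /andP[y0 _]; rewrite y0 mul1r lexx.
have c1 : cvgT id1.
  by exact: (@Thmono 0%N).
have df : linearly_dominated (fun y => y * psi y).
  split; first exact: measurable_funM.
  exists K => y y01; have /andP[y0 _] := y01.
  rewrite mulr_ge0//= mulrC ler_wpM2r//; apply: le_trans (psiK _ y01); exact: ler_norm.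
have T10 : 0 <= T id1.
  have <- : T (fun y => 0 * id1 y) = 0 by rewrite pfZ// mul0r.
  apply: pf_le => //; first exact: linearly_dominatedZ.
  by move=> y /andP[y0 y1]; rewrite mul0r.
apply/cvgrPdist_le => e e0.
pose eta := e / (4 * (T id1 + 1)).
have eta0 : 0 < eta by rewrite divr_gt0// mulr_gt0// ltr_wpDl.
have [n bn] := @bernstein_approx _ psi cpsi (ex_intro _ K psiK) _ eta0.
pose g k := psi (k%:R / n%:R).
have [dB cB] := cvg_bernstein n (g := g) 0 0 (fun k => psi0 _).
pose B := (fun y : R => y ^+ 1 * (1 - y) ^+ 0 * bernstein n g y).
have de : linearly_dominated (fun y => eta * id1 y) by apply: linearly_dominatedZ => //; exact: ltW.
have close U : positive_functional U -> `|U (fun y => y * psi y) - U B| <= eta * U id1.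
  move=> pU; rewrite ler_norml; apply/andP; split.
    rewrite lerNl opprB lerBlDl -pfZ -?pfD ?(ltW eta0)//; apply: pf_le => //; first exact: linearly_dominatedD.
    move=> y y01; have := bn y y01; have /andP[y0 y1] := y01; rewrite ler_norml => /andP[h1 h2].
    rewrite /B expr0 expr1 mulr1 /id1 /g; nra.
  rewrite lerBlDl -pfZ -?pfD ?(ltW eta0)//; apply: pf_le => //; first exact: linearly_dominatedD.
  move=> y y01; have := bn y y01; have /andP[y0 y1] := y01; rewrite ler_norml => /andP[h1 h2].
  rewrite /B expr0 expr1 mulr1 /id1 /g; nra.
have etaT : eta * (T id1 + 1) = e / 4.
  by rewrite /eta; field; rewrite gt_eqF// ltr_wpDl.
have e4 : 0 < e / 4 by rewrite divr_gt0.
near=> i.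
have h1 : `|T B - Th i B| <= e / 4.
  by near: i; move/cvgrPdist_le : cB; exact.
have h2 : `|T id1 - Th i id1| <= 1.
  by near: i; move/cvgrPdist_le : c1; exact.
have h3 := close _ pT; have h4 := close _ (pTh i).
have h5 : eta * Th i id1 <= e / 4.
  rewrite -etaT ler_pM2l//; move: h2; rewrite ler_norml; lra.
have h6 : eta * T id1 <= e / 4 by rewrite -etaT ler_pM2l//; lra.
move: h1 h3 h4; rewrite !ler_norml; lra.
Unshelve. all: by end_near. Qed.

End karamata.

(** * The test function of the lattice excess *)

Lemma continuous_powR_pos {R : realType} (a x : R) : 0 < x -> {for x, continuous (fun y : R => y `^ a)}.
Proof.
by move=> x0; apply/differentiable_continuous/derivable1_diffP; exact: (ex_derive (is_derive := is_derive1_powR a x0)).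
Qed.

Section test_function.
Context {R : realType}.
Variable dl : R.
Hypothesis dl0 : 0 < dl.

Lemma powR_le1 (x : R) : 0 <= x <= 1 -> x `^ dl <= 1.
Proof.
move=> /andP[x0 x1]; have -> : 1 = 1 `^ dl by rewrite powR1.
by rewrite ge0_ler_powR ?nnegrE// ltW.
Qed.

Lemma powR_ge1 (x : R) : 1 <= x -> 1 <= x `^ dl.
Proof.
move=> x1; have -> : 1 = 1 `^ dl by rewrite powR1.
by rewrite ge0_ler_powR ?nnegrE ?ler01 ?(le_trans ler01 x1) ?(ltW dl0).
Qed.

(** The absolute value matters: a power of a negative number is 1. *)
Lemma continuous_normr_powR : continuous (fun s : R => `|s| `^ dl).
Proof.
move=> s; have [->|s0] := eqVneq s 0; last first.
  apply: (@continuous_comp _ _ _ (fun s : R => `|s|) (fun y => y `^ dl)); first exact: norm_continuous.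
  by apply: continuous_powR_pos; rewrite normr_gt0.
apply/cvgrPdist_lt => e e0; near=> x.
rewrite normr0 powR0 ?gt_eqF// sub0r normrN ger0_norm ?powR_ge0//.
have -> : e = (e `^ dl^-1) `^ dl by rewrite -powRrM mulVf ?gt_eqF// powRr1// ltW.
rewrite gt0_ltr_powR ?nnegrE ?powR_ge0// -[x]subr0 distrC.
by near: x; exists (e `^ dl^-1) => //=; rewrite powR_gt0.
Unshelve. all: by end_near. Qed.

Let E : R := expR 1.
Let E1 : 1 <= E. Proof. by rewrite -expR0 ler_expR. Qed.
Let E0 : 0 < E. Proof. exact: expR_gt0. Qed.
Let clamp (y : R) : R := Num.min (Num.max y E^-1) 1.

Let clampP y : E^-1 <= clamp y <= 1.
Proof.
rewrite /clamp ge_min lexx orbT andbT le_min le_max lexx orbT/=.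
by rewrite invf_le1.
Qed.

(** The function psi such that y psi y = (1 - s^dl)_+ for y = e^{-s}; the clamping
    of y to [1/e, 1] keeps s in [0, 1] and makes psi vanish for s >= 1. *)
Definition karamata_test (y : R) : R :=
  (1 - (- ln (clamp y)) `^ dl) / clamp y.

Let nln_clamp y : 0 <= - ln (clamp y) <= 1.
Proof.
have /andP[h1 h2] := clampP y.
have c0 : 0 < clamp y by apply: lt_le_trans h1; rewrite invr_gt0.
rewrite oppr_ge0 ln_le0//= lerNl -(expRK (-1)) ler_ln ?posrE ?expR_gt0//.
by rewrite expRN.
Qed.

Let num_ge0 y : 0 <= 1 - (- ln (clamp y)) `^ dl <= 1.
Proof.
have /andP[h1 h2] := nln_clamp y.
by rewrite gerBl powR_ge0 andbT subr_ge0 powR_le1// h1.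
Qed.

Lemma karamata_test_ge0 y : 0 <= karamata_test y.
Proof.
have /andP[h1 h2] := num_ge0 y; have /andP[h3 h4] := clampP y.
by rewrite divr_ge0//; apply: le_trans h3; rewrite invr_ge0 ltW.
Qed.

Lemma karamata_test_bounded : exists K, forall a, 0 <= a <= 1 -> `|karamata_test a| <= K.
Proof.
exists E => y _; rewrite ger0_norm ?karamata_test_ge0//.
have /andP[h1 h2] := num_ge0 y; have /andP[h3 h4] := clampP y.
have c0 : 0 < clamp y by apply: lt_le_trans h3; rewrite invr_gt0.
rewrite ler_pdivrMr//; apply: le_trans h2 _.
by rewrite mulrC -ler_pdivrMr// div1r.
Qed.

Lemma continuous_karamata_test : continuous karamata_test.
Proof.
have c0 y : 0 < clamp y by have /andP[h _] := clampP y; apply: lt_le_trans h; rewrite invr_gt0.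
have cc : continuous clamp.
  move=> y; apply: (@continuous_min _ _ (fun y => Num.max y E^-1) (fun=> 1)); last exact: cvg_cst.
  by apply: (@continuous_max _ _ id (fun=> E^-1)); [exact: cvg_id|exact: cvg_cst].
have -> : karamata_test = (fun y => (1 - `|- ln (clamp y)| `^ dl) / clamp y).
  by apply/funext => y; rewrite ger0_norm//; have /andP[] := nln_clamp y.
move=> y; apply: cvgM; last by apply: cvgV; [rewrite gt_eqF|exact: cc].
apply: cvgB; first exact: cvg_cst.
have cl : - ln (clamp x) @[x --> y] --> - ln (clamp y).
  apply: cvgN; apply: (@continuous_comp _ _ _ clamp (@ln R)); first exact: cc.
  exact: continuous_ln.
exact: (cvg_comp _ _ cl (@continuous_normr_powR _)).
Qed.

Lemma karamata_testE (s : R) : 0 <= s ->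
  expR (- s) * karamata_test (expR (- s)) = Num.max 0 (1 - s `^ dl).
Proof.
move=> s0; rewrite /karamata_test /clamp.
have e1 : expR (- s) <= 1 by rewrite -expR0 ler_expR oppr_le0.
have [s1|s1] := leP s 1.
  have h : E^-1 <= expR (- s) by rewrite -expRN ler_expR lerN2.
  rewrite (max_l h) (min_l e1) expRK opprK mulrCA divff ?gt_eqF ?expR_gt0// mulr1.
  by rewrite max_r// subr_ge0 powR_le1// s0.
have h : expR (- s) <= E^-1 by rewrite -expRN ler_expR lerN2 ltW.
rewrite (max_r h) min_l ?invf_le1// -expRN expRK opprK powR1 subrr mul0r mulr0.
by rewrite max_l// subr_le0 powR_ge1// ltW.
Qed.

End test_function.

(** * Integrals against the Gamma density *)

Section gamma_integrals.
Context {R : realType}.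
Notation mu := (@lebesgue_measure R).

(** The inequality y <= e^y at y = eta x / a, raised to the power a. *)
Lemma powR_le_expR (a eta : R) : 0 < a -> 0 < eta ->
  forall x : R, 0 <= x -> x `^ a <= (a / eta) `^ a * expR (eta * x).
Proof.
move=> a0 e0 x x0.
have h : eta * x / a <= expR (eta * x / a).
  by apply: le_trans (expR_ge1Dx _); rewrite lerDr.
have xE : x = (a / eta) * (eta * x / a) by field; rewrite !gt_eqF.
have ae0 : 0 <= a / eta by rewrite divr_ge0 ?ltW.
have ex0 : 0 <= eta * x / a by rewrite divr_ge0 ?mulr_ge0// ltW.
rewrite [in leLHS]xE powRM// ler_wpM2l ?powR_ge0//.
apply: (@le_trans _ _ (expR (eta * x / a) `^ a)).
  by rewrite ge0_ler_powR ?nnegrE ?expR_ge0// ltW.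
rewrite -expRM le_eqVlt; apply/orP; left; apply/eqP; congr expR; field; rewrite !gt_eqF//.
Qed.

Lemma derivable_right_of_zero (f : R -> R) : (forall x, 0 < x -> derivable f x 1) ->
  forall a b : R, 0 < a -> a < b -> derivable_oo_LRcontinuous f a b.
Proof.
move=> df a b a0 ab.
have cf (x : R) : 0 < x -> {for x, continuous f}.
  by move=> x0; apply/differentiable_continuous/derivable1_diffP/df.
split.
- by move=> x; rewrite in_itv/= => /andP[ax xb]; apply: df; exact: lt_trans ax.
- by apply: cvg_at_right_filter; apply: cf.
- by apply: cvg_at_left_filter; apply: cf; exact: lt_trans ab.
Qed.

Lemma within_continuous_pos (f : R -> R) : (forall x : R, 0 < x -> {for x, continuous f}) ->
  forall A : set R, (forall x, A x -> 0 < x) -> {within A, continuous f}.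
Proof.
by move=> cf A A0; apply: continuous_in_subspaceT => x /[!inE] /A0 /cf.
Qed.

Lemma cvg_inv_S2 : (i.+2%:R : R)^-1 @[i --> \oo] --> (0 : R)^'+.
Proof.
have h : (i.+2%:R : R)^-1 @[i --> \oo] --> (0 : R).
  have := @cvg_harmonic R; rewrite -(cvg_shiftn 1)/=.
  by under eq_fun do rewrite addn1.
move=> P [e e0 Pe]; have /cvgrPdist_lt/(_ _ e0) := h.
move=> /filterS; apply => i /= hi.
by apply: Pe => //=.
Qed.

Lemma bigcup_itv_inv01 : \bigcup_i `[(i.+2%:R : R)^-1, 1%R]%classic = `]0%R, 1%R]%classic.
Proof.
apply/seteqP; split=> x /=.
  move=> [i _] /=; rewrite !in_itv/= => /andP[h ->]; rewrite andbT.
  by apply: lt_le_trans h; rewrite invr_gt0.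
rewrite in_itv/= => /andP[x0 x1]; exists (Num.truncn x^-1) => //=.
rewrite in_itv/= x1 andbT -[leRHS]invrK lef_pV2 ?posrE ?invr_gt0//.
apply: ltW; apply: (lt_trans (truncnS_gt _)).
by rewrite ltr_nat.
Qed.

Lemma bigcup_itv_invy : \bigcup_i `[(i.+2%:R : R)^-1, +oo[%classic = `]0%R, +oo[%classic.
Proof.
apply/seteqP; split=> x /=.
  move=> [i _] /=; rewrite !in_itv/= !andbT => h.
  by apply: lt_le_trans h; rewrite invr_gt0.
rewrite in_itv/= andbT => x0; exists (Num.truncn x^-1) => //=.
rewrite in_itv/= andbT -[leRHS]invrK lef_pV2 ?posrE ?invr_gt0//.
apply: ltW; apply: (lt_trans (truncnS_gt _)).
by rewrite ltr_nat.
Qed.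

(** The integrand is unbounded at 0 when g < 1: the fundamental theorem of calculus
    applies on [1 / (i + 2), 1], and monotone convergence gives the rest. *)
Lemma integral_powR01 (g : R) : 0 < g ->
  (\int[mu]_(x in `]0%R, 1%R]) (x `^ (g - 1))%:E = (g^-1)%:E)%E.
Proof.
move=> g0; rewrite -bigcup_itv_inv01.
pose F x : R := g^-1 * x `^ g.
have dF (x : R) : 0 < x -> is_derive x (1 : R) F (x `^ (g - 1)).
  move=> x0; have := is_deriveZ (f := fun y => y `^ g) g^-1 (is_derive1_powR g x0).
  by rewrite /GRing.scale/= mulrA mulVf ?gt_eqF// mul1r.
have step i : (\int[mu]_(x in `[i.+2%:R^-1%R, 1%R]) (x `^ (g - 1))%:E
    = (g^-1 - g^-1 * (i.+2%:R^-1) `^ g)%:E)%E.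
  have i0 : 0 < (i.+2%:R : R)^-1 by rewrite invr_gt0.
  have i1 : (i.+2%:R : R)^-1 < 1 by rewrite invf_lt1 ?ltr1n ?ltr0n.
  rewrite (@continuous_FTC2 _ _ F)//.
  - by rewrite -EFinB /F powR1 mulr1.
  - apply: within_continuous_pos; first exact: continuous_powR_pos.
    by move=> x /=; rewrite in_itv/= => /andP[+ _]; exact: lt_le_trans.
  - apply: derivable_right_of_zero => // x x0; exact: (ex_derive (is_derive := dF x x0)).
  - move=> x; rewrite in_itv/= => /andP[ix _].
    have x0 : 0 < x by exact: lt_trans ix.
    by rewrite derive1E (derive_val (is_derive := dF x x0)).
have c1 : (\int[mu]_(x in `[i.+2%:R^-1%R, 1%R]) (x `^ (g - 1))%:E)%E @[i --> \oo] -->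
   (\int[mu]_(x in \bigcup_i `[i.+2%:R^-1%R, 1%R]%classic) (x `^ (g - 1))%:E)%E.
  apply: ge0_nondecreasing_set_cvg_integral => //.
  - apply/nondecreasing_seqP => n; apply/subsetPset => x /=.
    rewrite !in_itv/= => /andP[h ->]; rewrite andbT; apply: le_trans h.
    by rewrite lef_pV2 ?posrE// ler_nat.
  - by move=> i; apply/measurable_EFinP; apply: (measurable_funS (E := setT)).
  - by move=> i x _; rewrite lee_fin powR_ge0.
have c2 : (\int[mu]_(x in `[i.+2%:R^-1%R, 1%R]) (x `^ (g - 1))%:E)%E @[i --> \oo] --> (g^-1)%:E.
  under eq_fun do rewrite step.
  apply: cvg_EFin; first by near=> i.
  rewrite /comp/= -[X in _ --> X]subr0 -[X in _ --> _ - X](mulr0 g^-1).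
  apply: cvgB; first exact: cvg_cst.
  apply: cvgM; first exact: cvg_cst.
  exact: (@cvg_comp _ _ _ (fun i : nat => (i.+2%:R : R)^-1) (fun a => a `^ g) _ _ _ cvg_inv_S2 (powR_cvg0 g0)).
exact: (cvg_unique _ c1 c2).
Unshelve. all: by end_near. Qed.

Variable b : R.
Hypothesis b0 : 0 < b.

Definition gamma_integral (f : R -> R) : \bar R :=
  (\int[mu]_(s in `]0%R, +oo[) (s `^ (b - 1) * f (expR (- s)))%:E)%E.

Lemma measurable_gamma_integrand f : measurable_fun setT f ->
  measurable_fun setT (fun s : R => (s `^ (b - 1) * f (expR (- s)))%:E).
Proof.
move=> mf; apply/measurable_EFinP; apply: measurable_funM => //.
apply: (measurableT_comp mf); apply: (measurableT_comp (@measurable_expR R)) => //.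
Qed.

Lemma itv0y_setU1 : `]0%R, +oo[%classic = `]0%R, 1%R] `|` `]1%R, +oo[ :> set R.
Proof.
apply/seteqP; split=> x /=; rewrite !in_itv/= ?andbT.
  by move=> ->/=; case: (leP x 1) => h; [left|right].
by move=> [/andP[]//|h]; exact: lt_trans h.
Qed.

Lemma gamma_integral_split : gamma_integral id =
  (\int[mu]_(s in `]0%R, 1%R]) (s `^ (b - 1) * expR (- s))%:E +
   \int[mu]_(s in `]1%R, +oo[) (s `^ (b - 1) * expR (- s))%:E)%E.
Proof.
rewrite /gamma_integral itv0y_setU1 ge0_integral_setU//=.
- by apply: measurable_funTS; exact: (@measurable_gamma_integrand id (@measurable_id _ R setT)).
- by move=> x _; rewrite lee_fin mulr_ge0 ?powR_ge0 ?expR_ge0.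
- apply/disj_setPRL => x /=; rewrite !in_itv/= andbT => h; rewrite andbC.
  by apply/negP; rewrite negb_and -ltNge h.
Qed.

Lemma gamma_integral_id_lty : (gamma_integral id < +oo)%E.
Proof.
rewrite gamma_integral_split; apply: lte_add_pinfty.
  apply: (@le_lt_trans _ _ (\int[mu]_(x in `]0%R, 1%R]) (x `^ (b - 1))%:E)%E).
    apply: le_lower_integral => x /=; rewrite in_itv/= => /andP[x0 x1].
      by rewrite lee_fin mulr_ge0 ?powR_ge0 ?expR_ge0.
    by rewrite lee_fin ler_piMr ?powR_ge0// -expR0 ler_expR oppr_le0 ltW.
  by rewrite integral_powR01// ltry.
pose C : R := (b / 2^-1) `^ b; have C0 : 0 <= 2 * C by rewrite mulr_ge0 ?powR_ge0.
have h0 : 0 < 2^-1 :> R by rewrite invr_gt0.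
have pdf0 (x : R) : 0 <= exponential_pdf 2^-1 x by apply: exponential_pdf_ge0; exact: ltW.
apply: (@le_lt_trans _ _ (\int[mu]_x ((2 * C)%:E * (exponential_pdf 2^-1 x)%:E))%E).
  rewrite integral_mkcond; apply: le_lower_integral => x _.
    by rewrite erestrict_ge0// => y _; rewrite lee_fin mulr_ge0 ?powR_ge0 ?expR_ge0.
  rewrite patchE; case: ifPn => [|_]; last by rewrite mule_ge0 ?lee_fin.
  rewrite inE/= in_itv/= andbT => x1; have x0 : 0 <= x by apply: le_trans (ltW x1).
  rewrite -EFinM lee_fin exponential_pdfE//.
  apply: (@le_trans _ _ (x `^ b * expR (- x))).
    by rewrite ler_wpM2r ?expR_ge0// ler_powR ?(ltW x1)//; lra.
  have -> : 2 * C * (2^-1 * expR (- 2^-1 * x)) = C * expR (- 2^-1 * x) by field.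
  have -> : - 2^-1 * x = 2^-1 * x + - x by field.
  by rewrite expRD mulrA ler_wpM2r ?expR_ge0//; exact: powR_le_expR.
rewrite ge0_integralZl_EFin// ?integral_exponential_pdf ?mule1 ?ltry//.
- by move=> x _; rewrite lee_fin.
- by apply/measurable_EFinP; exact: measurable_exponential_pdf.
Qed.

Let gamma_integrand_ge0 f : linearly_dominated f -> forall s : R, `]0%R, +oo[%classic s ->
  (0 <= (s `^ (b - 1) * f (expR (- s)))%:E)%E.
Proof.
move=> [_ [C fC]] s /=; rewrite in_itv/= andbT => s0.
rewrite lee_fin mulr_ge0 ?powR_ge0//.
have e01 : 0 <= expR (- s) <= 1.
  by rewrite expR_ge0 -expR0 ler_expR oppr_le0 ltW.
by have /andP[] := fC _ e01.
Qed.

Lemma gamma_integral_dominated_lty f : linearly_dominated f -> (gamma_integral f < +oo)%E.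
Proof.
move=> df; have [mf [C fC]] := df.
have C0 : 0 <= C.
  by have /andP[h1 h2] := fC 1 (introT andP (conj ler01 (lexx _))); apply: le_trans h1 _; rewrite mulr1 in h2.
apply: (@le_lt_trans _ _ (C%:E * gamma_integral id)%E); last first.
  apply: lte_mul_pinfty; rewrite ?lee_fin//; exact: gamma_integral_id_lty.
rewrite /gamma_integral -ge0_integralZl_EFin//=; last 2 first.
- by move=> s _; rewrite lee_fin mulr_ge0 ?powR_ge0 ?expR_ge0.
- by apply: measurable_funTS; exact: (@measurable_gamma_integrand id (@measurable_id _ R setT)).
apply: le_lower_integral; first exact: gamma_integrand_ge0.
move=> s /=; rewrite in_itv/= andbT => s0; rewrite -EFinM lee_fin mulrCA ler_wpM2l ?powR_ge0//.
have e01 : 0 <= expR (- s) <= 1.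
  by rewrite expR_ge0 -expR0 ler_expR oppr_le0 ltW.
by have /andP[] := fC _ e01.
Qed.

Lemma positive_functional_gamma c : 0 <= c ->
  positive_functional (fun f => c * fine (gamma_integral f)).
Proof.
move=> c0; have g0 f : linearly_dominated f -> (0 <= gamma_integral f)%E.
  by move=> df; apply: integral_ge0; exact: gamma_integrand_ge0.
have gfin f : linearly_dominated f -> gamma_integral f \is a fin_num.
  by move=> df; rewrite ge0_fin_numE ?g0//; exact: gamma_integral_dominated_lty.
have mg f : linearly_dominated f -> measurable_fun (`]0%R, +oo[%classic : set R) (fun s : R => (s `^ (b - 1) * f (expR (- s)))%:E).
  by move=> [mf _]; apply: measurable_funTS; exact: measurable_gamma_integrand.
split.
- move=> f g df dg; rewrite -mulrDr; congr (_ * _).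
  rewrite -fineD ?gfin//; congr fine; rewrite /gamma_integral -ge0_integralD//.
  + by apply: eq_integral => s _; rewrite mulrDr EFinD.
  + exact: gamma_integrand_ge0.
  + exact: mg.
  + exact: gamma_integrand_ge0.
  + exact: mg.
- move=> a f a0 df; rewrite mulrCA; congr (_ * _).
  rewrite -[a in RHS]/(fine a%:E) -fineM ?gfin//; congr fine.
  rewrite /gamma_integral -ge0_integralZl_EFin//.
  + by apply: eq_integral => s _; rewrite -EFinM mulrCA.
  + exact: gamma_integrand_ge0.
  + exact: mg.
- move=> f g df dg fg; rewrite ler_wpM2l// fine_le ?gfin//.
  apply: le_lower_integral; first exact: gamma_integrand_ge0.
  move=> s /=; rewrite in_itv/= andbT => s0; rewrite lee_fin ler_wpM2l ?powR_ge0//.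
  by apply: fg; rewrite expR_ge0 -expR0 ler_expR oppr_le0 ltW.
Qed.

Lemma GammaE : (Gamma b)%:E = gamma_integral id.
Proof.
rewrite /Gamma /Rintegral fineK// ge0_fin_numE ?gamma_integral_id_lty//.
by apply: integral_ge0 => s _; rewrite lee_fin mulr_ge0 ?powR_ge0 ?expR_ge0.
Qed.

Lemma Gamma_gt0 : 0 < Gamma b.
Proof.
rewrite -lte_fin GammaE.
apply: (@lt_le_trans _ _ (\int[mu]_(x in `]0%R, 1%R]) ((expR (-1))%:E * (x `^ (b - 1))%:E))%E).
  rewrite ge0_integralZl_EFin ?expR_ge0//.
  - by rewrite integral_powR01// -EFinM lte_fin mulr_gt0 ?expR_gt0 ?invr_gt0.
  - by move=> x _; rewrite lee_fin powR_ge0.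
  - by apply/measurable_EFinP; apply: (measurable_funS (E := setT)).
rewrite gamma_integral_split.
apply: (@le_trans _ _ (\int[mu]_(x in `]0%R, 1%R]) (x `^ (b - 1) * expR (- x))%:E)%E).
  apply: le_lower_integral => x /=; rewrite in_itv/= => /andP[x0 x1].
    by rewrite mule_ge0// lee_fin ?powR_ge0 ?expR_ge0.
  by rewrite -EFinM lee_fin mulrC ler_wpM2l ?powR_ge0// ler_expR lerN2.
apply: leeDl; apply: integral_ge0 => s _; by rewrite lee_fin mulr_ge0 ?powR_ge0 ?expR_ge0.
Qed.

(** Change of variables on [1 / (i + 2), +oo[, where the integrand is continuous,
    then monotone convergence. *)
Lemma gamma_integral_scale (c : R) : 0 < c ->
  (\int[mu]_(s in `]0%R, +oo[) (s `^ (b - 1) * expR (- (c * s)))%:E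
   = (c `^ (- b) * Gamma b)%:E)%E.
Proof.
move=> c0.
pose G (c x : R) := x `^ (b - 1) * expR (- (c * x)).
have G0 e x : 0 <= G e x by rewrite mulr_ge0 ?powR_ge0 ?expR_ge0.
have mG e : measurable_fun setT (fun x : R => (G e x)%:E).
  apply/measurable_EFinP; apply: measurable_funM => //.
  apply: (measurableT_comp (@measurable_expR R)) => //.
  by apply: measurableT_comp => //; apply: measurable_funM.
have cG e (x : R) : 0 < x -> {for x, continuous (G e)}.
  move=> x0; apply: cvgM; first exact: continuous_powR_pos.
  apply: (cvg_comp _ expR); last exact: continuous_expR.
  by apply: cvgN; apply: cvgM; [exact: cvg_cst|exact: cvg_id].
have sub i : (\int[mu]_(x in `[(c * i.+2%:R^-1)%R, +oo[) (G 1 x)%:E =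
    (c `^ b)%:E * \int[mu]_(x in `[i.+2%:R^-1%R, +oo[) (G c x)%:E)%E.
  have i0 : 0 < (i.+2%:R : R)^-1 by rewrite invr_gt0.
  have dc (x : R) : is_derive x (1:R) (fun x : R => c * x) c.
    by apply: is_derive_eq; rewrite /GRing.scale/= mulr1.
  have dcE : (fun x : R => c * x)^`()%classic = cst c.
    by apply/funext => x; rewrite derive1E (derive_val (is_derive := dc x)).
  rewrite (@increasing_ge0_integration_by_substitutiony _ (fun x => c * x) (G 1) (i.+2%:R^-1)).
  - rewrite -ge0_integralZl_EFin ?powR_ge0//; last 2 first.
    + by move=> x _; rewrite lee_fin.
    + by apply: measurable_funTS; exact: mG.
    apply: eq_integral => x; rewrite inE/= in_itv/= andbT => ix.
    have x0 : 0 < x by exact: lt_le_trans ix.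
    transitivity ((G 1 (c * x) * (fun x : R => c * x)^`()%classic x)%:E); first by [].
    rewrite dcE /= -EFinM; congr EFin; rewrite /G mul1r powRM ?(ltW c0) ?(ltW x0)//.
    by rewrite -[c `^ b](@mulr_powRB1 _ c b) ?(ltW c0)//; ring.
  - by move=> x y _ _ xy; rewrite ltr_pM2l.
  - by rewrite dcE => x _; exact: cvg_cst.
  - by rewrite dcE; exact: is_cvg_cst.
  - by rewrite dcE; exact: is_cvg_cst.
  - split; first by move=> x _; exact: (ex_derive (is_derive := dc x)).
    by apply: cvg_at_right_filter; apply: cvgM; [exact: cvg_cst|exact: cvg_id].
  - by apply: gt0_cvgMry => //; exact: cvg_id.
  - apply: within_continuous_pos; first exact: cG.
    by move=> x /=; rewrite in_itv/= andbT; apply: lt_le_trans; rewrite mulr_gt0.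
  - by move=> x _.
have ndn (e : R) : 0 < e -> nondecreasing_seq (fun i : nat => `[(e * i.+2%:R^-1)%R, +oo[%classic : set R).
  move=> e0; apply/nondecreasing_seqP => n; apply/subsetPset => x /=.
  rewrite !in_itv/= !andbT; apply: le_trans.
  by rewrite ler_pM2l// lef_pV2 ?posrE// ler_nat.
have cvgi (e a : R) : 0 < a -> (\int[mu]_(x in `[(a * i.+2%:R^-1)%R, +oo[) (G e x)%:E)%E @[i --> \oo] -->
   (\int[mu]_(x in \bigcup_i `[(a * i.+2%:R^-1)%R, +oo[%classic) (G e x)%:E)%E.
  move=> a0; apply: ge0_nondecreasing_set_cvg_integral => //; first exact: ndn.
  - by move=> i; apply: measurable_funTS; exact: mG.
  - by move=> i x _; rewrite lee_fin.
have bigE (a : R) : 0 < a -> \bigcup_i `[(a * i.+2%:R^-1)%R, +oo[%classic = `]0%R, +oo[%classic :> set R.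
  move=> a0; apply/seteqP; split=> x /=.
    move=> [i _] /=; rewrite !in_itv/= !andbT; apply: lt_le_trans.
    by rewrite mulr_gt0 ?invr_gt0.
  rewrite in_itv/= andbT => x0.
  have : (\bigcup_i `[(i.+2%:R : R)^-1, +oo[%classic) (x / a).
    by rewrite bigcup_itv_invy/= in_itv/= andbT divr_gt0.
  move=> [i _] /=; rewrite in_itv/= andbT => h; exists i => //=; rewrite in_itv/= andbT.
  by rewrite mulrC -ler_pdivlMr.
have l1 := cvgi 1 c c0.
have l2 := cvgi c 1 ltr01.
rewrite !bigE// in l1 l2.
have gE : (\int[mu]_(x in `]0%R, +oo[) (G 1 x)%:E = (Gamma b)%:E)%E.
  by rewrite GammaE; apply: eq_integral => x _; rewrite /G mul1r.
rewrite gE in l1.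
have l3 : ((c `^ b)%:E * \int[mu]_(x in `[(1 * i.+2%:R^-1)%R, +oo[) (G c x)%:E)%E @[i --> \oo] --> (Gamma b)%:E.
  by move: l1; under eq_fun do rewrite sub -[X in `[X, +oo[]mul1r.
have l4 := cvgeZl (y := (c `^ b)%:E) isT l2.
have := cvg_unique _ l3 l4; move=> /(_ (@ereal_hausdorff R)) eqG.
rewrite powRN EFinM eqG muleA -EFinM mulVf ?mul1e// gt_eqF// powR_gt0//.
Qed.

Lemma gamma_integral_monomial n : fine (gamma_integral (fun y => y ^+ n.+1)) =
  n.+1%:R `^ (- b) * Gamma b.
Proof.
rewrite /gamma_integral -[RHS]/(fine (_%:E)) -gamma_integral_scale ?ltr0n//; congr fine.
by apply: eq_integral => s _; rewrite -expRM_natl mulrN.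
Qed.

Lemma gamma_integral_test (dl : R) : 0 < dl ->
  fine (gamma_integral (fun y => y * karamata_test dl y)) = dl / (b * (b + dl)).
Proof.
move=> dl0.
have E1 : gamma_integral (fun y => y * karamata_test dl y) =
    (\int[mu]_(s in `]0%R, 1%R]) (s `^ (b - 1) - s `^ (b + dl - 1))%:E)%E.
  rewrite /gamma_integral integral_mkcond [RHS]integral_mkcond; apply: eq_integral => s _.
  rewrite /patch; case: ifPn; case: ifPn => //; rewrite !inE/= !in_itv/= ?andbT.
  - move=> /andP[s0 s1] _; rewrite karamata_testE ?(ltW s0)// max_r; last first.
      by rewrite subr_ge0 powR_le1// (ltW s0).
    by rewrite mulrBr mulr1 -powRD ?(gt_eqF s0) ?implybT// addrAC.
  - move=> h s0; rewrite karamata_testE ?(ltW s0)// max_l ?mulr0//.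
    rewrite subr_le0 powR_ge1//; move: h => /negP; rewrite inE/= in_itv/= s0/=.
    by move/negP; rewrite -ltNge => /ltW.
  - by move=> /andP[s0 s1] /negP; rewrite inE/= in_itv/= s0.
rewrite E1.
have m1 (g : R) : measurable_fun (`]0%R, 1%R]%classic : set R) (fun x : R => (x `^ g)%:E).
  by apply/measurable_EFinP; apply: (measurable_funS (E := setT)).
have nn (s : R) : `]0%R, 1%R]%classic s -> 0 <= s `^ (b - 1) - s `^ (b + dl - 1).
  rewrite /= in_itv/= => /andP[s0 s1]; rewrite subr_ge0 addrAC [s `^ (b - 1 + dl)]powRD; last by rewrite (gt_eqF s0) implybT.
  by rewrite ler_piMr ?powR_ge0// powR_le1// (ltW s0).
have := integral_powR01 b0.
have -> : (\int[mu]_(x in `]0%R, 1%R]) (x `^ (b - 1))%:E =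
  \int[mu]_(s in `]0%R, 1%R]) (s `^ (b - 1) - s `^ (b + dl - 1))%:E + \int[mu]_(s in `]0%R, 1%R]) (s `^ (b + dl - 1))%:E)%E.
  rewrite -ge0_integralD//.
  - by apply: eq_integral => s _; rewrite -EFinD subrK.
  - apply/measurable_EFinP; apply: measurable_funB; apply: (measurable_funS (E := setT)) => //.
  - by move=> s _; rewrite lee_fin powR_ge0.
  - exact: m1.
rewrite (integral_powR01 (addr_gt0 b0 dl0)).
case: (\int[mu]_(s in _) _)%E => [r||]//= [] h.
have -> : r = b^-1 - (b + dl)^-1 by rewrite -h addrK.
by field; rewrite !gt_eqF// addr_gt0.
Qed.

End gamma_integrals.

(** * Growth of the excess *)

Section lattice_sums.
Context {R : realType} {d : nat}.
Implicit Types (q : 'rV[int]_d) (f : R -> R).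

Definition qnorm q : R := enorm (@lattice_point R d q).

Lemma enorm_ge0 (x : 'rV[R]_d) : 0 <= enorm x. Proof. exact: sqrtr_ge0. Qed.

Lemma enorm_sqr (x : 'rV[R]_d) : enorm x ^+ 2 = \sum_(i < d) x 0 i ^+ 2.
Proof. by rewrite sqr_sqrtr// sumr_ge0// => i _; rewrite sqr_ge0. Qed.

Lemma qnorm_ge0 q : 0 <= qnorm q. Proof. exact: enorm_ge0. Qed.

Lemma qnorm_sqr q : qnorm q ^+ 2 = \sum_(i < d) (q 0 i)%:~R ^+ 2.
Proof. by rewrite enorm_sqr; apply: eq_bigr => i _; rewrite mxE. Qed.

(** The Gaussian of the Euclidean norm is a product over the coordinates. *)
Lemma esum_gaussian (b : R) : 0 < b ->
  \esum_(q in [set: 'rV[int]_d]) (expR (- (b * qnorm q ^+ 2)))%:E = (theta_sum b ^+ d)%:E.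
Proof.
move=> b0; rewrite -(@esum_rV_prod R d (fun k => expR (- (b * k%:~R ^+ 2))) (theta_sum b)).
- apply: eq_esum => q _; congr EFin; rewrite -expR_sum; congr expR.
  by rewrite qnorm_sqr mulr_sumr sumrN.
- by move=> k; exact: expR_ge0.
- by have [-> _] := theta_sum_bounds b0.
Qed.

Definition lattice_sum (h : R) f : R :=
  h ^+ d * fine (\esum_(q in [set: 'rV[int]_d]) (f (expR (- (h ^+ 2 * qnorm q ^+ 2))))%:E).

Lemma lattice_term01 (h : R) q : 0 <= expR (- (h ^+ 2 * qnorm q ^+ 2)) <= 1.
Proof. by rewrite expR_ge0 -expR0 ler_expR oppr_le0 mulr_ge0 ?sqr_ge0. Qed.

Lemma lattice_sum_fin (h : R) f : 0 < h -> linearly_dominated f ->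
  (\esum_(q in [set: 'rV[int]_d]) (f (expR (- (h ^+ 2 * qnorm q ^+ 2))))%:E)%E \is a fin_num.
Proof.
move=> h0 [mf [C fC]].
rewrite ge0_fin_numE; last first.
  apply: esum_ge0 => q _; have /andP[+ _] := fC _ (lattice_term01 h q); by rewrite lee_fin.
apply: (@le_lt_trans _ _ (C * theta_sum (h ^+ 2) ^+ d)%:E); last by rewrite ltry.
have C0 : 0 <= C.
  by have /andP[h1 h2] := fC 1 (introT andP (conj ler01 (lexx _))); apply: le_trans h1 _; rewrite mulr1 in h2.
rewrite EFinM -esum_gaussian ?exprn_gt0// -esumZ//.
apply: le_esum => q _; rewrite -EFinM lee_fin.
by have /andP[] := fC _ (lattice_term01 h q).
Qed.

Lemma positive_functional_lattice_sum (h : R) : 0 < h -> positive_functional (lattice_sum h).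
Proof.
move=> h0; have h0' : 0 <= h ^+ d by rewrite exprn_ge0// ltW.
have nn f q : linearly_dominated f -> (0 <= (f (expR (- (h ^+ 2 * qnorm q ^+ 2))))%:E)%E.
  by move=> [_ [C fC]]; have /andP[+ _] := fC _ (lattice_term01 h q); rewrite lee_fin.
split.
- move=> f g df dg; rewrite /lattice_sum -mulrDr; congr (_ * _).
  rewrite -fineD ?lattice_sum_fin//; congr fine; rewrite -esumD//; last 2 first.
  + by move=> q _; exact: nn.
  + by move=> q _; exact: nn.
- move=> c f c0 df; rewrite /lattice_sum mulrCA; congr (_ * _).
  rewrite -[c in RHS]/(fine c%:E) -fineM ?lattice_sum_fin//; congr fine.
  by rewrite -esumZ// => q _; exact: nn.
- move=> f g df dg fg; rewrite ler_wpM2l// fine_le ?lattice_sum_fin//.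
  by apply: le_esum => q _; rewrite lee_fin; apply: fg; exact: lattice_term01.
Qed.

Lemma lattice_sum_monomial (h : R) n : 0 < h ->
  lattice_sum h (fun y => y ^+ n.+1) = (h * theta_sum (n.+1%:R * h ^+ 2)) ^+ d.
Proof.
move=> h0; rewrite /lattice_sum exprMn; congr (_ * _).
rewrite -[RHS]/(fine (_%:E)) -esum_gaussian ?mulr_gt0 ?exprn_gt0//; congr fine.
by apply: eq_esum => q _; rewrite -expRM_natl mulrN mulrA.
Qed.

Lemma cvg_theta_sum (c : R) : 0 < c ->
  h * theta_sum (c * h ^+ 2) @[h --> (0 : R)^'+] --> Num.sqrt (pi / c).
Proof.
move=> c0; pose a := Num.sqrt (c / pi).
have a0 : 0 < a by rewrite sqrtr_gt0 divr_gt0 ?pi_gt0.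
have aE : Num.sqrt (pi / c) = a^-1.
  by rewrite /a -sqrtrV ?divr_ge0 ?pi_ge0 ?(ltW c0)// invf_div.
apply/cvgrPdist_le => e e0; near=> h.
have h0 : 0 < h by near: h; exact: nbhs_right_gt.
have he : h <= e by near: h; exact: nbhs_right_le.
have [_] := @theta_sum_bounds R (c * h ^+ 2) (mulr_gt0 c0 (exprn_gt0 2 h0)).
have -> : Num.sqrt (c * h ^+ 2 / pi) = h * a.
  by rewrite mulrAC sqrtrM ?divr_ge0 ?pi_ge0 ?(ltW c0)// sqrtr_sqr gtr0_norm// mulrC.
rewrite aE => H.
have -> : a^-1 - h * theta_sum (c * h ^+ 2) = a^-1 * (1 - h * a * theta_sum (c * h ^+ 2)).
  by field; rewrite gt_eqF.
rewrite normrM gtr0_norm ?invr_gt0// distrC mulrC ler_pdivrMr//.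
by apply: le_trans H _; rewrite ler_wpM2r// ltW.
Unshelve. all: by end_near. Qed.

Hypothesis d1 : (1 <= d)%N.
Let b : R := d%:R / 2.
Let b0 : 0 < b. Proof. by rewrite divr_gt0// ltr0n. Qed.

Lemma sqrt_pi_div n : Num.sqrt (pi / n.+1%:R) ^+ d = pi `^ b / Gamma b * fine (gamma_integral b (fun y => y ^+ n.+1)) :> R.
Proof.
have p0 : 0 <= (pi : R) / n.+1%:R by rewrite divr_ge0 ?pi_ge0.
rewrite gamma_integral_monomial// mulrCA divfK ?gt_eqF ?Gamma_gt0//.
rewrite -powR12_sqrt// -powR_mulrn ?powR_ge0// -powRrM [2^-1 * _]mulrC -/b.
by rewrite powRM ?pi_ge0 ?invr_ge0// mulrC -powR_inv1 ?ler0n// -powRrM mulN1r.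
Qed.

Variable theta : R.
Hypothesis theta0 : 0 < theta.

(** The largest exponential gain of sites that are displaced to the origin, when
    each of them brings L and costs |q|^theta. *)
Definition excess (L : R) : R :=
  fine (\esum_(q in [set: 'rV[int]_d]) (Num.max 0 (L - qnorm q `^ theta))%:E).

(** With h = L^(-1/theta), L^-1 (L - |q|^theta)_+ = (1 - |h q|^theta)_+, which is
    the test function of exponent theta / 2 at s = |h q|^2. *)
Lemma excess_scale (L : R) : 0 < L ->
  \esum_(q in [set: 'rV[int]_d]) (Num.max 0 (L - qnorm q `^ theta))%:E = (excess L)%:E /\
  lattice_sum (L `^ (- theta^-1)) (fun y => y * karamata_test (theta / 2) y) =
  excess L / L `^ (1 + d%:R / theta).
Proof.
move=> L0; set h := L `^ _.
have h0 : 0 < h by rewrite powR_gt0.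
have t2 : 0 < theta / 2 by rewrite divr_gt0.
have termE q : expR (- (h ^+ 2 * qnorm q ^+ 2)) * karamata_test (theta / 2) (expR (- (h ^+ 2 * qnorm q ^+ 2)))
   = L^-1 * Num.max 0 (L - qnorm q `^ theta).
  rewrite karamata_testE//; last by rewrite mulr_ge0 ?sqr_ge0.
  rewrite -exprMn -powR_mulrn ?mulr_ge0 ?qnorm_ge0 ?(ltW h0)// -powRrM.
  have -> : 2%:R * (theta / 2) = theta by field.
  rewrite powRM ?qnorm_ge0 ?(ltW h0)// /h -powRrM mulNr mulVf ?gt_eqF//.
  by rewrite powR_inv1 ?(ltW L0)// maxr_pMr ?invr_ge0 ?(ltW L0)// mulr0 mulrBr mulVf ?gt_eqF.
have nn q : (0 <= (Num.max 0 (L - qnorm q `^ theta))%:E)%E by rewrite lee_fin le_max lexx.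
have df : linearly_dominated (fun y : R => y * karamata_test (theta / 2) y).
  split; first by apply: measurable_funM => //; apply: continuous_measurable_fun; exact: continuous_karamata_test.
  have [K KP] := karamata_test_bounded t2; exists K => y y01; have /andP[y0 y1] := y01.
  rewrite mulr_ge0 ?karamata_test_ge0//= mulrC ler_wpM2r//; apply: le_trans (KP _ y01); exact: ler_norm.
have E : (\esum_(q in [set: 'rV[int]_d]) (expR (- (h ^+ 2 * qnorm q ^+ 2)) * karamata_test (theta / 2) (expR (- (h ^+ 2 * qnorm q ^+ 2))))%:E
   = L^-1%:E * \esum_(q in [set: 'rV[int]_d]) (Num.max 0 (L - qnorm q `^ theta))%:E)%E.
  rewrite -esumZ ?invr_ge0 ?(ltW L0)//.
  by apply: eq_esum => q _; rewrite termE EFinM.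
have fin := lattice_sum_fin h0 df.
have fin2 : (\esum_(q in [set: 'rV[int]_d]) (Num.max 0 (L - qnorm q `^ theta))%:E)%E \is a fin_num.
  move: fin; rewrite E !ge0_fin_numE ?mule_ge0 ?esum_ge0 ?lee_fin ?invr_ge0 ?(ltW L0)//.
  by case: (\esum_(q in _) (Num.max _ _)%:E)%E => [r||]; rewrite ?ltry ?ltNyr// gt0_muley ?lte_fin ?invr_gt0.
split; first by rewrite /excess fineK.
rewrite /lattice_sum E -[LHS]/(h ^+ d * fine (_ * _)%E) fineM//= -/(excess L).
rewrite powRD; last by rewrite (gt_eqF L0) implybT.
have -> : h ^+ d = (L `^ (d%:R / theta))^-1.
  by rewrite -powR_mulrn ?(ltW h0)// /h -powRrM -powRN; congr (_ `^ _); ring.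
by rewrite powRr1 ?(ltW L0)// invfM; ring.
Qed.

Definition excess_constant : R :=
  2 * pi `^ (d%:R / 2) * theta / (d%:R * (d%:R + theta) * Gamma (d%:R / 2)).

Theorem cvg_excess :
  excess L / L `^ (1 + d%:R / theta) @[L --> +oo] --> excess_constant.
Proof.
pose T f := pi `^ b / Gamma b * fine (gamma_integral b f).
pose f (y : R) := y * karamata_test (theta / 2) y.
have t2 : 0 < theta / 2 by rewrite divr_gt0.
have TE : T f = excess_constant.
  rewrite /T gamma_integral_test// /excess_constant -/b /b; field.
  have : 0 < d%:R :> R by rewrite ltr0n.
  move=> dp; rewrite !gt_eqF ?Gamma_gt0 ?addr_gt0//.
have pT : positive_functional T.
  apply: positive_functional_gamma => //.
  by rewrite divr_ge0 ?powR_ge0// ltW// Gamma_gt0.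
(* [karamata] asks for a positive functional at every h *)
pose Th (h : R) := if 0 < h then lattice_sum h else T.
have pTh h : positive_functional (Th h).
  by rewrite /Th; case: ifPn => // h0; exact: positive_functional_lattice_sum.
have lim : Th h f @[h --> (0 : R)^'+] --> T f.
  apply: karamata => //.
  - move=> n; rewrite /T -sqrt_pi_div.
    apply: (@cvg_trans _ ((h * theta_sum (n.+1%:R * h ^+ 2)) ^+ d @[h --> (0:R)^'+])).
      apply: near_eq_cvg; near=> h; have h0 : 0 < h by near: h; exact: nbhs_right_gt.
      by rewrite /Th h0 lattice_sum_monomial.
    apply: (@cvg_comp _ _ _ _ (fun x => x ^+ d) _ _ _ (cvg_theta_sum (ltr0Sn _ n))).
    exact: exprn_continuous.
  - exact: continuous_karamata_test.
  - exact: karamata_test_bounded.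
  - by move=> a; exact: karamata_test_ge0.
have hlim : L `^ (- theta^-1) @[L --> +oo] --> (0 : R)^'+.
  move=> P [e e0 Pe].
  suff H : \forall L \near +oo, P (L `^ (- theta^-1)) by exact: H.
  near=> L.
  have L0 : 0 < L by near: L; exact: nbhs_pinfty_gt.
  have h0 : 0 < L `^ (- theta^-1) by rewrite powR_gt0.
  apply: Pe => //=; rewrite sub0r normrN gtr0_norm//.
  rewrite powRN invf_plt ?posrE ?powR_gt0//.
  have Le : (e^-1) `^ theta < L by near: L; apply: nbhs_pinfty_gt; exact: num_real.
  have -> : e^-1 = (e^-1 `^ theta) `^ theta^-1.
    by rewrite -powRrM mulfV ?gt_eqF// powRr1// invr_ge0 ltW.
  by rewrite gt0_ltr_powR ?invr_gt0// nnegrE ?powR_ge0// ltW.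
rewrite -TE; apply: (@cvg_trans _ (Th (L `^ (- theta^-1)) f @[L --> +oo])).
  apply: near_eq_cvg; near=> L.
  have L0 : 0 < L by near: L; exact: nbhs_pinfty_gt.
  by rewrite /Th powR_gt0// -(excess_scale L0).2.
exact: (@cvg_comp _ _ _ (fun L : R => L `^ (- theta^-1)) (fun h => Th h f) _ _ _ hlim lim).
Unshelve. all: by end_near. Qed.

End lattice_sums.

(** * Summability over the lattice *)

Section summability.
Context {R : realType}.

(** Telescoping: s (N+1)^(-1-s) <= N^(-s) - (N+1)^(-s). *)
Lemma powR_series_bound (s : R) : 0 < s -> forall n,
  \sum_(0 <= k < n.+1) (k.+1%:R : R) `^ (- (1 + s)) <= 1 + s^-1 - s^-1 * (n.+1%:R) `^ (- s).
Proof.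
move=> s0; elim=> [|n IH].
  by rewrite big_nat1 !powR1 mulr1 addrK.
rewrite big_nat_recr//=; apply: le_trans (lerD IH (lexx _)) _.
set N : R := n.+1%:R; have N0 : 0 < N by rewrite ltr0n.
have NS : n.+2%:R = N + 1 :> R by rewrite -natr1.
rewrite NS; have N1 : 0 < N + 1 by rewrite addr_gt0.
rewrite -addrA lerD2l opprD.
suff : s * (N + 1) `^ (- (1 + s)) <= N `^ (- s) - (N + 1) `^ (- s).
  move=> h; have := ler_wpM2l (ltW (_ : 0 < s^-1)) h.
  rewrite invr_gt0 mulrA mulVf ?gt_eqF// mul1r => /(_ s0) h2.
  move: h2; rewrite -/N opprD; lra.
rewrite opprD powRD; last by rewrite (gt_eqF N1) implybT.
rewrite powR_inv1 ?(ltW N1)//.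
have E : N `^ (- s) = (N + 1) `^ (- s) * expR (s * ln ((N + 1) / N)).
  rewrite lnM ?posrE ?invr_gt0// lnV ?posrE// /powR !gt_eqF// -expRD; congr expR; ring.
have l : (N + 1)^-1 <= ln ((N + 1) / N).
  have := @le_ln1Dx R (- (N + 1)^-1).
  have -> : 1 + - (N + 1)^-1 = ((N + 1) / N)^-1 by rewrite invf_div; field; rewrite gt_eqF.
  rewrite lnV ?posrE ?divr_gt0// lerN2; apply.
  by rewrite ltrN2 invf_lt1// ltrDr.
have e := expR_ge1Dx (s * ln ((N + 1) / N)).
have p0 := powR_ge0 (N + 1) (- s).
rewrite E; set X := ln _ in l e *; set Y := expR _ in e *; set p := _ `^ _ in p0 *.
have : s * (N + 1)^-1 <= s * X by rewrite ler_wpM2l// ltW.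
move=> h; have : p * (s * (N + 1)^-1) <= p * (Y - 1) by rewrite ler_wpM2l//; lra.
lra.
Qed.

Lemma esum_int_powR_lty (s : R) : 1 < s ->
  (\esum_(k in [set: int]) ((1 + `|k%:~R|) `^ (- s))%:E < +oo)%E.
Proof.
move=> s1; have s0 : 0 < s - 1 by rewrite subr_gt0.
have p0 (x : R) : (0 <= (x `^ (- s))%:E)%E by rewrite lee_fin powR_ge0.
have bound : (\sum_(n <oo) ((n.+1%:R : R) `^ (- s))%:E <= (1 + (s - 1)^-1)%:E)%E.
  apply: lime_le; first by apply: is_cvg_nneseries.
  near=> n; have n0 : (0 < n)%N by near: n; exact: nbhs_infty_gt.
  rewrite sumEFin lee_fin -(prednK n0).
  have := powR_series_bound s0 n.-1; rewrite addrC subrK; move=> /le_trans; apply.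
  by rewrite gerBl mulr_ge0 ?invr_ge0 ?powR_ge0 ?ltW.
rewrite esum_int; last by move=> k; exact: p0.
apply: lte_add_pinfty.
  apply: le_lt_trans (ltry (1 + (s - 1)^-1)); apply: le_trans bound.
  apply: lee_nneseries => n *; first exact: p0.
  by rewrite ger0_norm ?ler0z// -natr1 addrC.
apply: le_lt_trans (ltry (1 + (s - 1)^-1)); apply: le_trans bound.
apply: lee_nneseries => n *; first exact: p0.
have e1 : 0 < 1 + (n.+1%:Z)%:~R :> R by rewrite ltr_pwDl// ler0z.
rewrite mulrNz normrN ger0_norm ?ler0z// lee_fin !powRN lef_pV2 ?posrE ?powR_gt0//.
rewrite ge0_ler_powR ?nnegrE ?(ltW e1)//; last by rewrite lerDr.
by apply: ltW; apply: lt_trans s1.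
Unshelve. all: by end_near. Qed.

Context {d : nat}.
Hypothesis d1 : (1 <= d)%N.
Implicit Types q : 'rV[int]_d.
Let dp : 0 < d%:R :> R. Proof. by rewrite ltr0n. Qed.

Lemma coord_le_enorm (x : 'rV[R]_d) i : `|x 0 i| <= enorm x.
Proof.
rewrite -sqrtr_sqr ler_wsqrtr// (bigD1 i)//= lerDl sumr_ge0// => j _; exact: sqr_ge0.
Qed.

(** The Euclidean norm dominates every coordinate, so (1 + |q|)^(-a) is at most the
    product over the coordinates of (1 + |q_i|)^(- a/d), a product of convergent
    series. *)
Lemma esum_powR_lty (a : R) : d%:R < a ->
  (\esum_(q in [set: 'rV[int]_d]) ((1 + qnorm q) `^ (- a))%:E < +oo)%E.
Proof.
move=> da; have s1 : 1 < a / d%:R by rewrite ltr_pdivlMr// mul1r.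
have := esum_int_powR_lty s1.
set S := (\esum_(k in _) _)%E; have S0 : (0 <= S)%E.
  by apply: esum_ge0 => k _; rewrite lee_fin powR_ge0.
case ES : S S0 => [r||]// _ _.
apply: (@le_lt_trans _ _ (r ^+ d)%:E); last by rewrite ltry.
rewrite -(@esum_rV_prod R d (fun k => (1 + `|k%:~R|) `^ (- (a / d%:R))) r)//.
apply: le_esum => q _; rewrite lee_fin.
have -> : (1 + qnorm q) `^ (- a) = \prod_(i < d) (1 + qnorm q) `^ (- (a / d%:R)).
  rewrite prodr_const card_ord -powR_mulrn ?powR_ge0// -powRrM; congr (_ `^ _).
  by field; rewrite gt_eqF.
apply: ler_prod => i _; rewrite powR_ge0/= !powRN lef_pV2 ?posrE ?powR_gt0 ?ltr_pwDl//; last first.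
  exact: qnorm_ge0.
rewrite ge0_ler_powR ?nnegrE ?addr_ge0 ?qnorm_ge0//.
  by apply: divr_ge0 => //; apply: ltW; exact: lt_trans da.
rewrite lerD2l; have := coord_le_enorm (@lattice_point R d q) i; by rewrite mxE.
Qed.

Lemma powR1D_le_exp (a eta theta : R) : 0 < a -> 0 < eta -> 0 < theta ->
  exists2 C, 0 < C & forall x : R, 0 <= x -> expR (- (eta * x `^ theta)) <= C * (1 + x) `^ (- a).
Proof.
move=> a0 e0 t0; have at0 : 0 < a / theta by rewrite divr_gt0.
pose K := (a / theta / eta) `^ (a / theta).
exists (2 `^ a * (1 + K)); first by rewrite mulr_gt0 ?powR_gt0 ?ltr_pwDl ?powR_ge0.
move=> x x0; have x1 : 0 < 1 + x by rewrite ltr_pwDl.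
rewrite expRN powRN ler_pdivlMr ?powR_gt0// mulrC ler_pdivrMr ?expR_gt0//.
have e1 : 1 <= expR (eta * x `^ theta).
  by rewrite -expR0 ler_expR mulr_ge0 ?powR_ge0// ltW.
have [xs|xl] := leP x 1.
  apply: (@le_trans _ _ (2 `^ a)).
    by rewrite ge0_ler_powR ?nnegrE ?(ltW a0) ?(ltW x1)//; lra.
  rewrite -mulrA ler_peMr ?powR_ge0// mulr_ege1// lerDl powR_ge0//.
apply: (@le_trans _ _ ((2 * x) `^ a)).
  rewrite ge0_ler_powR ?nnegrE ?(ltW a0) ?(ltW x1) ?mulr_ge0//; lra.
rewrite powRM// -mulrA ler_wpM2l ?powR_ge0//.
have -> : x `^ a = (x `^ theta) `^ (a / theta) by rewrite -powRrM mulrC divfK ?gt_eqF.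
apply: le_trans (powR_le_expR at0 e0 (powR_ge0 _ _)) _.
by rewrite ler_wpM2r ?expR_ge0// lerDr.
Qed.

Lemma esum_stretched_exp_lty (eta theta : R) : 0 < eta -> 0 < theta ->
  (\esum_(q in [set: 'rV[int]_d]) (expR (- (eta * qnorm q `^ theta)))%:E < +oo)%E.
Proof.
move=> e0 t0; have a0 : 0 < d%:R + 1 :> R by rewrite addr_gt0.
have [C C0 CP] := powR1D_le_exp a0 e0 t0.
apply: (@le_lt_trans _ _ (\esum_(q in [set: 'rV[int]_d]) (C%:E * ((1 + qnorm q) `^ (- (d%:R + 1)))%:E))%E).
  by apply: le_esum => q _; rewrite -EFinM lee_fin CP// qnorm_ge0.
rewrite esumZ ?(ltW C0)//; last by move=> q _; rewrite lee_fin powR_ge0.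
apply: lte_mul_pinfty; rewrite ?lee_fin ?(ltW C0)//.
by apply: esum_powR_lty; rewrite ltrDl.
Qed.

End summability.

(** * Countable sums, integrals and exponentials *)

Section countable_sums.
Context {R : realType}.

Lemma esum_pickle (T : countType) (f : T -> \bar R) : (forall p, (0 <= f p)%E) ->
  (\sum_(n <oo) (if (pickle_inv n : option T) is Some p then f p else 0) = \esum_(p in [set: T]) f p)%E.
Proof.
move=> f0; rewrite nneseries_esumT; last by move=> n; case: pickle_inv.
rewrite (esumID (range (@choice.pickle T)))//; last by move=> n _; case: pickle_inv.
rewrite [X in (_ + X)%E]esum1 ?adde0; last first.
  move=> n [_ /= nr]; case E : (pickle_inv n : option T) => [p|]//.
  by exfalso; apply: nr; exists p => //; have := @pickle_invK T n; rewrite /= E.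
rewrite setTI (reindex_esum [set: T] _ (@choice.pickle T))//; last first.
  by split=> // x y _ _; exact: (pcan_inj (@pickleK_inv T)).
by apply: eq_esum => p _; rewrite pickleK_inv.
Qed.

Lemma integral_esum {dT : measure_display} {X : measurableType dT}
    (mu : {measure set X -> \bar R}) (T : countType) (f : T -> X -> \bar R) :
  (forall p, measurable_fun setT (f p)) -> (forall p x, (0 <= f p x)%E) ->
  (\int[mu]_x (\esum_(p in [set: T]) f p x) = \esum_(p in [set: T]) \int[mu]_x f p x)%E.
Proof.
move=> mf f0; rewrite -esum_pickle; last by move=> p; exact: integral_ge0.
transitivity (\int[mu]_x \sum_(n <oo) (if (pickle_inv n : option T) is Some p then f p x else 0))%E.
  by apply: eq_integral => x _; rewrite esum_pickle.
rewrite integral_nneseries//.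
- apply: eq_eseriesr => n _; case: pickle_inv => [p|]//; exact: integral0.
- by move=> n; case: pickle_inv => [p|]; [exact: mf|exact: measurable_cst].
- by move=> n x _; case: pickle_inv.
Qed.

Lemma measurable_esum {dT : measure_display} {X : measurableType dT}
    (T : countType) (f : T -> X -> \bar R) :
  (forall p, measurable_fun setT (f p)) -> (forall p x, (0 <= f p x)%E) ->
  measurable_fun setT (fun x => \esum_(p in [set: T]) f p x).
Proof.
move=> mf f0.
rewrite (_ : (fun x => _) = (fun x => \sum_(n <oo) (if (pickle_inv n : option T) is Some p then f p x else 0))%E); last first.
  by apply/funext => x; rewrite esum_pickle.
apply: ge0_emeasurable_sum => //.
- by move=> n x _ _; case: pickle_inv.
- by move=> n _; case: pickle_inv => [p|]; [exact: mf|exact: measurable_cst].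
Qed.

Lemma sum_le_esum (T : choiceType) (f : T -> \bar R) (s : seq T) : uniq s ->
  (\sum_(q <- s) f q <= \esum_(q in [set: T]) f q)%E.
Proof.
move=> us; apply: ereal_sup_ubound; exists [set` s] => //.
by rewrite -fsbig_seq.
Qed.

(** Finite duplicate-free lists that exhaust a countable type, to which the
    independence of finite families applies. *)
Definition enumeration (T : countType) (n : nat) : seq T :=
  pmap (@pickle_inv T) (iota 0 n).

Lemma enumerationS (T : countType) n : enumeration T n.+1 =
  enumeration T n ++ (if (pickle_inv n : option T) is Some p then [:: p] else [::]).
Proof. by rewrite /enumeration -addn1 iotaD pmap_cat/= add0n; case: pickle_inv. Qed.

Lemma enumeration_uniq (T : countType) n : uniq (enumeration T n).
Proof.
rewrite /enumeration; apply: pmap_uniq (iota_uniq 0 n); exact: pickle_invK.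
Qed.

Lemma sum_enumeration (T : countType) (f : T -> \bar R) n :
  (\sum_(q <- enumeration T n) f q = \sum_(0 <= k < n) (if (pickle_inv k : option T) is Some p then f p else 0))%E.
Proof.
rewrite /enumeration /index_iota subn0; elim: (iota 0 n) => [|k s IH].
  by rewrite !big_nil.
by rewrite [RHS]big_cons /=; case: pickle_inv => [p|]/=; rewrite ?big_cons IH// add0e.
Qed.

Lemma cvg_enumeration (T : countType) (f : T -> \bar R) : (forall p, (0 <= f p)%E) ->
  (\sum_(q <- enumeration T n) f q)%E @[n --> \oo] --> \esum_(q in [set: T]) f q.
Proof.
move=> f0; rewrite -esum_pickle//; under eq_fun do rewrite sum_enumeration.
by apply: is_cvg_nneseries => n _ _; case: pickle_inv.
Qed.

(** As exp is an isomorphism of ordered sets onto [0, +oo], the limit l = +oo needs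
    no separate argument. *)
Lemma expeR_limit_le (a : nat -> R) (l : \bar R) : nondecreasing_seq a ->
  (a n)%:E @[n --> \oo] --> l -> (expeR l <= limn (fun n => (expR (a n))%:E))%E.
Proof.
move=> nda al; set S := limn _.
have ndS : nondecreasing_seq (fun n => (expR (a n))%:E).
  by move=> m n mn; rewrite lee_fin ler_expR; exact: nda.
have leS n : ((expR (a n))%:E <= S)%E.
  have -> : S = ereal_sup (range (fun n => (expR (a n))%:E)).
    by apply/cvg_lim => //; exact: ereal_nondecreasing_cvgn.
  by apply: ereal_sup_ubound; exists n.
have S0 : (0 <= S)%E by apply: le_trans (leS 0%N); rewrite lee_fin expR_ge0.
have SE : expeR (lne S) = S by apply/eqP; rewrite lneK_eq.
rewrite -SE lee_expeR; apply: (cvge_to_le al); apply: nearW => n.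
by rewrite -(expeRK (a n)%:E) lee_lne ?in_itv/= ?leey ?andbT ?expR_ge0// lee_fin expR_ge0.
Qed.

End countable_sums.

(** * Exponential moments of the displaced lattice *)

Lemma esum_single {R : realType} (T : choiceType) (f : T -> \bar R) (a : T) :
  (forall p, (0 <= f p)%E) -> (forall p, p <> a -> f p = 0%E) ->
  \esum_(p in [set: T]) f p = f a.
Proof.
move=> f0 fa; rewrite (esumID [set a])// setTI esum_set1// esum1 ?adde0//.
by move=> p [_ /= pa]; exact: fa.
Qed.

Section perturbation.
Context {R : realType} {d : nat} {dX : measure_display} {X : measurableType dX}.
Variables (Pt : probability X R) (theta : R) (xi : 'rV[int]_d -> X -> 'rV[int]_d).
Hypotheses (d1 : (1 <= d)%N) (theta0 : 0 < theta).
Hypothesis law : lattice_perturbation Pt theta xi.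

Local Notation Z := (@partition_function R d theta).
Local Notation w := (@lattice_weight R d theta).

Let w_ge0 p : 0 <= w p. Proof. exact: expR_ge0. Qed.

Lemma lattice_weightE p : w p = expR (- (1 * qnorm p `^ theta)).
Proof. by rewrite mul1r. Qed.

Lemma partition_functionE : \esum_(p in [set: 'rV[int]_d]) (w p)%:E = Z%:E.
Proof.
rewrite /partition_function fineK// ge0_fin_numE; last by apply: esum_ge0 => p _; rewrite lee_fin.
have := esum_stretched_exp_lty d1 (ltr01 : 0 < (1 : R)) theta0.
by under eq_esum do rewrite -lattice_weightE.
Qed.

(** The term p = 0 of the series is 1. *)
Lemma partition_function_ge1 : 1 <= Z.
Proof.
rewrite -lee_fin -partition_functionE.
have w1 : w 0 = 1.
  rewrite lattice_weightE mul1r /qnorm.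
  have -> : enorm (@lattice_point R d 0) = 0.
    by rewrite /enorm big1 ?sqrtr0// => i _; rewrite !mxE expr0n.
  by rewrite powR0 ?gt_eqF// oppr0 expR0.
rewrite -w1; apply: le_trans (sum_le_esum (fun p => (w p)%:E) (s := [:: 0]) isT).
by rewrite big_seq1.
Qed.

Lemma perturbation_probE q (A : set 'rV[int]_d) :
  Pt (xi q @^-1` A) = (\esum_(p in [set: 'rV[int]_d]) ((Z^-1 * (\1_A p * w p))%:E))%E.
Proof.
have mA B : measurable (xi q @^-1` B) by exact: (lp_measurable law).
transitivity (\int[Pt]_x (\1_(xi q @^-1` A) x)%:E)%E.
  by rewrite integral_indic// setIT.
transitivity (\int[Pt]_x (\esum_(p in [set: 'rV[int]_d]) ((\1_A p)%:E * (\1_(xi q @^-1` [set p]) x)%:E)))%E.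
  apply: eq_integral => x _; rewrite (esum_single (a := xi q x)).
  - rewrite !indicE -EFinM; congr EFin.
    rewrite [in X in _ = _ * X]mem_set ?mulr1//; congr (_ %:R); by rewrite !inE.
  - by move=> p; rewrite mule_ge0 ?lee_fin.
  - move=> p pq; rewrite [X in (_ * X)%E](_ : _ = 0%E) ?mule0//; congr EFin.
    by rewrite indicE memNset//= => e; apply: pq.
rewrite integral_esum; last 2 first.
- move=> p; apply: measurable_funeM; apply/measurable_EFinP; exact: measurable_indic.
- by move=> p x; rewrite mule_ge0 ?lee_fin.
apply: eq_esum => p _; rewrite ge0_integralZl_EFin//; last first.
  by apply/measurable_EFinP; exact: measurable_indic.
rewrite integral_indic// setIT.
transitivity ((\1_A p)%:E * (Z^-1 * w p)%:E)%E.
  by congr (_ * _)%E; exact: (lp_law law q p).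
by rewrite -EFinM; congr EFin; ring.
Qed.

Definition far (r : R) : set 'rV[int]_d := [set p | r <= qnorm p].

(** The part dl of the exponent is spent on summing over the values. *)
Lemma perturbation_tail (dl : R) : 0 < dl < 1 -> exists2 C : R, 0 <= C &
  forall q r, 0 <= r -> (Pt (xi q @^-1` far r) <= (C * expR (- ((1 - dl) * r `^ theta)))%:E)%E.
Proof.
move=> /andP[dl0 dl1].
have := esum_stretched_exp_lty d1 dl0 theta0.
set S := (\esum_(p in _) _)%E; have S0 : (0 <= S)%E by apply: esum_ge0 => p _; rewrite lee_fin expR_ge0.
case ES : S S0 => [s||]// s0 _.
have Z0 : 0 <= Z^-1 by rewrite invr_ge0 (le_trans ler01)// partition_function_ge1.
exists (Z^-1 * s); first by rewrite mulr_ge0.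
move=> q r r0; rewrite perturbation_probE.
have -> : (Z^-1 * s * expR (- ((1 - dl) * r `^ theta)))%:E = ((Z^-1 * expR (- ((1 - dl) * r `^ theta)))%:E * S)%E.
  by rewrite ES -EFinM; congr EFin; ring.
rewrite /S -esumZ ?mulr_ge0 ?expR_ge0//.
apply: le_esum => p _; rewrite -EFinM lee_fin -mulrA ler_wpM2l// -expRD indicE.
have [rp|rp] := boolP (p \in far r); last by rewrite mul0r expR_ge0.
rewrite mul1r lattice_weightE ler_expR.
have : r `^ theta <= qnorm p `^ theta.
  move: rp; rewrite inE /far/= => rp.
  by rewrite ge0_ler_powR ?nnegrE ?qnorm_ge0 ?(ltW theta0).
move=> h; have : (1 - dl) * r `^ theta <= (1 - dl) * qnorm p `^ theta by rewrite ler_wpM2l//; lra.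
lra.
Qed.

(** Independence is given as a product rule for events.  Expanding one factor
    1 + (c - 1) 1_A at a time, and moving its index to the second list, reduces
    the expectation of the product to that rule. *)
Lemma perturbation_product (c : R) (A : 'rV[int]_d -> set 'rV[int]_d)
    (s J : seq 'rV[int]_d) : 1 <= c -> uniq (s ++ J) ->
  (\int[Pt]_x (\prod_(q <- s) (1 + (c - 1) * \1_(xi q @^-1` A q) x) *
               \prod_(q <- J) \1_(xi q @^-1` A q) x)%:E =
   (\prod_(q <- s) (1 + (c - 1) * fine (Pt (xi q @^-1` A q))) *
    \prod_(q <- J) fine (Pt (xi q @^-1` A q)))%:E)%E.
Proof.
move=> c1; have c0 : 0 <= c - 1 by rewrite subr_ge0.
have mA q : measurable (xi q @^-1` A q) by exact: (lp_measurable law).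
have mI q : measurable_fun setT (\1_(xi q @^-1` A q) : X -> R) by exact: measurable_indic.
have nnI (q : 'rV[int]_d) x : 0 <= (\1_(xi q @^-1` A q) x : R) by [].
elim: s J => [|q s IH] J us.
  under eq_integral do rewrite big_nil mul1r.
  rewrite big_nil mul1r.
  transitivity (\int[Pt]_x (\1_(\bigcap_(q in [set` [fset q in J]%fset]) (xi q @^-1` A q)) x)%:E)%E.
    apply: eq_integral => x _; congr EFin; rewrite [RHS]indicE.
    have [/allP aJ|/allPn [q qJ nq]] := boolP (all (fun q => x \in xi q @^-1` A q) J).
      rewrite mem_set; last first.
        by move=> q /=; rewrite !inE /= => qJ; have := aJ _ qJ; rewrite inE.
      rewrite big_seq big1// => q qJ; by rewrite indicE aJ.
    rewrite memNset; last first.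
      by move=> /(_ q) /=; rewrite !inE/= => /(_ qJ) h; move: nq; rewrite mem_set.
    rewrite (perm_big _ (perm_to_rem qJ)) big_cons/= indicE (negbTE nq) mul0r//.
  rewrite integral_indic ?setIT//; last first.
    by apply: fin_bigcap_measurable.
  transitivity (\prod_(i <- [fset q in J]%fset) Pt (xi i @^-1` A i))%E.
    exact: (lp_independent law).
  transitivity (\prod_(i <- [fset q in J]%fset) (fine (Pt (xi i @^-1` A i)))%:E)%E.
    by apply: eq_bigr => i _; rewrite fineK ?fin_num_measure.
  rewrite prodEFin; congr EFin.
  apply: perm_big; apply: uniq_perm => [||i]; [exact: fset_uniq|exact: us|by rewrite !inE].
have us1 : uniq (s ++ J) by move: us => /= /andP[].
have us2 : uniq (s ++ (q :: J)).
  by rewrite -(perm_uniq (permEl (perm_catCA [:: q] s J))).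
pose G (x : X) := \prod_(q <- s) (1 + (c - 1) * \1_(xi q @^-1` A q) x).
pose I J (x : X) := \prod_(q <- J) (\1_(xi q @^-1` A q) x : R).
have G0 x : 0 <= G x.
  by apply: prodr_ge0 => i _; rewrite addr_ge0 ?mulr_ge0.
have I0 K x : 0 <= I K x by apply: prodr_ge0 => i _.
have mG : measurable_fun setT G.
  apply: measurable_prod => i _; apply: measurable_funD => //.
  exact: measurable_funM.
have mIJ K : measurable_fun setT (I K) by apply: measurable_prod => i _.
transitivity (\int[Pt]_x ((G x * I J x)%:E + (c - 1)%:E * (G x * I (q :: J) x)%:E))%E.
  apply: eq_integral => x _; rewrite -EFinM -EFinD; congr EFin.
  by rewrite /I !big_cons -/(G x); ring.
have mGI K : measurable_fun setT (fun x => (G x * I K x)%:E).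
  by apply/measurable_EFinP; exact: measurable_funM.
rewrite ge0_integralD//; last 3 first.
- by move=> x _; rewrite lee_fin mulr_ge0.
- by move=> x _; rewrite mule_ge0 ?lee_fin ?mulr_ge0.
- by apply: measurable_funeM.
rewrite ge0_integralZl_EFin//; last by move=> x _; rewrite lee_fin mulr_ge0.
rewrite IH// IH// !big_cons -EFinM -EFinD; congr EFin; ring.
Qed.

(** Monotone convergence along the enumeration of the lattice; the exponential of
    L 1_A is 1 + (e^L - 1) 1_A. *)
Lemma perturbation_exp_moment (L K : R) (A : 'rV[int]_d -> set 'rV[int]_d)
    (k : 'rV[int]_d -> R) : 0 <= L -> (forall q, 0 <= k q) ->
  (forall q, 1 + (expR L - 1) * fine (Pt (xi q @^-1` A q)) <= expR (k q)) ->
  (\esum_(q in [set: 'rV[int]_d]) (k q)%:E <= K%:E)%E ->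
  (\int[Pt]_x expeR (L%:E * \esum_(q in [set: 'rV[int]_d]) (\1_(xi q @^-1` A q) x)%:E)
    <= (expR K)%:E)%E.
Proof.
move=> L0 k0 kP kK.
have mA q : measurable (xi q @^-1` A q) by exact: (lp_measurable law).
pose e n := enumeration 'rV[int]_d n.
pose a (x : X) n : R := \sum_(q <- e n) L * \1_(xi q @^-1` A q) x.
pose h n (x : X) := (expR (a x n))%:E.
have nda x : nondecreasing_seq (a x).
  apply/nondecreasing_seqP => n; rewrite /a /e enumerationS big_cat/=.
  by rewrite lerDl sumr_ge0// => i _; rewrite mulr_ge0.
have mh n : measurable_fun setT (h n).
  apply/measurable_EFinP; apply: (measurableT_comp (@measurable_expR R)).
  by apply: measurable_sum => q; apply: measurable_funM => //; exact: measurable_indic.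
apply: (@le_trans _ _ (\int[Pt]_x limn (fun n => h n x))%E).
  apply: le_lower_integral => x _; first exact: expeR_ge0.
  apply: expeR_limit_le => //.
  rewrite -esumZ//; under eq_fun do rewrite /a -sumEFin.
  by apply: cvg_enumeration => p; rewrite mule_ge0 ?lee_fin.
rewrite monotone_convergence//; last 2 first.
- by move=> n x _; rewrite lee_fin expR_ge0.
- by move=> x _ m n mn; rewrite /h lee_fin ler_expR; exact: nda.
apply: lime_le.
  apply: ereal_nondecreasing_is_cvgn => m n mn; apply: le_lower_integral => x _.
    by rewrite lee_fin expR_ge0.
  by rewrite /h lee_fin ler_expR; exact: nda.
apply: nearW => n.
have c1 : 1 <= expR L by rewrite -expR0 ler_expR.
have E x : h n x = (\prod_(q <- e n) (1 + (expR L - 1) * \1_(xi q @^-1` A q) x) *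
               \prod_(q <- [::]) \1_(xi q @^-1` A q) x)%:E.
  rewrite big_nil mulr1 /h /a expR_sum; congr EFin; apply: eq_bigr => q _.
  rewrite indicE; case: (_ \in _); rewrite ?mulr1 ?mulr0 ?expR0 ?addr0//; ring.
under eq_integral do rewrite E.
rewrite perturbation_product//; last by rewrite cats0; exact: enumeration_uniq.
rewrite big_nil mulr1 lee_fin.
apply: (@le_trans _ _ (\prod_(q <- e n) expR (k q))).
  apply: ler_prod => q _; rewrite kP andbT addr_ge0// mulr_ge0 ?subr_ge0//.
  by rewrite fine_ge0.
rewrite -expR_sum ler_expR -lee_fin -sumEFin; apply: le_trans kK.
exact: (sum_le_esum (fun q => (k q)%:E) (enumeration_uniq _ n)).
Qed.

(** Only the sites of these lattice points can come close to z. *)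
Definition far_count (dl : R) (z : 'rV[int]_d) (x : X) : \bar R :=
  \esum_(q in [set: 'rV[int]_d]) (\1_(xi q @^-1` far ((1 - dl) * qnorm (z - q))) x)%:E.

(** With r = |z - q| and k < k1 < 1 as below, e^L P(A_q) <= C exp (L - k1 r^theta)
    is at most exp ((L - k r^theta)_+) C exp (- (k1 - k) r^theta), so the factor
    of q is the exponential of (L - k r^theta)_+ up to a summable error. *)
Lemma far_count_exp_moment (dl : R) : 0 < dl < 1 -> exists D : R,
  forall L z, 0 < L -> (\int[Pt]_x expeR (L%:E * far_count dl z x) <=
    (expR ((1 - dl) `^ (2 + theta) * @excess R d theta (L / (1 - dl) `^ (2 + theta)) + D))%:E)%E.
Proof.
move=> dl01; have /andP[dl0 dl1] := dl01.
have [C C0 CP] := perturbation_tail dl01.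
set k := (1 - dl) `^ (2 + theta).
have dl1' : 0 < 1 - dl by rewrite subr_gt0.
have k0 : 0 < k by rewrite powR_gt0.
(* k1 collects 1 - dl from the tail and (1 - dl)^theta from the radius (1 - dl) r;
   the extra factor 1 - dl in k leaves room for the summable error *)
pose k1 := (1 - dl) `^ (1 + theta).
have kk1 : k < k1.
  rewrite /k (_ : 2 + theta = 1 + (1 + theta)); last by ring.
  rewrite powRD ?(gt_eqF dl1') ?implybT// powRr1 ?(ltW dl1')// -/k1.
  by rewrite mulrC gtr_pMr ?powR_gt0// gtrBl.
pose eta := k1 - k; have eta0 : 0 < eta by rewrite subr_gt0.
have := esum_stretched_exp_lty d1 eta0 theta0.
set S := (\esum_(p in _) _)%E; have S0 : (0 <= S)%E by apply: esum_ge0 => p _; rewrite lee_fin expR_ge0.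
case ES : S S0 => [s||]// s0 _.
exists (C * s) => L z L0.
pose g (y : 'rV[int]_d) : R := Num.max 0 (L - k * qnorm y `^ theta) + C * expR (- (eta * qnorm y `^ theta)).
have g0 y : 0 <= g y by rewrite addr_ge0 ?mulr_ge0 ?expR_ge0// le_max lexx.
apply: (@perturbation_exp_moment L (k * @excess R d theta (L / k) + C * s)
  (fun q => far ((1 - dl) * qnorm (z - q))) (fun q => g (z - q))).
- exact: ltW.
- by move=> q; exact: g0.
- move=> q; set r := qnorm (z - q).
  have r0 : 0 <= r by exact: qnorm_ge0.
  have t := CP q ((1 - dl) * r) (mulr_ge0 (ltW dl1') r0).
  have {t} : fine (Pt (xi q @^-1` far ((1 - dl) * r))) <= C * expR (- (k1 * r `^ theta)).
    have fin : Pt (xi q @^-1` far ((1 - dl) * r)) \is a fin_num.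
      by apply: fin_num_measure; exact: (lp_measurable law q (far ((1 - dl) * r))).
    rewrite -lee_fin (fineK fin).
    apply: le_trans t _; rewrite lee_fin powRM ?(ltW dl1')// mulrA.
    by rewrite /k1 powRD ?(gt_eqF dl1') ?implybT// powRr1 ?(ltW dl1').
  set pr := fine _ => prle.
  have pr0 : 0 <= pr by rewrite fine_ge0.
  set M := Num.max 0 (L - k * r `^ theta).
  have M0 : 0 <= M by rewrite le_max lexx.
  have eM : 1 <= expR M by rewrite -expR0 ler_expR.
  set W := expR (- (eta * r `^ theta)).
  have W0 : 0 <= W by exact: expR_ge0.
  apply: (@le_trans _ _ (expR M * (1 + C * W))); last first.
    by rewrite /g expRD ler_wpM2l ?expR_ge0// expR_ge1Dx.
  have h1 : (expR L - 1) * pr <= expR M * (C * W).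
    apply: (@le_trans _ _ (expR L * pr)); first by rewrite ler_wpM2r// gerBl.
    apply: (@le_trans _ _ (expR L * (C * expR (- (k1 * r `^ theta))))).
      by rewrite ler_wpM2l ?expR_ge0.
    rewrite mulrCA [leRHS]mulrCA ler_wpM2l// /W -!expRD ler_expR.
    have : L - k * r `^ theta <= M by rewrite /M le_max lexx orbT.
    rewrite /eta; lra.
  rewrite mulrDr mulr1; lra.
- rewrite (reindex_esum [set: 'rV[int]_d] _ (fun y => z - y)); last first.
    split=> //; [by move=> x y _ _ /(addrI _)/oppr_inj|by move=> y _; exists (z - y) => //; rewrite opprB addrC subrK].
  under eq_esum do rewrite opprB addrC subrK.
  rewrite [X in (X <= _)%E](_ : _ = \esum_(y in [set: 'rV[int]_d]) ((Num.max 0 (L - k * qnorm y `^ theta))%:E + (C * expR (- (eta * qnorm y `^ theta)))%:E)%E)//.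
  rewrite esumD; last 2 first.
  + by move=> y _; rewrite lee_fin le_max lexx.
  + by move=> y _; rewrite lee_fin mulr_ge0 ?expR_ge0.
  rewrite EFinD; apply: leeD.
    rewrite EFinM -(excess_scale theta0 (divr_gt0 L0 k0)).1 -esumZ ?(ltW k0)//; last by move=> y _; rewrite lee_fin le_max lexx.
    by apply: le_esum => y _; rewrite -EFinM lee_fin maxr_pMr ?(ltW k0)// mulr0 mulrBr mulrCA divff ?gt_eqF// mulr1 lexx.
  under eq_esum do rewrite EFinM.
  by rewrite esumZ// -/S ?ES -?EFinM// => y _; rewrite lee_fin expR_ge0.
Qed.

End perturbation.

(** * Jensen's inequality *)

Section jensen.
Context {R : realType}.

Lemma measurable_expeR : measurable_fun [set: \bar R] (@expeR R).
Proof.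
apply: (measurability _ (ErealGenOInfty.measurableE R)) => _ [_ [x ->] <-].
rewrite setTI; have [x0|x0] := ltP x 0.
  rewrite (_ : _ @^-1` _ = setT)//; apply/seteqP; split=> // y _ /=.
  by rewrite in_itv/= andbT (lt_le_trans _ (expeR_ge0 y))// lte_fin.
have xE : expeR (lne x%:E) = x%:E by rewrite lneK// in_itv/= lee_fin x0 leey.
move: (lne x%:E) xE => L LE.
rewrite (_ : _ @^-1` _ = `]L, +oo[%classic); first exact: emeasurable_itv.
apply/seteqP; split=> y /=; rewrite !in_itv/= !andbT.
  by rewrite -LE lte_expeR.
by rewrite -LE lte_expeR.
Qed.

Context {dT : measure_display} {T : measurableType dT}.

Lemma le_lower_integral_ae (mu : {measure set T -> \bar R}) (f g : T -> \bar R) :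
  (forall x, 0 <= f x)%E -> (forall x, 0 <= g x)%E -> measurable_fun setT g ->
  {ae mu, forall x, (f x <= g x)%E} -> (\int[mu]_x f x <= \int[mu]_x g x)%E.
Proof.
move=> f0 g0 mg [N [mN muN0 fgN]].
pose h x := (g x + +oo * (\1_N x)%:E)%E.
have h0 x : (0 <= h x)%E by rewrite adde_ge0 ?mule_ge0 ?leey ?lee_fin.
have mh : measurable_fun setT h.
  apply: emeasurable_funD => //; apply: measurable_funeM.
  by apply/measurable_EFinP; exact: measurable_indic.
apply: (@le_trans _ _ (\int[mu]_x h x)%E).
  apply: le_lower_integral => x _ //; rewrite /h indicE.
  have [xN|xN] := boolP (x \in N).
    by rewrite mule1 addey ?leey// gt_eqF// (lt_le_trans _ (g0 x))// ltNyr.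
  rewrite mule0 adde0; apply: contrapT => nfg; move/negP: xN; apply.
  by rewrite inE; apply: fgN.
rewrite (ge0_negligible_integral mN)// [X in (_ <= X)%E](ge0_negligible_integral mN)//.
apply: le_lower_integral => x [_ xN] //.
by rewrite /h indicE memNset// mule0 adde0.
Qed.

Lemma ae_le_lower_integral (mu : {measure set T -> \bar R}) (f g : T -> \bar R) :
  (forall x, 0 <= f x)%E -> (forall x, 0 <= g x)%E -> measurable_fun setT g ->
  {ae mu, forall x, (g x <= f x)%E} -> (\int[mu]_x g x <= \int[mu]_x f x)%E.
Proof.
move=> f0 g0 mg [N [mN muN0 fgN]].
rewrite (ge0_negligible_integral mN)// setTD integral_mkcond.
apply: le_lower_integral => x _; first by rewrite erestrict_ge0.
rewrite patchE; case: ifPn => // /[!inE] xN.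
by apply: contrapT => nfg; apply: xN; apply: fgN.
Qed.

Variable P : probability T R.
Variable Y : T -> \bar R.
Hypotheses (mY : measurable_fun setT Y) (Y0 : forall x, (0 <= Y x)%E).

Let cst_integral (k : R) : (\int[P]_x k%:E = k%:E)%E.
Proof.
rewrite integral_cst// [X in (_ * X)%E](_ : _ = 1%E) ?mule1//; exact: probability_setT.
Qed.

(** The tangent of exp at the mean m: e^y >= e^m + e^m (y - m). *)
Lemma jensen_expeR : (expeR (\int[P]_x Y x) <= \int[P]_x expeR (Y x))%E.
Proof.
have meY : measurable_fun setT (fun x => expeR (Y x)) by exact: (measurableT_comp measurable_expeR).
have m0 : (0 <= \int[P]_x Y x)%E by exact: integral_ge0.
case E : (\int[P]_x Y x)%E m0 => [m||]// m0.
  set J := (\int[P]_x _)%E; rewrite -(@leeD2rE _ (expR m * m)%:E)//.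
  rewrite lee_fin in m0; have em0 := expR_ge0 m.
  have -> : (expeR m%:E + (expR m * m)%:E = \int[P]_x ((expR m)%:E + (expR m)%:E * Y x))%E.
    rewrite ge0_integralD//; last 2 first.
    - by move=> x _; rewrite mule_ge0.
    - exact: measurable_funeM.
    by rewrite cst_integral ge0_integralZl_EFin// E -EFinM.
  have -> : (J + (expR m * m)%:E = \int[P]_x (expeR (Y x) + (expR m * m)%:E))%E.
    rewrite ge0_integralD ?cst_integral//.
    - by move=> x _; exact: expeR_ge0.
    - by move=> x _; rewrite lee_fin mulr_ge0.
  apply: le_lower_integral => x _; first by rewrite adde_ge0 ?mule_ge0.
  case: (Y x) (Y0 x) => [y||]//= y0; last by rewrite addye// leey.
  rewrite -EFinM -!EFinD lee_fin.
  have := expR_ge1Dx (y - m); rewrite expRD expRN => h.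
  have : expR m * (1 + (y - m)) <= expR m * (expR y * (expR m)^-1) by rewrite ler_wpM2l.
  rewrite [X in _ <= X](_ : _ = expR y); last by field; rewrite gt_eqF// expR_gt0.
  lra.
rewrite /= -E; apply: le_lower_integral => x _ //.
by apply: le_trans (expeR_ge1Dx _); rewrite leeDr.
Qed.

(** Young's inequality with c = m^(p - 1), m the mean, which is the tangent
    inequality of y^p at m. *)
Lemma jensen_poweR (p : R) : 1 <= p -> ((\int[P]_x Y x) `^ p <= \int[P]_x (Y x `^ p))%E.
Proof.
rewrite le_eqVlt => /predU1P[<-|p1].
  rewrite poweRe1; last exact: integral_ge0.
  by apply: le_lower_integral => x _ //; rewrite poweRe1.
have p0 : 0 < p by exact: lt_trans p1.
have mpY : measurable_fun setT (fun x => Y x `^ p)%E by exact: (measurableT_comp (measurable_poweR p)).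
have m0 : (0 <= \int[P]_x Y x)%E by exact: integral_ge0.
have J0 : (0 <= \int[P]_x (Y x `^ p))%E by apply: integral_ge0 => x _; exact: poweR_ge0.
case E : (\int[P]_x Y x)%E m0 => [m||]// m0.
  rewrite lee_fin in m0; pose q := p / (p - 1); pose c := m `^ (p - 1).
  have q0 : 0 < q by rewrite divr_gt0// subr_gt0.
  have pq : p^-1 + q^-1 = 1 by rewrite /q; field; rewrite !gt_eqF// subr_gt0.
  have cq : c `^ q = m `^ p.
    by rewrite /c -powRrM /q mulrC divfK// gt_eqF// subr_gt0.
  have c0 : 0 <= c by exact: powR_ge0.
  have cm : c * m = m `^ p by rewrite /c mulrC mulr_powRB1.
  set J := (\int[P]_x _)%E; rewrite poweR_EFin -(@leeD2rE _ ((p - 1) * m `^ p)%:E)//.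
  have mp0 : 0 <= m `^ p by exact: powR_ge0.
  have -> : ((m `^ p)%:E + ((p - 1) * m `^ p)%:E = \int[P]_x ((p * c)%:E * Y x))%E.
    rewrite ge0_integralZl_EFin ?mulr_ge0 ?(ltW p0)// E -EFinM -EFinD; congr EFin.
    by rewrite -mulrA cm; ring.
  have -> : (J + ((p - 1) * m `^ p)%:E = \int[P]_x (Y x `^ p + ((p - 1) * m `^ p)%:E))%E.
    rewrite ge0_integralD ?cst_integral//.
    - by move=> x _; exact: poweR_ge0.
    - by move=> x _; rewrite lee_fin mulr_ge0// subr_ge0 ltW.
  apply: le_lower_integral => x _; first by rewrite mule_ge0 ?lee_fin ?mulr_ge0 ?(ltW p0).
  case: (Y x) (Y0 x) => [y||]// y0; last by rewrite poweRyr ?gt_eqF// addye// leey.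
  rewrite lee_fin in y0.
  rewrite poweR_EFin -EFinM -!EFinD lee_fin.
  have := conjugate_powR y0 c0 p0 q0 pq; rewrite cq => h.
  have h2 : p * (y * c) <= p * (y `^ p / p + m `^ p / q) by rewrite ler_wpM2l// ltW.
  rewrite -mulrA [c * y]mulrC.
  apply: le_trans h2 _; rewrite le_eqVlt; apply/orP; left; apply/eqP.
  by rewrite /q; field; rewrite !gt_eqF// subr_gt0.
have : (\int[P]_x Y x <= \int[P]_x (1 + Y x `^ p))%E.
  apply: le_lower_integral => x _ //; case: (Y x) (Y0 x) => [y||]// y0.
    rewrite poweR_EFin -EFinD lee_fin; have [y1|y1] := leP 1 y.
      by apply: le_trans (le1r_powR y1 (ltW p1)) _; rewrite lerDr.
    by apply: le_trans (ltW y1) _; rewrite lerDl powR_ge0.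
  by rewrite poweRyr ?gt_eqF// addey.
rewrite E ge0_integralD// ?cst_integral; last by move=> x _; exact: poweR_ge0.
move=> h; rewrite poweRyr ?gt_eqF// leNgt; apply/negP => lt; move: h.
rewrite leNgt => /negP; apply; exact: lte_add_pinfty (ltry 1) lt.
Qed.

End jensen.

(** * A jointly measurable version of the motion *)

Section brownian_joint.
Context {R : realType} {d : nat} {dO : measure_display} {O : measurableType dO}.

Lemma borel_coord (i : 'I_d) (Y : set R) : measurable Y ->
  borel [set x : 'rV[R]_d | Y (x 0 i)].
Proof.
have H : measurable_fun [set: g_sigma_algebraType [set A : set 'rV[R]_d | open A]]
    (fun x : 'rV[R]_d => x 0 i).
  apply: (measurability _ (RGenOpens.measurableE R)) => _ [_ [a [b ->] <-]].
  rewrite setTI; apply: sub_sigma_algebra.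
  have /continuousP := @coord_continuous R 1 d 0 i; apply; exact: interval_open.
by move=> mY; have := H measurableT _ mY; rewrite setTI.
Qed.

Variables (P : probability O R) (x0 : 'rV[R]_d) (B : R -> O -> 'rV[R]_d).
Hypothesis bm : brownian_motion P x0 B.

Lemma bm_coord_measurable t i : 0 <= t -> measurable_fun setT (fun w => B t w 0 i).
Proof.
move=> t0 _ Y mY; rewrite setTI; exact: (bm_measurable bm t0 (borel_coord i mY)).
Qed.

(* step approximations of the path along the grid of mesh 1/(n+1) *)
Let grid (n : nat) (s : R) : R := (Num.truncn (Num.max 0 s * n.+1%:R))%:R / n.+1%:R.

Let grid_ge0 n s : 0 <= grid n s.
Proof. by rewrite divr_ge0. Qed.

Let cvg_grid s : 0 <= s -> grid n s @[n --> \oo] --> s.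
Proof.
move=> s0; apply/cvgrPdist_le => e e0.
have := @cvg_harmonic R; move/cvgrPdist_le/(_ _ e0); apply: filterS => n.
rewrite sub0r normrN /harmonic/= => h; apply: le_trans h.
have n0 : 0 < n.+1%:R :> R by rewrite ltr0n.
rewrite /grid max_r//; set t := Num.truncn _.
have h1 : t%:R <= s * n.+1%:R by rewrite truncn_le mulr_ge0.
have h2 : s * n.+1%:R <= t%:R + 1 by rewrite natr1 ltW// truncnS_gt.
have a1 : t%:R / n.+1%:R <= s by rewrite ler_pdivrMr.
have a2 : s <= (t%:R + 1) / n.+1%:R by rewrite ler_pdivlMr.
by rewrite !ger0_norm ?invr_ge0 ?subr_ge0// lerBlDl -[X in _ + X]mul1r -mulrDl.
Qed.

(** The motion is measurable at each time and almost surely continuous.  Its step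
    approximations along finer and finer grids are jointly measurable, and
    converge to it almost surely at all times; their upper limit is jointly
    measurable. *)
Lemma joint_version : exists Bt : 'I_d -> O * R -> R,
  (forall i, measurable_fun setT (Bt i)) /\
  {ae P, forall w, forall s i, 0 <= s -> Bt i (w, s) = B s w 0 i}.
Proof.
pose D n i (z : O * R) : R := B (grid n z.2) z.1 0 i.
exists (fun i z => fine (limn_esup (fun n => (D n i z)%:E))); split.
  move=> i; apply: measurableT_comp => //; apply: measurable_fun_limn_esup => n.
  apply/measurable_EFinP => _ Y mY; rewrite setTI.
  rewrite (_ : _ @^-1` _ = \bigcup_k
     ([set w | Y (B (k%:R / n.+1%:R) w 0 i)] `*` [set s | k%:R <= Num.max 0 s * n.+1%:R < k.+1%:R])); last first.
    apply/seteqP; split=> -[w s] /=.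
      move=> h; exists (Num.truncn (Num.max 0 s * n.+1%:R)) => //=; split=> //.
      by rewrite truncn_le ?mulr_ge0 ?le_max ?lexx// truncnS_gt.
    move=> [k _ /= [h1 h2]]; rewrite /D/= /grid.
    suff -> : Num.truncn (Num.max 0 s * n.+1%:R) = k by [].
    by apply/eqP; rewrite truncn_eq ?mulr_ge0 ?le_max ?lexx.
  apply: bigcupT_measurable => k; apply: measurableX.
    have := @bm_coord_measurable (k%:R / n.+1%:R) i (divr_ge0 (ler0n _ _) (ler0n _ _)) measurableT _ mY.
    by rewrite setTI.
  have mg : measurable_fun setT (fun s : R => Num.max 0 s * n.+1%:R).
    by apply: measurable_funM => //; exact: measurable_maxr.
  have := mg measurableT _ (measurable_itv `[(k%:R : R), k.+1%:R[).
  by rewrite setTI; congr measurable; apply/seteqP; split=> s /=; rewrite in_itv.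
have := bm_continuous bm; apply: filterS => w cw s i s0.
suff : (D n i (w, s))%:E @[n --> \oo] --> (B s w 0 i)%:E.
  by move=> /cvg_limn_einf_sup [_ ->].
apply: cvg_EFin; first exact: nearW.
rewrite /comp/= /D/=.
apply: (@cvg_comp _ _ _ (fun n => B (grid n s) w) (fun x => x 0 i) _ (nbhs (B s w))); last first.
  exact: coord_continuous.
have /subspace_continuousP/(_ s) := cw.
rewrite /= in_itv/= andbT => /(_ s0) cws.
apply: (@cvg_comp _ _ _ (fun n => grid n s) (fun t => B t w) _ (within `[0, +oo[%classic (nbhs s))) => //.
move=> A /= [e e0 Ae]; have /cvgrPdist_lt/(_ _ e0) := cvg_grid s0.
by apply: filterS => n hn; apply: Ae => //=; rewrite in_itv/= andbT.
Qed.

End brownian_joint.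

(** * Occupation weights of the lattice cells *)

Section occupation.
Context {R : realType} {d : nat} {dO : measure_display} {O : measurableType dO}.

Definition cell (x : 'rV[R]_d) : 'rV[int]_d := \row_i Num.floor (x 0 i + 2^-1).

Lemma cellP (x : 'rV[R]_d) i : (cell x 0 i)%:~R - 2^-1 <= x 0 i < (cell x 0 i)%:~R + 2^-1.
Proof.
rewrite mxE; have h1 := floor_le (x 0 i + 2^-1); have h2 := floorD1_gt (x 0 i + 2^-1).
rewrite intrD in h2; apply/andP; split; lra.
Qed.

Lemma poweR_expeR (y : \bar R) (p : R) : (0 <= y)%E -> 0 < p -> (expeR y `^ p)%E = expeR (p%:E * y)%E.
Proof.
case: y => [y||]// y0 p0; last by rewrite gt0_muley ?lte_fin// poweRyr ?gt_eqF.
by rewrite -EFinM /expeR poweR_EFin -expRM mulrC.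
Qed.

Variables (P : probability O R) (x0 : 'rV[R]_d) (B : R -> O -> 'rV[R]_d).
Hypothesis bm : brownian_motion P x0 B.
Variable t : R.
Hypothesis t0 : 0 < t.

(** The weights are the mean fractions of time that the motion spends in the cells
    up to t.  Two applications of Jensen's inequality: for exp and the uniform
    law on [0, t], and for the p-th power and the law of the motion.  They do
    not involve W, so that W may be random and integrated afterwards. *)
Lemma fk_power_le : exists pi_ : 'rV[int]_d -> \bar R,
  [/\ (forall z, 0 <= pi_ z)%E, \esum_(z in [set: 'rV[int]_d]) pi_ z = 1%E &
  forall (p : R) (G : 'rV[int]_d -> \bar R) (W : 'rV[R]_d -> \bar R), 1 <= p ->
    (forall x, 0 <= W x)%E -> (forall x, W x <= G (cell x))%E ->
    ((\int[P]_w expeR (\int[lebesgue_measure]_(s in `[0%R, t]) W (B s w))) `^ p <=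
     \esum_(z in [set: 'rV[int]_d]) (expeR ((p * t)%:E * G z) * pi_ z))%E].
Proof.
have [Bt [mBt BtE]] := joint_version bm.
pose cellt (ws : O * R) : 'rV[int]_d := \row_i Num.floor (Bt i ws + 2^-1).
have mcell z : measurable (cellt @^-1` [set z]).
  rewrite (_ : _ @^-1` _ = \bigcap_(i in [set: 'I_d]) (Bt i @^-1` `[(z 0 i)%:~R - 2^-1, (z 0 i)%:~R + 2^-1[)).
    apply: fin_bigcap_measurable => // i _.
    by rewrite -[X in measurable X]setTI; apply: mBt => //; exact: measurable_itv.
  apply/seteqP; split=> ws /=.
    move=> <- i _ /=; rewrite in_itv/= mxE.
    have h1 := floor_le (Bt i ws + 2^-1); have h2 := floorD1_gt (Bt i ws + 2^-1).
    rewrite intrD in h2; apply/andP; split; lra.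
  move=> h; apply/rowP => i; rewrite mxE; have := h i Logic.I; rewrite /= in_itv/= => /andP[h1 h2].
  apply: floor_def; rewrite intrD; apply/andP; split; lra.
pose U : probability (measurableTypeR R) R := uniform_prob t0.
pose H z (ws : O * R) : \bar R := (\1_(cellt @^-1` [set z]) ws)%:E.
have H0 z ws : (0 <= H z ws)%E by rewrite lee_fin.
have mH z : measurable_fun setT (H z).
  by apply/measurable_EFinP; exact: measurable_indic.
have HE (g : 'rV[int]_d -> \bar R) ws : (forall z, 0 <= g z)%E ->
    (\esum_(z in [set: 'rV[int]_d]) (g z * H z ws) = g (cellt ws))%E.
  move=> g0; rewrite (esum_single (a := cellt ws)).
  - by rewrite /H indicE mem_set// mule1.
  - by move=> z; rewrite mule_ge0.
  - by move=> z zc; rewrite /H indicE memNset ?mule0//= => e; exact: zc.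
have mg (g : 'rV[int]_d -> \bar R) : (forall z, 0 <= g z)%E ->
    measurable_fun setT (fun ws => g (cellt ws)).
  move=> g0; rewrite (_ : (fun ws => _) = (fun ws => \esum_(z in [set: 'rV[int]_d]) (g z * H z ws)%E)); last first.
    by apply/funext => ws; rewrite HE.
  apply: measurable_esum; first by move=> z; exact: measurable_funeM.
  by move=> z ws; rewrite mule_ge0.
pose pi_ z : \bar R := (\int[P]_w \int[U]_s H z (w, s))%E.
have int_esum (g : 'rV[int]_d -> \bar R) : (forall z, 0 <= g z)%E ->
    (\int[P]_w \int[U]_s g (cellt (w, s)) = \esum_(z in [set: 'rV[int]_d]) (g z * pi_ z))%E.
  move=> g0.
  have mHw z w : measurable_fun setT (fun s : R => H z (w, s)).
    exact: (measurableT_comp (mH z)).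
  have mHU z : measurable_fun setT (fun w => \int[U]_s H z (w, s))%E.
    apply: (measurable_fun_fubini_tonelli_F (m2 := U) (H z)) => //; exact: mH.
  transitivity (\int[P]_w (\esum_(z in [set: 'rV[int]_d]) (g z * \int[U]_s H z (w, s))))%E.
    apply: eq_integral => w _.
    transitivity (\int[U]_s (\esum_(z in [set: 'rV[int]_d]) (g z * H z (w, s))))%E.
      by apply: eq_integral => s _; rewrite HE.
    rewrite integral_esum; last 2 first.
    - by move=> z; apply: measurable_funeM; exact: mHw.
    - by move=> z s; rewrite mule_ge0.
    by apply: eq_esum => z _; rewrite ge0_integralZl//; exact: mHw.
  rewrite integral_esum; last 2 first.
  - by move=> z; apply: measurable_funeM; exact: mHU.
  - by move=> z w; rewrite mule_ge0// integral_ge0.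
  apply: eq_esum => z _; rewrite ge0_integralZl//.
  by move=> w _; rewrite integral_ge0.
have pi0 z : (0 <= pi_ z)%E by apply: integral_ge0 => w _; exact: integral_ge0.
exists pi_; split => //.
  transitivity (\esum_(z in [set: 'rV[int]_d]) (1 * pi_ z))%E.
    by apply: eq_esum => z _; rewrite mul1e.
  rewrite -(int_esum (fun=> 1%E))//.
  have cst1 (dd : measure_display) (TT : measurableType dd) (Q : probability TT R) : (\int[Q]_x 1%:E = 1%E)%E.
    by rewrite integral_cst// [X in (_ * X)%E](_ : _ = 1%E) ?mule1//; exact: probability_setT.
  transitivity (\int[P]_w 1%:E)%E; last exact: cst1.
  by apply: eq_integral => w _; exact: (cst1 _ _ U).
move=> p G W p1 W0 WG; have p0 : 0 < p by exact: lt_le_trans p1.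
have G0 z : (0 <= G z)%E.
  have -> : z = cell (@lattice_point R d z).
    apply/rowP => i; rewrite !mxE; apply/esym/floor_def.
    rewrite intrD; apply/andP; split; lra.
  exact: le_trans (WG _).
pose Y w : \bar R := (\int[U]_s (t%:E * G (cellt (w, s))))%E.
have mtG : measurable_fun setT (fun ws => t%:E * G (cellt ws))%E.
  by apply: measurable_funeM; exact: mg.
have tG0 ws : (0 <= t%:E * G (cellt ws))%E by rewrite mule_ge0 ?lee_fin ?(ltW t0).
have mY : measurable_fun setT Y.
  by apply: (measurable_fun_fubini_tonelli_F (m2 := U) (fun ws => t%:E * G (cellt ws))%E).
have Y0 w : (0 <= Y w)%E by apply: integral_ge0 => s _.
have meY : measurable_fun setT (fun w => expeR (Y w)) by exact: (measurableT_comp measurable_expeR).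
have step1 : (\int[P]_w expeR (\int[lebesgue_measure]_(s in `[0%R, t]) W (B s w)) <= \int[P]_w expeR (Y w))%E.
  apply: le_lower_integral_ae => //.
  - by move=> w; exact: expeR_ge0.
  - by move=> w; exact: expeR_ge0.
  - apply: filterS BtE => w BtE; rewrite lee_expeR.
    rewrite /Y (integral_uniform t0)//; last by exact: (measurableT_comp mtG).
    rewrite subr0 ge0_integralZl_EFin ?(ltW t0)//; last first.
      by apply: measurable_funTS; exact: (measurableT_comp (mg G G0)).
    rewrite muleA -EFinM mulVf ?gt_eqF// mul1e.
    apply: le_lower_integral => s //=; rewrite in_itv/= => /andP[s0 st].
    rewrite (_ : cellt (w, s) = cell (B s w))//.
    by apply/rowP => i; rewrite !mxE BtE.
have le_pow (a b : \bar R) : (0 <= a)%E -> (a <= b)%E -> (a `^ p <= b `^ p)%E.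
  move=> a0 ab; apply: gt0_ler_poweR; rewrite ?(ltW p0)// ?in_itv/= ?leey ?andbT//.
  exact: le_trans ab.
apply: le_trans (le_pow _ _ _ step1) _.
  by apply: integral_ge0 => w _; exact: expeR_ge0.
apply: le_trans (@jensen_poweR R _ O P _ meY (fun w => expeR_ge0 (Y w)) p p1) _.
rewrite -int_esum; last by move=> z; exact: expeR_ge0.
apply: le_lower_integral => w _; first exact: poweR_ge0.
rewrite poweR_expeR//.
have -> : (p%:E * Y w = \int[U]_s ((p * t)%:E * G (cellt (w, s))))%E.
  rewrite /Y -ge0_integralZl_EFin ?(ltW p0)//; last exact: (measurableT_comp mtG).
  by apply: eq_integral => s _; rewrite muleA -EFinM.
apply: jensen_expeR.
  by apply: measurable_funeM; exact: (measurableT_comp (mg G G0)).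
by move=> s; rewrite mule_ge0 ?lee_fin ?mulr_ge0 ?(ltW p0) ?(ltW t0).
Qed.

End occupation.

(** * The Euclidean norm *)

Section euclid.
Context {R : realType} {d : nat}.
Implicit Types x y : 'rV[R]_d.

Lemma cauchy_schwarz x y : \sum_(i < d) x 0 i * y 0 i <= enorm x * enorm y.
Proof.
have [x0|x0] := eqVneq (enorm x) 0.
  have : forall i, x 0 i = 0.
    move=> i; have := coord_le_enorm x i; rewrite x0 normr_le0 => /eqP //.
  by move=> h; rewrite x0 mul0r big1// => i _; rewrite h mul0r.
have [y0|y0] := eqVneq (enorm y) 0.
  have : forall i, y 0 i = 0.
    move=> i; have := coord_le_enorm y i; rewrite y0 normr_le0 => /eqP //.
  by move=> h; rewrite y0 mulr0 big1// => i _; rewrite h mulr0.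
have xp : 0 < enorm x by rewrite lt_neqAle eq_sym x0 enorm_ge0.
have yp : 0 < enorm y by rewrite lt_neqAle eq_sym y0 enorm_ge0.
have h : 2 * (enorm x * enorm y) * (\sum_(i < d) x 0 i * y 0 i) <= 2 * (enorm x * enorm y) ^+ 2.
  have -> : 2 * (enorm x * enorm y) * (\sum_(i < d) x 0 i * y 0 i)
     = \sum_(i < d) 2 * ((enorm y * x 0 i) * (enorm x * y 0 i)).
    rewrite mulr_sumr; apply: eq_bigr => i _; ring.
  apply: (@le_trans _ _ (\sum_(i < d) ((enorm y * x 0 i) ^+ 2 + (enorm x * y 0 i) ^+ 2))).
    apply: ler_sum => i _; have := sqr_ge0 (enorm y * x 0 i - enorm x * y 0 i).
    rewrite sqrrB; lra.
  rewrite big_split/=; under eq_bigr do rewrite exprMn; under [X in _ + X]eq_bigr do rewrite exprMn.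
  rewrite -!mulr_sumr -!enorm_sqr exprMn; lra.
have : 0 < 2 * (enorm x * enorm y) by rewrite !mulr_gt0.
by move=> h0; rewrite -(ler_pM2l h0); apply: le_trans h _; rewrite expr2 mulrA.
Qed.

Lemma enormD x y : enorm (x + y) <= enorm x + enorm y.
Proof.
rewrite -ler_sqr ?nnegrE ?enorm_ge0 ?addr_ge0 ?enorm_ge0//.
rewrite enorm_sqr sqrrD !enorm_sqr.
have := cauchy_schwarz x y => h.
under eq_bigr do rewrite mxE sqrrD; rewrite !big_split/=.
by rewrite lerD2r lerD2l mulr2n lerD.
Qed.

Lemma enormN x : enorm (- x) = enorm x.
Proof. by congr Num.sqrt; apply: eq_bigr => i _; rewrite mxE sqrrN. Qed.

Lemma enorm_le_coord x (c : R) : 0 <= c -> (forall i, `|x 0 i| <= c) -> enorm x <= d%:R * c.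
Proof.
move=> c0 h.
have [d0|dp] := posnP d.
  have -> : enorm x = 0.
    by rewrite /enorm big1 ?sqrtr0// => i _; exfalso; move: i; rewrite d0 => -[].
  by rewrite mulr_ge0.
rewrite -ler_sqr ?nnegrE ?enorm_ge0 ?mulr_ge0// enorm_sqr.
apply: (@le_trans _ _ (\sum_(i < d) c ^+ 2)).
  by apply: ler_sum => i _; rewrite -real_normK ?num_real// ler_sqr ?nnegrE.
rewrite sumr_const card_ord -[_ *+ _]mulr_natl exprMn ler_wpM2r ?sqr_ge0// expr2 ler_peMl// ler1n//.
Qed.

Lemma lattice_pointB (p q : 'rV[int]_d) : lattice_point (p - q) = lattice_point p - lattice_point q :> 'rV[R]_d.
Proof. by apply/rowP => i; rewrite !mxE intrB. Qed.

Lemma cell_near x : enorm (x - lattice_point (cell x)) <= d%:R.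
Proof.
rewrite -[leRHS]mulr1; apply: enorm_le_coord => // i.
have /andP[h1 h2] := cellP x i; rewrite !mxE in h1 h2 *; rewrite ler_norml; apply/andP; split; lra.
Qed.

End euclid.

(** * Upper bound of the moments *)

Section upper_bound.
Context {R : realType} {d : nat} {dX : measure_display} {X : measurableType dX}.
Variables (theta alpha C0 : R) (u : 'rV[R]_d -> R).
Hypotheses (d1 : (1 <= d)%N) (theta0 : 0 < theta) (alpha_d : d%:R < alpha) (C00 : C0 < 0).
Variable M : R.
Hypotheses (u_ge : forall x, - M <= u x) (u_le0 : forall x, u x <= 0).
Hypothesis u_tail : u x / (C0 * enorm x `^ (- alpha)) @[x --> enorm_infty] --> (1 : R).

Let alpha0 : 0 < alpha. Proof. by apply: le_lt_trans alpha_d. Qed.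

Lemma u_tail_near : exists2 r : R, 1 <= r & forall x, r < enorm x ->
  1 / 2 <= u x / (C0 * enorm x `^ (- alpha)) <= 2.
Proof.
have h0 : 0 < 1 / 2 :> R by rewrite divr_gt0.
have [r _ rP] := u_tail (nbhsx_ballx (1 : R) (1 / 2) h0).
exists (Num.max 1 r); first by rewrite le_max lexx.
move=> x; rewrite gt_max => /andP[_ rx]; have := rP x rx; rewrite /= /ball/= ltr_norml; lra.
Qed.

Lemma u_polynomial_bound : exists2 C : R, 0 <= C & forall x, - u x <= C * (1 + enorm x) `^ (- alpha).
Proof.
have M0 : 0 <= M by have := le_trans (u_ge 0) (u_le0 0); lra.
have C0n : 0 <= - C0 by rewrite oppr_ge0 ltW.
have [r r1 rP] := u_tail_near.
exists (M * (1 + r) `^ alpha + 2 * (- C0) * 2 `^ alpha).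
  by apply: addr_ge0; rewrite !mulr_ge0 ?powR_ge0//.
move=> x; have n0 := enorm_ge0 x.
have n1 : 0 < 1 + enorm x by rewrite ltr_pwDl.
have t1 : 0 <= M * (1 + r) `^ alpha * (1 + enorm x) `^ (- alpha) by rewrite !mulr_ge0 ?powR_ge0.
have t2 : 0 <= 2 * (- C0) * 2 `^ alpha * (1 + enorm x) `^ (- alpha).
  by rewrite !mulr_ge0 ?powR_ge0.
rewrite mulrDl; have [xr|rx] := leP (enorm x) r.
  suff : M <= M * (1 + r) `^ alpha * (1 + enorm x) `^ (- alpha).
    have := u_ge x; lra.
  rewrite -mulrA ler_peMr// powRN ler_pdivlMr ?powR_gt0// mul1r.
  rewrite ge0_ler_powR ?nnegrE ?(ltW alpha0) ?(ltW n1)//; lra.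
suff : - u x <= 2 * (- C0) * 2 `^ alpha * (1 + enorm x) `^ (- alpha) by lra.
have xp : 0 < enorm x by apply: lt_trans rx; lra.
have xa : 0 < enorm x `^ (- alpha) by rewrite powR_gt0.
have /andP[_] := rP x rx.
rewrite ler_ndivrMr; last by rewrite nmulr_rlt0.
move=> h; apply: (@le_trans _ _ (2 * (- C0) * enorm x `^ (- alpha))); first by lra.
rewrite -!mulrA !ler_wpM2l//.
rewrite powRN [(1 + _) `^ _]powRN ler_pdivlMr ?powR_gt0// mulrC ler_pdivrMr ?powR_gt0//.
rewrite -powRM ?(ltW xp)// ge0_ler_powR ?nnegrE ?(ltW alpha0) ?(ltW n1) ?mulr_ge0 ?(ltW xp)//; lra.
Qed.

(** The tail of u is strictly negative. *)
Lemma u_minimum_neg : 0 < M.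
Proof.
have [r r1 rP] := u_tail_near.
pose x : 'rV[R]_d := const_mx (r + 1).
have rx : r < enorm x.
  have := coord_le_enorm x (Ordinal d1); rewrite mxE ger0_norm; lra.
have /andP[+ _] := rP x rx.
have xp : 0 < enorm x by lra.
rewrite ler_ndivlMr; last by rewrite nmulr_rlt0 ?powR_gt0.
have : C0 * enorm x `^ (- alpha) < 0 by rewrite nmulr_rlt0 ?powR_gt0.
have := u_ge x; lra.
Qed.

Variables (Pt : probability X R) (xi : 'rV[int]_d -> X -> 'rV[int]_d).
Hypothesis law : lattice_perturbation Pt theta xi.

Definition neg_potential (z : 'rV[int]_d -> 'rV[int]_d) (x : 'rV[R]_d) : \bar R :=
  \esum_(q in [set: 'rV[int]_d]) (- u (x - lattice_point q - lattice_point (z q)))%:E.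

Lemma neg_potential_ge0 z x : (0 <= neg_potential z x)%E.
Proof. by apply: esum_ge0 => q _; rewrite lee_fin oppr_ge0. Qed.

Lemma feynman_kacE {dO : measure_display} {O : measurableType dO}
    (P : probability O R) (B : R -> O -> 'rV[R]_d) z t :
  feynman_kac P B (potential u z) t =
  (\int[P]_w expeR (\int[lebesgue_measure]_(s in `[0%R, t]) neg_potential z (B s w)))%E.
Proof.
apply: eq_integral => w _; congr expeR.
rewrite /potential -/(neg_potential _ _) integral_ge0N ?oppeK// => s _.
exact: neg_potential_ge0.
Qed.

(** If q moves by less than (1 - dl) |z - q|, z being the cell of x, then its site
    stays at distance at least dl |z - q| - d from x and contributes at most a
    multiple of (1 + |z - q|)^(-alpha), which is summable over q. *)
Lemma neg_potential_le (dl : R) : 0 < dl < 1 -> exists S : R, forall z x,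
  (neg_potential z x <= S%:E + M%:E * \esum_(q in [set: 'rV[int]_d])
      (\1_(far ((1 - dl) * qnorm (cell x - q))) (z q))%:E)%E.
Proof.
move=> /andP[dl0 dl1]; have [C C_ge0 CP] := u_polynomial_bound.
have M0 : 0 < M := u_minimum_neg.
pose D0 : R := d%:R; have D00 : 0 <= D0 by rewrite ler0n.
pose k := dl / (1 + D0); have k0 : 0 < k by rewrite divr_gt0// ltr_pwDl.
pose C2 := C * k `^ (- alpha); have C20 : 0 <= C2 by rewrite mulr_ge0 ?powR_ge0.
have := esum_powR_lty d1 alpha_d.
set Sa := (\esum_(p in _) _)%E; have Sa0 : (0 <= Sa)%E by apply: esum_ge0 => p _; rewrite lee_fin powR_ge0.
case ES : Sa Sa0 => [s||]// s0 _.
exists (C2 * s) => z x.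
have bound q : - u (x - lattice_point q - lattice_point (z q)) <=
    C2 * (1 + qnorm (cell x - q)) `^ (- alpha) + M * \1_(far ((1 - dl) * qnorm (cell x - q))) (z q).
  set y := qnorm _; have y0 : 0 <= y by exact: qnorm_ge0.
  rewrite indicE; have [zf|zf] := boolP (z q \in _).
    rewrite mulr1; have := u_ge (x - lattice_point q - lattice_point (z q)).
    have : 0 <= C2 * (1 + y) `^ (- alpha) by rewrite mulr_ge0 ?powR_ge0.
    lra.
  rewrite mulr0 addr0; set v := x - _ - _.
  have pz : qnorm (z q) < (1 - dl) * y.
    by rewrite ltNge; apply/negP => h; move/negP: zf; apply; rewrite inE.
  have tri : y <= enorm v + qnorm (z q) + D0.
    rewrite /y /qnorm.
    (* z - q is the sum of the vector from the site to x, of the displacement of q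
   and of the vector from x to z *)
    have -> : lattice_point (cell x - q) = (v + lattice_point (z q)) + (- (x - lattice_point (cell x))) :> 'rV[R]_d.
      rewrite lattice_pointB /v; apply/rowP => i; rewrite !mxE; ring.
    apply: le_trans (enormD _ _) _; apply: lerD; first exact: enormD.
    by rewrite enormN; exact: cell_near.
  have v0 := enorm_ge0 v.
  apply: le_trans (CP v) _; rewrite -mulrA ler_wpM2l//.
  rewrite -powRM ?(ltW k0) ?addr_ge0// !powRN lef_pV2 ?posrE ?powR_gt0 ?mulr_gt0 ?ltr_pwDl// ?invr_gt0 ?ltr_pwDl//.
  have ky : 0 <= k * (1 + y) by rewrite mulr_ge0 ?(ltW k0) ?addr_ge0.
  rewrite ge0_ler_powR ?nnegrE ?(ltW alpha0) ?addr_ge0//.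
  rewrite /k mulrAC ler_pdivrMr ?ltr_pwDl//.
  have : 0 <= D0 * enorm v by rewrite mulr_ge0.
  have : dl * y <= enorm v + D0 by lra.
  lra.
rewrite /neg_potential.
apply: (@le_trans _ _ (\esum_(q in [set: 'rV[int]_d]) ((C2 * (1 + qnorm (cell x - q)) `^ (- alpha))%:E
    + (M * \1_(far ((1 - dl) * qnorm (cell x - q))) (z q))%:E)%E)).
  by apply: le_esum => q _; rewrite -EFinD lee_fin; exact: bound.
rewrite esumD; last 2 first.
- by move=> q _; rewrite lee_fin mulr_ge0 ?powR_ge0.
- by move=> q _; rewrite lee_fin mulr_ge0 ?(ltW M0).
apply: leeD.
  rewrite (reindex_esum [set: 'rV[int]_d] _ (fun y => cell x - y)); last first.
    by split=> //; [move=> a b _ _ /(addrI _)/oppr_inj|move=> y _; exists (cell x - y) => //; rewrite opprB addrC subrK].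
  under eq_esum do rewrite subKr EFinM.
  by rewrite esumZ// -/Sa ?ES -?EFinM// => q _; rewrite lee_fin powR_ge0.
under eq_esum do rewrite EFinM.
by rewrite esumZ ?(ltW M0).
Qed.

Lemma fk_moment_le (dl : R) : 0 < dl < 1 -> exists S D : R,
  forall {dO : measure_display} {O : measurableType dO} (P : probability O R)
    (B : R -> O -> 'rV[R]_d) (x0 : 'rV[R]_d) (p t : R),
  brownian_motion P x0 B -> 1 <= p -> 0 < t ->
  (\int[Pt]_w (feynman_kac P B (potential u (xi ^~ w)) t `^ p) <=
   (expR (p * t * S + ((1 - dl) `^ (2 + theta) *
      @excess R d theta (p * t * M / (1 - dl) `^ (2 + theta)) + D)))%:E)%E.
Proof.
move=> dl01; have [S SP] := neg_potential_le dl01.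
have M0 : 0 < M := u_minimum_neg.
have [D DP] := far_count_exp_moment d1 theta0 law dl01.
exists S, D => dO O P B x0 p t bm p1 t0.
have p0 : 0 < p by exact: lt_le_trans p1.
have pt0 : 0 < p * t by exact: mulr_gt0.
have [pi_ [pi0 pi1 piP]] := fk_power_le bm t0.
pose N w z := far_count xi dl z w.
have N0 w z : (0 <= N w z)%E by apply: esum_ge0 => q _; rewrite lee_fin.
pose G w z := (S%:E + M%:E * N w z)%E.
pose K := expR (p * t * S).
have GE w z : expeR ((p * t)%:E * G w z) = (K%:E * expeR ((p * t * M)%:E * N w z))%E.
  rewrite /G muleDr//.
  by rewrite expeRD muleA -!EFinM.
have mN z : measurable_fun setT (N ^~ z).
  apply: measurable_esum => q; last by move=> w; rewrite lee_fin.
  apply/measurable_EFinP; apply: measurable_indic; exact: (lp_measurable law).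
have me z : measurable_fun setT (fun w => expeR ((p * t * M)%:E * N w z)).
  by apply: (measurableT_comp measurable_expeR); apply: measurable_funeM.
apply: (@le_trans _ _ (\int[Pt]_w (\esum_(z in [set: 'rV[int]_d]) ((K%:E * expeR ((p * t * M)%:E * N w z)) * pi_ z)))%E).
  apply: le_lower_integral => w _; first exact: poweR_ge0.
  rewrite feynman_kacE; apply: le_trans (piP p (G w) (neg_potential (xi ^~ w)) p1 _ _) _.
  - by move=> x; exact: neg_potential_ge0.
  - move=> x; apply: le_trans (SP _ x) _; rewrite /G /N /far_count.
    by [].
  - by apply: le_esum => z _; rewrite GE.
rewrite integral_esum; last 2 first.
- by move=> z; apply: emeasurable_funM => //; exact: measurable_funeM.
- by move=> z w; rewrite !mule_ge0 ?expeR_ge0// lee_fin expR_ge0.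
set E := (_ * excess _ _ + D); rewrite expRD -/K EFinM.
apply: (@le_trans _ _ (\esum_(z in [set: 'rV[int]_d]) ((K * expR E)%:E * pi_ z))%E).
  apply: le_esum => z _.
  rewrite ge0_integralZr//; last 2 first.
  - exact: measurable_funeM.
  - by move=> w _; rewrite mule_ge0 ?expeR_ge0// lee_fin expR_ge0.
  rewrite lee_wpmul2r// ge0_integralZl_EFin ?expR_ge0//; last by move=> w _; exact: expeR_ge0.
  rewrite [(K * expR E)%:E]EFinM lee_wpmul2l ?lee_fin ?expR_ge0//.
  by apply: DP; exact: mulr_gt0.
by rewrite esumZ ?mulr_ge0 ?expR_ge0// pi1 mule1 EFinM.
Qed.

End upper_bound.

(** * Gaussian estimates *)

Section normal_bounds.
Context {R : realType}.

Lemma normal_pdf_sqrtE (v x : R) : 0 < v ->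
  normal_pdf 0 (Num.sqrt v) x = (Num.sqrt (2 * pi * v))^-1 * expR (- (x ^+ 2 / (2 * v))).
Proof.
move=> v0; rewrite normal_pdfE ?gt_eqF ?sqrtr_gt0// /normal_peak /normal_fun sqr_sqrtr ?(ltW v0)// subr0.
by rewrite mulNr -mulr_natl [2 * v]mulr_natl mulrA mulrAC.
Qed.

Lemma normal_itv_ge (v c h e : R) : 0 < v <= 1 -> 0 <= h -> (`|c| + h) ^+ 2 / (2 * v) <= e ->
  ((h / 2 * expR (- e))%:E <= normal_prob 0 (Num.sqrt v) `[(c - h)%R, (c + h)%R]%classic)%E.
Proof.
move=> /andP[v0 v1] h0 he.
have : (\int[lebesgue_measure]_(x in `[(c - h)%R, (c + h)%R]) (2^-1 / 2 * expR (- e))%:E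
    <= normal_prob 0 (Num.sqrt v) `[(c - h)%R, (c + h)%R]%classic)%E.
  apply: le_lower_integral => x /=.
    by move=> _; rewrite lee_fin !mulr_ge0 ?expR_ge0.
  rewrite in_itv/= => /andP[x1 x2]; rewrite lee_fin normal_pdf_sqrtE//.
  apply: ler_pM; rewrite ?mulr_ge0 ?expR_ge0//.
    rewrite -invfM lef_pV2 ?posrE ?mulr_gt0 ?sqrtr_gt0 ?pi_gt0//.
    rewrite -(@ler_sqr R) ?nnegrE ?sqrtr_ge0 ?mulr_ge0// sqr_sqrtr ?mulr_ge0 ?pi_ge0 ?(ltW v0)//.
    have p4 : pi <= 4 :> R by have := @pihalf_lt2 R; lra.
    have : pi * v <= 4 * 1 by rewrite ler_pM ?pi_ge0 ?(ltW v0).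
    rewrite -mulrA; lra.
    by rewrite !mulr_gt0 ?pi_gt0.
  rewrite ler_expR lerN2; apply: le_trans he; rewrite ler_pM2r ?invr_gt0 ?mulr_gt0//.
  rewrite -real_normK ?num_real// ler_sqr ?nnegrE ?addr_ge0//.
  have : - `|c| <= c <= `|c| by rewrite -ler_norml.
  move=> /andP[c1 c2]; rewrite ler_norml; apply/andP; split; lra.
rewrite integral_cst//= lebesgue_measure_itv/= lte_fin.
case: ifPn => [_|]; last by rewrite -leNgt => ?; have -> : h = 0; [lra|rewrite !mul0r mule0].
rewrite -EFinD -EFinM; apply: le_trans; rewrite lee_fin le_eqVlt; apply/orP; left; apply/eqP; field.
by [].
Qed.

Lemma normal_itv_le (v a b : R) : 1 <= v -> a <= b ->
  (normal_prob 0 (Num.sqrt v) `[a, b]%classic <= (b - a)%:E)%E.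
Proof.
move=> v1 ab; have v0 : 0 < v by exact: lt_le_trans v1.
apply: (@le_trans _ _ (\int[lebesgue_measure]_(x in `[a, b]) 1%:E)%E).
  apply: le_lower_integral => x _; first by rewrite lee_fin normal_pdf_ge0.
  rewrite lee_fin normal_pdf_sqrtE// -[leRHS]mulr1; apply: ler_pM; rewrite ?expR_ge0//.
    rewrite -[leRHS]invr1 lef_pV2 ?posrE ?sqrtr_gt0 ?mulr_gt0 ?pi_gt0//.
    rewrite -[leLHS]sqrtr1 ler_wsqrtr//.
    have p2 : 2 <= pi :> R by exact: pi_ge2.
    have : 2 * 1 <= pi * v by rewrite ler_pM.
    rewrite -mulrA; lra.
  by rewrite -[leRHS]expR0 ler_expR lerNl oppr0 mulr_ge0 ?sqr_ge0 ?invr_ge0 ?mulr_ge0 ?(ltW v0).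
rewrite integral_cst//= mul1e lebesgue_measure_itv/= lte_fin.
by case: ifPn => //; rewrite lee_fin subr_ge0.
Qed.

(** On the tail, the density is at most 2 exp (- rho^2 / (4 v)) times the density
    of variance 2 v. *)
Lemma normal_tail (v rho : R) : 0 < v -> 0 <= rho ->
  (normal_prob 0 (Num.sqrt v) [set x | (rho < `|x|)%R] <= (2 * expR (- (rho ^+ 2 / (4 * v))))%:E)%E.
Proof.
move=> v0 rho0; set K := 2 * _; have K0 : 0 <= K by rewrite mulr_ge0 ?expR_ge0.
have v20 : 0 < 2 * v by rewrite mulr_gt0.
apply: (@le_trans _ _ (\int[lebesgue_measure]_x (K%:E * (normal_pdf 0 (Num.sqrt (2 * v)) x)%:E))%E); last first.
  rewrite ge0_integralZl_EFin//; last 2 first.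
  - by move=> x _; rewrite lee_fin normal_pdf_ge0.
  - by apply/measurable_EFinP; exact: measurable_normal_pdf.
  by rewrite integral_normal_pdf mule1.
rewrite /normal_prob integral_mkcond; apply: le_lower_integral => x _.
  by rewrite erestrict_ge0// => y _; rewrite lee_fin normal_pdf_ge0.
rewrite patchE; case: ifPn => [|_]; last by rewrite -EFinM lee_fin mulr_ge0 ?normal_pdf_ge0.
rewrite inE/= => rx; rewrite -EFinM lee_fin !normal_pdf_sqrtE// /K.
have x2 : rho ^+ 2 <= x ^+ 2 by rewrite -[leRHS]real_normK ?num_real// ler_sqr ?nnegrE// ltW.
have -> : 2 * expR (- (rho ^+ 2 / (4 * v))) * ((Num.sqrt (2 * pi * (2 * v)))^-1 * expR (- (x ^+ 2 / (2 * (2 * v))))) =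
  (2 * (Num.sqrt (2 * pi * (2 * v)))^-1) * (expR (- (rho ^+ 2 / (4 * v))) * expR (- (x ^+ 2 / (2 * (2 * v))))) by ring.
apply: ler_pM; rewrite ?expR_ge0 ?invr_ge0 ?sqrtr_ge0//.
  rewrite ler_pdivlMr ?sqrtr_gt0 ?mulr_gt0 ?pi_gt0// mulrC ler_pdivrMr ?sqrtr_gt0 ?mulr_gt0 ?pi_gt0//.
  rewrite -(@ler_sqr R) ?nnegrE ?mulr_ge0 ?sqrtr_ge0// exprMn !sqr_sqrtr ?mulr_ge0 ?pi_ge0 ?(ltW v0)//.
  have : 0 <= pi * v by rewrite mulr_ge0 ?pi_ge0 ?ltW.
  rewrite -!mulrA [pi * (2 * v)]mulrCA; lra.
rewrite -expRD ler_expR -opprD lerN2.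
have -> : x ^+ 2 / (2 * v) = x ^+ 2 / (4 * v) + x ^+ 2 / (4 * v) by field; rewrite gt_eqF.
have -> : x ^+ 2 / (2 * (2 * v)) = x ^+ 2 / (4 * v) by field; rewrite gt_eqF.
by rewrite lerD2r ler_pM2r ?invr_gt0 ?mulr_gt0.
Qed.

End normal_bounds.

(** * Increments of the motion *)

Section brownian_increments.
Context {R : realType} {d : nat} {dO : measure_display} {O : measurableType dO}.
Variables (P : probability O R) (x0 : 'rV[R]_d) (B : R -> O -> 'rV[R]_d).
Hypothesis bm : brownian_motion P x0 B.

Lemma borel_coords (Y : 'I_d -> set R) : (forall i, measurable (Y i)) ->
  borel [set x : 'rV[R]_d | forall i, Y i (x 0 i)].
Proof.
move=> mY; rewrite (_ : [set x | _] = \bigcap_(i in [set: 'I_d]) [set x : 'rV[R]_d | Y i (x 0 i)]).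
  apply: (@fin_bigcap_measurable _ (g_sigma_algebraType [set A : set 'rV[R]_d | open A])) => // i _.
  exact: borel_coord.
by apply/seteqP; split=> x /= h i; [move=> _|]; exact: h.
Qed.

Lemma boxE (a b : 'rV[R]_d) : box a b = [set x | forall i, `[a 0 i, b 0 i]%classic (x 0 i)].
Proof. by apply/seteqP; split=> x /= h i; have := h i; rewrite /= in_itv. Qed.

Lemma borel_box (a b : 'rV[R]_d) : borel (box a b).
Proof. by rewrite boxE; apply: (borel_coords (Y := fun i => `[a 0 i, b 0 i]%classic)) => i. Qed.

Definition increment (s t : R) (w : O) : 'rV[R]_d := B t w - B s w.

Lemma measurable_increment_coord (s t : R) i : 0 <= s -> 0 <= t ->
  measurable_fun setT (fun w => increment s t w 0 i).
Proof.
move=> s0 t0; rewrite (_ : (fun w => _) = (fun w => B t w 0 i - B s w 0 i)).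
  by apply: measurable_funB; exact: (bm_coord_measurable bm).
by apply/funext => w; rewrite /increment !mxE.
Qed.

Lemma measurable_increment_coords (s t : R) (Y : 'I_d -> set R) : 0 <= s -> 0 <= t ->
  (forall i, measurable (Y i)) ->
  measurable (increment s t @^-1` [set x | forall i, Y i (x 0 i)]).
Proof.
move=> s0 t0 mY.
rewrite (_ : _ @^-1` _ = \bigcap_(i in [set: 'I_d]) ((fun w => increment s t w 0 i) @^-1` Y i)).
  apply: fin_bigcap_measurable => // i _; rewrite -[X in measurable X]setTI.
  exact: measurable_increment_coord.
by apply/seteqP; split=> x /= h i; [move=> _|]; exact: h.
Qed.

Lemma measurable_increment_box (s t : R) (a b : 'rV[R]_d) : 0 <= s -> 0 <= t ->
  measurable (increment s t @^-1` box a b).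
Proof.
move=> s0 t0; rewrite boxE.
exact: (measurable_increment_coords (Y := fun i => `[a 0 i, b 0 i]%classic)).
Qed.

Lemma increment_coords (s t : R) (Y : 'I_d -> set R) : 0 <= s -> s < t ->
  (forall i, measurable (Y i)) ->
  P (increment s t @^-1` [set x | forall i, Y i (x 0 i)]) =
  (\prod_(i < d) normal_prob 0 (Num.sqrt (t - s)) (Y i))%E.
Proof.
move=> s0 st mY.
pose J := [fset i in enum 'I_d]%fset.
transitivity (P (\bigcap_(i in [set` J]) (fun w => B t w 0 i - B s w 0 i) @^-1` Y i)).
  congr (P _); apply/seteqP; split=> w /= h i.
    by move=> _ /=; have := h i; rewrite /increment !mxE.
  have := h i; rewrite /= !inE/= mem_enum => /(_ isT); by rewrite /increment !mxE.
rewrite (bm_independent_coordinates bm s0 st)//.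
rewrite [LHS](_ : _ = \prod_(i <- J) normal_prob 0 (Num.sqrt (t - s)) (Y i))%E; last first.
  by apply: eq_bigr => i _; rewrite -(bm_gaussian bm i s0 st (mY i)).
rewrite -big_enum/=; apply: perm_big; apply: uniq_perm => [||i]; rewrite ?fset_uniq ?enum_uniq//.
by rewrite !inE/= mem_enum.
Qed.

Lemma increment_box_ge (s t h e : R) (c : 'rV[R]_d) : 0 <= s -> s < t -> t - s <= 1 -> 0 <= h ->
  (forall i, (`|c 0 i| + h) ^+ 2 / (2 * (t - s)) <= e) ->
  (((h / 2 * expR (- e)) ^+ d)%:E <=
     P (increment s t @^-1` box (c - const_mx h) (c + const_mx h)))%E.
Proof.
move=> s0 st ts1 h0 he; rewrite boxE (increment_coords (Y := fun i => `[(c - const_mx h) 0 i, (c + const_mx h) 0 i]%classic))//.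
have -> : ((h / 2 * expR (- e)) ^+ d)%:E = (\prod_(i < d) (h / 2 * expR (- e))%:E)%E.
  by rewrite prodEFin prodr_const card_ord.
have k0 : (0 <= (h / 2 * expR (- e))%:E)%E by rewrite lee_fin mulr_ge0 ?expR_ge0 ?divr_ge0.
suff H : (0 <= \prod_(i < d) (h / 2 * expR (- e))%:E)%E /\ (\prod_(i < d) (h / 2 * expR (- e))%:E <=
  \prod_(i < d) normal_prob 0 (Num.sqrt (t - s)) `[((c - const_mx h) 0 i)%R, ((c + const_mx h) 0 i)%R]%classic)%E by case: H.
apply: (big_ind2 (fun x y : \bar R => (0 <= x)%E /\ (x <= y)%E)) => //.
- by move=> x1 x2 y1 y2 [? ?] [? ?]; split; [exact: mule_ge0|exact: lee_pmul].
- move=> i _; split=> //; rewrite !mxE; apply: normal_itv_ge => //.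
  by rewrite subr_gt0 st.
Qed.

Lemma increment_box_le (s t : R) (a b : 'rV[R]_d) : 0 <= s -> 1 <= t - s ->
  (forall i, a 0 i <= b 0 i) ->
  (P (increment s t @^-1` box a b) <= (\prod_(i < d) (b 0 i - a 0 i))%:E)%E.
Proof.
move=> s0 st ab; have st' : s < t by lra.
rewrite boxE (increment_coords (Y := fun i => `[a 0 i, b 0 i]%classic))// -prodEFin.
suff H : (0 <= \prod_(i < d) normal_prob 0 (Num.sqrt (t - s)) `[(a 0 i)%R, (b 0 i)%R]%classic)%E /\
  (\prod_(i < d) normal_prob 0 (Num.sqrt (t - s)) `[(a 0 i)%R, (b 0 i)%R]%classic <= \prod_(i < d) (b 0 i - a 0 i)%:E)%E by case: H.
apply: (big_ind2 (fun x y : \bar R => (0 <= x)%E /\ (x <= y)%E)) => //.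
- by move=> x1 x2 y1 y2 [? ?] [? ?]; split; [exact: mule_ge0|exact: lee_pmul].
- by move=> i _; split; [exact: measure_ge0|exact: normal_itv_le].
Qed.

Definition large (rho : R) : set 'rV[R]_d := [set x | exists i, (rho < `|x 0 i|)%R].

Let tail_measurable (rho : R) : measurable [set x : R | (rho < `|x|)%R].
Proof.
have mn : measurable_fun setT (fun x : R => `|x|) by exact: normr_measurable.
have := mn measurableT _ (measurable_itv `]rho, +oo[).
by rewrite setTI; congr measurable; apply/seteqP; split=> x /=; rewrite in_itv/= andbT.
Qed.

Lemma borel_large (rho : R) : borel (large rho).
Proof.
rewrite (_ : large rho = \bigcup_(i in [set: 'I_d]) [set x : 'rV[R]_d | (rho < `|x 0 i|)%R]).
  apply: (@fin_bigcup_measurable _ (g_sigma_algebraType [set A : set 'rV[R]_d | open A])) => // i _.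
  exact: (borel_coord i (tail_measurable rho)).
by apply/seteqP; split=> x /=; [move=> [i h]|move=> [i _ h]]; exists i.
Qed.

Let large_coord (s t rho : R) (k : nat) : set O :=
  if insub k is Some i then [set w | (rho < `|increment s t w 0 (i : 'I_d)|)%R] else set0.

Lemma increment_largeE (s t rho : R) : increment s t @^-1` large rho =
  \big[setU/set0]_(k < d) large_coord s t rho k.
Proof.
rewrite -bigcup_mkord; apply/seteqP; split=> w /=.
  by move=> [i h]; exists i => //=; rewrite /large_coord valK.
by move=> [k kd]; rewrite /large_coord insubT => h; exists (Ordinal kd).
Qed.

Let measurable_large_coord (s t rho : R) k : 0 <= s -> 0 <= t ->
  measurable (large_coord s t rho k).
Proof.
move=> s0 t0; rewrite /large_coord; case: insubP => [i _ _|_] //; have := measurable_increment_coord i s0 t0 measurableT (tail_measurable rho).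
by rewrite setTI.
Qed.

Lemma measurable_increment_large (s t rho : R) : 0 <= s -> 0 <= t ->
  measurable (increment s t @^-1` large rho).
Proof.
move=> s0 t0; rewrite increment_largeE; apply: bigsetU_measurable => i _.
exact: measurable_large_coord.
Qed.

Lemma increment_large_le (s t rho : R) : 0 <= s -> s < t -> 0 <= rho ->
  (P (increment s t @^-1` large rho) <= (d%:R * (2 * expR (- (rho ^+ 2 / (4 * (t - s))))))%:E)%E.
Proof.
move=> s0 st rho0; have t0 : 0 <= t by lra.
rewrite increment_largeE.
apply: le_trans (Boole_inequality _ _) _ => //.
  by move=> k _; exact: measurable_large_coord.
apply: (@le_trans _ _ (\sum_(i < d) (2 * expR (- (rho ^+ 2 / (4 * (t - s)))))%:E)%E).
  apply: lee_sum => i _.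
  have -> : large_coord s t rho i = [set w | [set x : R | (rho < `|x|)%R] (B t w 0 i - B s w 0 i)].
    by rewrite /large_coord valK; apply/seteqP; split=> w /=; rewrite /increment !mxE.
  have G := bm_gaussian bm i s0 st (tail_measurable rho).
  have ts0 : 0 < t - s by rewrite subr_gt0.
  apply: le_trans (normal_tail ts0 rho0); rewrite le_eqVlt; apply/orP; left; apply/eqP; exact: G.
by rewrite sumEFin lee_fin sumr_const card_ord -[leLHS]mulr_natl.
Qed.

Lemma increments_product (tau : nat -> R) (A : nat -> set 'rV[R]_d) (J : seq nat) :
  0 <= tau 0%N -> {homo tau : i j / (i < j)%N >-> i < j} -> (forall j, borel (A j)) -> uniq J ->
  P [set w | forall j, j \in J -> A j (increment (tau j) (tau j.+1) w)] =
  (\prod_(j <- J) P (increment (tau j) (tau j.+1) @^-1` A j))%E.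
Proof.
move=> t0 tm mA uJ; pose J' := [fset i in J]%fset.
transitivity (P (\bigcap_(i in [set` J']) increment (tau i) (tau i.+1) @^-1` A i)).
  congr (P _); apply/seteqP; split=> w /= h i.
    by rewrite /= !inE/= => iJ; exact: h.
  by move=> iJ; apply: h; rewrite /= !inE.
rewrite (bm_independent_increments bm t0 tm)//.
apply: perm_big; apply: uniq_perm => [||i]; rewrite ?fset_uniq//.
by rewrite !inE.
Qed.

End brownian_increments.

(** * Confining the motion to a small cube *)

Section confinement.
Context {R : realType} {d : nat} {dO : measure_display} {O : measurableType dO}.
Variables (P : probability O R) (x0 : 'rV[R]_d) (B : R -> O -> 'rV[R]_d).
Hypothesis bm : brownian_motion P x0 B.
Variables (m n : nat) (h r : R).
Hypotheses (m0 : (0 < m)%N) (h0 : 0 <= h) (r0 : 0 < r) (nh : n%:R * h <= r / 2).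

Let tau (j : nat) : R := j%:R / m%:R.
Let mR : 0 < m%:R :> R. Proof. by rewrite ltr0n. Qed.
Let tau_ge0 j : 0 <= tau j. Proof. by rewrite divr_ge0. Qed.
Let tau_lt : {homo tau : i j / (i < j)%N >-> i < j}.
Proof. by move=> i j ij; rewrite /tau ltr_pM2r ?invr_gt0// ltr_nat. Qed.
Let tauS j : tau j.+1 - tau j = m%:R^-1.
Proof. by rewrite /tau -mulrBl -natr1 addrC addKr mul1r. Qed.

(** The first increment takes the motion from x0 to the origin. *)
Definition step_center (j : nat) : 'rV[R]_d := if j is 0%N then - x0 else 0.

Definition step_box (j : nat) : set 'rV[R]_d :=
  box (step_center j - const_mx h) (step_center j + const_mx h).

Definition confined : set O :=
  [set w | forall j, (j < n)%N -> step_box j (increment B (j%:R / m%:R) (j.+1%:R / m%:R) w)].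

Let p j : \bar R := P (increment B (tau j) (tau j.+1) @^-1` step_box j).

Lemma confined_prob : P confined = (\prod_(j <- iota 0 n) p j)%E.
Proof.
rewrite -(increments_product bm (tau_ge0 0) tau_lt); last 2 first.
- by move=> j; exact: borel_box.
- exact: iota_uniq.
by congr (P _); apply/seteqP; split=> w /= H j; have := H j; rewrite mem_iota add0n.
Qed.

Lemma measurable_confined : measurable confined.
Proof.
rewrite (_ : confined = \bigcap_(j in `I_n) (increment B (tau j) (tau j.+1) @^-1` step_box j)).
  apply: bigcap_measurableType => j _.
  exact: (measurable_increment_box bm).
by apply/seteqP; split=> w /= H j; exact: H.
Qed.

Lemma confined_position w k : B 0 w = x0 -> confined w -> (k < n)%N ->
  forall i, `|B (tau k.+1) w 0 i| <= k.+1%:R * h.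
Proof.
move=> B0 cw; elim: k => [|k IH] kn i.
  have := cw 0%N kn i; rewrite (_ : 0%:R / m%:R = 0) ?mul0r// /increment B0 !mxE /= ?mxE -/(tau 1).
  rewrite mul1r ler_norml => /andP[a1 a2]; apply/andP; split; lra.
have := IH (ltnW kn) i; have := cw k.+1 kn i.
rewrite /increment !mxE /= ?mxE -/(tau k.+1) -/(tau k.+2) -[k.+2%:R]natr1 mulrDl mul1r.
rewrite !ler_norml => /andP[a1 a2] /andP[b1 b2]; apply/andP; split; lra.
Qed.

Variables (s : R) (k : nat).
Hypotheses (k1 : (1 <= k)%N) (kn : (k < n)%N) (ks : tau k <= s < tau k.+1).

(** The grid positions stay within n h <= r / 2 of the origin, in each coordinate,
    and the increment since the last grid time adds at most r / 2. *)
Lemma confined_at : {ae P, forall w, confined w ->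
  ~ large (r / 2) (increment B (tau k) s w) -> box (const_mx (- r)) (const_mx r) (B s w)}.
Proof.
have := bm_start bm; apply: filterS => w B0 cw nl i; rewrite !mxE.
have k0 : (k.-1 < n)%N by apply: leq_ltn_trans kn; exact: leq_pred.
have := confined_position B0 cw k0 i; rewrite prednK// => pos.
have nhk : k%:R * h <= r / 2.
  by apply: le_trans nh; rewrite ler_wpM2r// ler_nat ltnW.
have : `|increment B (tau k) s w 0 i| <= r / 2.
  by rewrite leNgt; apply/negP => lt; apply: nl; exists i.
have : `|B (tau k) w 0 i| <= r / 2 by exact: le_trans pos nhk.
rewrite /increment !mxE !ler_norml => /andP[a1 a2] /andP[b1 b2]; apply/andP; split; lra.
Qed.

Variables (eps q : R).
Hypotheses (eps0 : 0 <= eps) (qp : forall j, (1 <= j)%N -> (q%:E <= p j)%E).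
Hypothesis small : d%:R * (2 * expR (- (r ^+ 2 * m%:R / 16))) <= eps * q.

(** Insert the time s into the grid and drop the condition on the k-th step: the
    increments of the refined grid are independent, so that the probability is
    at most that of [confined] times P(large increment) / P(k-th step), and
    the assumption [small] makes this ratio at most eps. *)
Lemma confined_escape : (P (confined `&` increment B (tau k) s @^-1` large (r / 2)) <=
  eps%:E * P confined)%E.
Proof.
have /andP[k_s sk] := ks.
have s0 : 0 <= s by exact: le_trans (tau_ge0 k) k_s.
have [->|sNk] := eqVneq s (tau k).
  rewrite [X in P X](_ : _ = set0) ?measure0 ?mule_ge0 ?lee_fin//.
  apply/seteqP; split=> // w /= [_ [i]]; rewrite /increment subrr mxE normr0 ltNge.
  by rewrite divr_ge0 ?(ltW r0).
have ks' : tau k < s by rewrite lt_neqAle eq_sym sNk.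
(* s is the (k+1)-st time of the refined grid; the old k-th step is split into a
   step to s, which is large, and a step from s, whose index k+1 is left out of J' *)
pose tau' j := if (j <= k)%N then tau j else if j == k.+1 then s else tau j.-1.
pose A' j := if (j < k)%N then step_box j else if j == k then large (r / 2) else step_box j.-1.
have tau'0 : 0 <= tau' 0%N by rewrite /tau' leq0n tau_ge0.
have tau'S : forall j, tau' j < tau' j.+1.
  move=> j; rewrite /tau'; have [jk|] := ltnP j k.
    by rewrite (ltnW jk); exact: tau_lt.
  rewrite leq_eqVlt => /predU1P[<-|kj]; first by rewrite leqnn eqxx.
  rewrite leqNgt kj/= eqSS (gtn_eqF kj).
  have [->|jk] := eqVneq j k.+1; first by [].
  by apply: tau_lt; case: j kj jk.
have tau'_lt : {homo tau' : i j / (i < j)%N >-> i < j}.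
  by apply: homo_ltn => //; exact: lt_trans.
have mA' j : borel (A' j).
  by rewrite /A'; case: ifP => _; [exact: borel_box|case: ifP => _; [exact: borel_large|exact: borel_box]].
have shift j : (k < j)%N -> [/\ A' j.+1 = step_box j, tau' j.+1 = tau j & tau' j.+2 = tau j.+1].
  move=> kj; rewrite /A' /tau'.
  have -> : (j.+1 < k)%N = false by apply/negbTE; rewrite -leqNgt ltnW// ltnW.
  have -> : (j.+1 <= k)%N = false by apply/negbTE; rewrite -ltnNge ltnW.
  by rewrite eqSS !gtn_eqF// ltnW.
pose J' := iota 0 k ++ k :: iota k.+2 (n - k.+1).
have J'u : uniq J'.
  rewrite cat_uniq /= negb_or !iota_uniq !mem_iota !add0n !ltnn !andbF/= andbT.
  have -> : (k.+1 < k)%N = false by apply/negbTE; rewrite -leqNgt ltnW.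
  rewrite andbT.
  apply/hasPn => j; rewrite !mem_iota add0n -leqNgt => /andP[h1 _].
  by rewrite (leq_trans _ h1)// -addn2 leq_addr.
apply: (@le_trans _ _ (P [set w | forall j, j \in J' -> A' j (increment B (tau' j) (tau' j.+1) w)])).
  apply: le_measure.
  - rewrite inE; apply: measurableI; first exact: measurable_confined.
    exact: (measurable_increment_large bm).
  - rewrite inE.
    rewrite (_ : [set w | _] = \bigcap_(j in [set` J']) (increment B (tau' j) (tau' j.+1) @^-1` A' j)) //.
    have tau'_ge0 j : 0 <= tau' j by rewrite /tau'; case: ifP => // _; case: ifP.
    apply: bigcap_measurableType => j _.
    rewrite /A'; case: ifP => _; first exact: (measurable_increment_box bm).
    case: ifP => _; first exact: (measurable_increment_large bm).
    exact: (measurable_increment_box bm).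
  - move=> w [cw lw] j; rewrite mem_cat inE !mem_iota add0n => /orP[/= jk|/orP[/eqP ->|/andP[kj jn]]].
    + by rewrite /A' /tau' jk (ltnW jk); apply: cw; exact: ltn_trans kn.
    + by rewrite /A' /tau' !ltnn leqnn !eqxx.
    + case: j kj jn => // j kj jn; have [-> -> ->] := shift _ kj.
      apply: cw; move: jn; rewrite -[k.+2]addn1 addnAC subnKC// addn1 ltnS; exact.
rewrite (increments_product bm tau'0 tau'_lt mA' J'u) confined_prob.
have nE : n = (k + (1 + (n - k.+1)))%N by rewrite addnA addn1 subnKC.
rewrite [in iota 0 n]nE iotaD big_cat/= add0n big_cons big_cat/= big_cons.
have E1 : (\prod_(j <- iota 0 k) P (increment B (tau' j) (tau' j.+1) @^-1` A' j) =
           \prod_(j <- iota 0 k) p j)%E.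
  rewrite !big_seq; apply: eq_bigr => j; rewrite mem_iota add0n /= => jk.
  by rewrite /A' /tau' jk (ltnW jk).
have E2 : (\prod_(j <- iota k.+2 (n - k.+1)) P (increment B (tau' j) (tau' j.+1) @^-1` A' j) =
           \prod_(j <- iota k.+1 (n - k.+1)) p j)%E.
  rewrite -[k.+2]add1n iotaDl big_map !big_seq; apply: eq_bigr => j; rewrite mem_iota => /andP[kj _].
  rewrite add1n.
  by have [-> -> ->] := shift _ kj.
rewrite E1 E2 !muleA [(eps%:E * _)%E]muleC -!muleA.
have p_ge0 j : (0 <= p j)%E by exact: measure_ge0.
apply: lee_pmul => //.
- by apply: prode_ge0.
- by rewrite mule_ge0 ?measure_ge0// prode_ge0.
rewrite muleCA [leRHS]muleA; apply: lee_pmul => //.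
- by apply: prode_ge0.
rewrite /A' /tau' !ltnn leqnn !eqxx.
apply: le_trans (increment_large_le bm (tau_ge0 k) ks' (ltW (divr_gt0 r0 (ltr0n _ 2)))) _.
apply: (@le_trans _ _ (eps * q)%:E); last first.
  by rewrite EFinM muleC lee_wpmul2r// qp.
rewrite lee_fin; apply: le_trans small; rewrite ler_wpM2l// ler_wpM2l// ler_expR lerN2.
have v0 : 0 < s - tau k by rewrite subr_gt0.
rewrite ler_pdivlMr ?mulr_gt0//.
have vm : (s - tau k) * m%:R <= 1.
  by rewrite -ler_pdivlMr// mul1r -(tauS k); rewrite lerD2r ltW.
have r2 : 0 <= r ^+ 2 by exact: sqr_ge0.
have := ler_wpM2l r2 vm; rewrite expr_div_n; lra.
Qed.

End confinement.

(** * Avoiding a Lebesgue-null set *)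

Section avoidance.
Context {R : realType} {d : nat}.

(** A countable combination of boxes, hence visibly measurable along any family of
    measurable coordinates. *)
Definition box_limsup (ab : nat -> nat -> 'rV[R]_d * 'rV[R]_d) : set 'rV[R]_d :=
  \bigcap_m \bigcup_k box (ab m k).1 (ab m k).2.

Definition null_cover (ab : nat -> nat -> 'rV[R]_d * 'rV[R]_d) : Prop :=
  (forall m k i, (ab m k).1 0 i <= (ab m k).2 0 i) /\
  forall m, (\sum_(0 <= k <oo) (\prod_(i < d) ((ab m k).2 0 i - (ab m k).1 0 i))%:E <= (m.+1%:R^-1)%:E)%E.

Lemma lebesgue_outer_null (A : set 'rV[R]_d) : lebesgue_outer A = 0%E ->
  exists2 ab, null_cover ab & A `<=` box_limsup ab.
Proof.
move=> A0.
have H (m : nat) : exists ab : nat -> 'rV[R]_d * 'rV[R]_d,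
    [/\ (forall k i, (ab k).1 0 i <= (ab k).2 0 i), A `<=` \bigcup_k box (ab k).1 (ab k).2 &
    (\sum_(0 <= k <oo) (\prod_(i < d) ((ab k).2 0 i - (ab k).1 0 i))%:E <= (m.+1%:R^-1)%:E)%E].
  have : (lebesgue_outer A < (m.+1%:R^-1)%:E)%E by rewrite A0 lte_fin invr_gt0.
  by move=> /ereal_inf_lt [_ [ab [ab1 ab2] <-]] /ltW h; exists ab.
have [ab abP] := choice H.
exists ab; first by split=> [m k i|m]; have [] := abP m.
by move=> x Ax m _; have [_ + _] := abP m; apply.
Qed.

Context {dO : measure_display} {O : measurableType dO}.
Variables (P : probability O R) (x0 : 'rV[R]_d) (B : R -> O -> 'rV[R]_d).
Hypothesis bm : brownian_motion P x0 B.

(** After time 1 the density of the motion is at most 1, so the probability of a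
    box is at most its volume. *)
Lemma brownian_avoids_null ab (s : R) : null_cover ab -> 1 <= s ->
  {ae P, forall w, ~ box_limsup ab (B s w)}.
Proof.
move=> [abP abm] s1; have s0 : 0 <= s by lra.
pose S m k := increment B 0 s @^-1` box ((ab m k).1 - x0) ((ab m k).2 - x0).
have mS m k : measurable (S m k) by exact: (measurable_increment_box bm).
have SE m k w : B 0 w = x0 -> box (ab m k).1 (ab m k).2 (B s w) -> S m k w.
  by move=> B0 h i; have := h i; rewrite /increment !mxE B0 !lerD2r.
have : {ae P, forall w, ~ (\bigcap_m \bigcup_k S m k) w}.
  exists (\bigcap_m \bigcup_k S m k); split.
  - by apply: bigcap_measurableType => m _; exact: bigcupT_measurable.
  - apply/eqP; rewrite eq_le measure_ge0 andbT; apply/lee_addgt0Pr => e e0; rewrite add0e.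
    pose m := Num.truncn e^-1.
    apply: (@le_trans _ _ (P (\bigcup_k S m k))).
      apply: le_measure; rewrite ?inE; [|exact: bigcupT_measurable|by move=> w; apply].
      by apply: bigcap_measurableType => j _; exact: bigcupT_measurable.
    apply: (@le_trans _ _ (\sum_(0 <= k <oo) P (S m k))%E).
      apply: measure_sigma_subadditive => //; exact: bigcupT_measurable.
    apply: (@le_trans _ _ (m.+1%:R^-1)%:E).
      apply: le_trans (abm m); apply: lee_nneseries => [k _ _|k _]; first exact: measure_ge0.
      have := @increment_box_le _ _ _ _ _ _ _ bm 0 s ((ab m k).1 - x0) ((ab m k).2 - x0) (lexx _).
      rewrite subr0 => /(_ s1); rewrite (_ : \prod_(i < d) _ = \prod_(i < d) ((ab m k).2 0 i - (ab m k).1 0 i)).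
        by apply=> i; rewrite !mxE lerD2r.
      by apply: eq_bigr => i _; rewrite !mxE; lra.
    rewrite lee_fin -[leRHS]invrK lef_pV2 ?posrE ?invr_gt0//.
    by rewrite /m ltW// truncnS_gt.
  - by move=> w; apply: contrapT.
move=> h; have := bm_start bm; apply: filterS2 h => w nw B0 bw; apply: nw => m _.
by have [k _ bk] := bw m Logic.I; exists k => //; exact: SE.
Qed.

End avoidance.

(** * Exponential moments of the time spent in a good set *)

Section exponential_occupation.
Context {R : realType} {d : nat} {dO : measure_display} {O : measurableType dO}.

Lemma measurable_row_box {dT : measure_display} {T : measurableType dT}
    (f : 'I_d -> T -> R) (a b : 'rV[R]_d) : (forall i, measurable_fun setT (f i)) ->
  measurable ((fun x => \row_i f i x) @^-1` box a b).
Proof.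
move=> mf.
rewrite (_ : _ @^-1` _ = \bigcap_(i in [set: 'I_d]) (f i @^-1` `[a 0 i, b 0 i])).
  apply: fin_bigcap_measurable => // i _; rewrite -[X in measurable X]setTI.
  exact: (mf i _ _ (measurable_itv _)).
by apply/seteqP; split=> x /= h i; [move=> _|]; have := h i; rewrite /= mxE in_itv//=; apply.
Qed.

Lemma measurable_row_limsup {dT : measure_display} {T : measurableType dT}
    (f : 'I_d -> T -> R) (ab : nat -> nat -> 'rV[R]_d * 'rV[R]_d) :
  (forall i, measurable_fun setT (f i)) ->
  measurable ((fun x => \row_i f i x) @^-1` box_limsup ab).
Proof.
move=> mf; rewrite /box_limsup preimage_bigcap; apply: bigcap_measurableType => j _.
by rewrite preimage_bigcup; apply: bigcupT_measurable => k; exact: measurable_row_box.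
Qed.

Variables (P : probability O R) (x0 : 'rV[R]_d) (B : R -> O -> 'rV[R]_d).
Hypothesis bm : brownian_motion P x0 B.
Variables (m n : nat) (h r t eps q : R) (ab : nat -> nat -> 'rV[R]_d * 'rV[R]_d).
Hypotheses (m0 : (0 < m)%N) (h0 : 0 <= h) (r0 : 0 < r) (nh : n%:R * h <= r / 2).
Hypotheses (t1 : 1 < t) (tn : t * m%:R < n%:R) (eps01 : 0 <= eps <= 1).
Hypothesis qp : forall j, (1 <= j)%N ->
  (q%:E <= P (increment B (j%:R / m%:R) (j.+1%:R / m%:R) @^-1` step_box x0 h j))%E.
Hypothesis small : d%:R * (2 * expR (- (r ^+ 2 * m%:R / 16))) <= eps * q.
Hypothesis null : null_cover ab.

Definition good_set : set 'rV[R]_d := box (const_mx (- r)) (const_mx r) `\` box_limsup ab.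

Let E := confined x0 B m n h.

Lemma confined_visit (s : R) (V : set O) : 1 <= s <= t -> measurable V ->
  {ae P, forall w, good_set (B s w) -> V w} -> ((1 - eps)%:E * P E <= P (E `&` V))%E.
Proof.
move=> /andP[s1 st] mV aeV.
have mR : 0 < m%:R :> R by rewrite ltr0n.
have s0 : 0 <= s by lra.
have sm0 : 0 <= s * m%:R by rewrite mulr_ge0.
pose k := Num.truncn (s * m%:R).
have k1 : (1 <= k)%N.
  by rewrite truncn_ge_nat// mulr_ege1// ler1n.
have kn : (k < n)%N.
  rewrite -(ltr_nat R); apply: le_lt_trans tn; apply: le_trans (_ : s * m%:R <= _).
    by rewrite truncn_le.
  by rewrite ler_wpM2r.
have ks : k%:R / m%:R <= s < k.+1%:R / m%:R.
  by rewrite ler_pdivrMr// ltr_pdivlMr// truncn_le sm0 truncnS_gt.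
have /andP[eps0 eps1] := eps01.
have esc := confined_escape bm m0 r0 k1 kn ks eps0 qp small.
set F := increment B (k%:R / m%:R) s @^-1` large (r / 2) in esc.
have mE : measurable E by exact: (measurable_confined bm).
have mF : measurable F by exact: (measurable_increment_large bm).
have fE : P E \is a fin_num by exact: fin_num_measure.
rewrite EFinB muleBl ?fin_num_adde_defr// mul1e leeBlDl ?fin_numM//.
apply: (@le_trans _ _ (P ((E `&` F) `|` (E `&` V)))); last first.
  have := measureU2 P (measurableI _ _ mE mF) (measurableI _ _ mE mV).
  by move=> /le_trans; apply; exact: leeD.
have [N [mN N0 NP]] : {ae P, forall w, E w -> ((E `&` F) `|` (E `&` V)) w}.
  have H1 := confined_at bm m h0 nh s k1 kn.
  have H2 := brownian_avoids_null bm null s1.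
  move: H1 H2 aeV; apply: filterS3 => w H1 H2 H3 Ew.
  have [Fw|nFw] := pselect (F w); [by left|right; split=> //; apply: H3; split=> //].
  exact: H1.
apply: (@le_trans _ _ (P (((E `&` F) `|` (E `&` V)) `|` N))).
  apply: le_measure; rewrite ?inE//.
    by apply: measurableU => //; apply: measurableU; exact: measurableI.
  move=> w Ew; have [Nw|nN] := pselect (N w); [by right|left].
  by apply: contrapT => nw; apply: nN; apply: NP => /= /(_ Ew).
rewrite measureU0//; by apply: measurableU; exact: measurableI.
Qed.

(** Let Y be K times the time spent in the good set during [1, t], and mu the
    announced exponent.  Integrate e^Y >= e^mu (1 + Y - mu) over the confinement
    event E; the mean of Y on E is at least mu P(E), by [confined_visit] and
    Fubini's theorem. *)
Lemma exp_occupation_ge (K : R) : 0 <= K ->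
  ((expR (K * ((1 - eps) * (t - 1))))%:E * P E <=
   \int[P]_w expeR (\int[lebesgue_measure]_(s in `[0%R, t]) (K * \1_good_set (B s w))%:E))%E.
Proof.
move=> K0; have /andP[eps0 eps1] := eps01.
have [Bt [mBt BtE]] := joint_version bm.
have tm1 : 0 < t - 1 by rewrite subr_gt0.
pose S : set (O * R) := (fun z => \row_i Bt i z) @^-1` good_set.
have mS : measurable S.
  have := measurableD (measurable_row_box (const_mx (- r)) (const_mx r) mBt) (measurable_row_limsup ab mBt).
  by congr measurable.
have mE : measurable E by exact: (measurable_confined bm).
pose U : probability (measurableTypeR R) R := uniform_prob t1.
pose g (z : O * R) : \bar R := (\1_S z)%:E.
have g0 z : (0 <= g z)%E by rewrite lee_fin.
have mg : measurable_fun setT g by apply/measurable_EFinP; exact: measurable_indic.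
have mgw w : measurable_fun setT (fun s : R => g (w, s)) by exact: (measurableT_comp mg).
pose Y w : \bar R := ((K * (t - 1))%:E * \int[U]_s g (w, s))%E.
have mI : measurable_fun setT (fun w => \int[U]_s g (w, s))%E.
  exact: (measurable_fun_fubini_tonelli_F (m2 := U) g).
have mY : measurable_fun setT Y by exact: measurable_funeM.
have Kt0 : 0 <= K * (t - 1) by rewrite mulr_ge0// ltW.
have I0 w : (0 <= \int[U]_s g (w, s))%E by exact: integral_ge0.
have Y0 w : (0 <= Y w)%E by rewrite mule_ge0.
have Yfin w : Y w \is a fin_num.
  rewrite fin_numM// ge0_fin_numE//; apply: (@le_lt_trans _ _ (\int[U]_s 1%:E)%E).
    by apply: le_lower_integral => s _ //; rewrite lee_fin indicE lern1 leq_b1.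
  by rewrite integral_cst// mul1e ltey_eq fin_num_measure.
have meY : measurable_fun setT (fun w => expeR (Y w)) by exact: (measurableT_comp measurable_expeR).
apply: (@le_trans _ _ (\int[P]_w expeR (Y w))%E); last first.
  apply: ae_le_lower_integral => //.
  - by move=> w; exact: expeR_ge0.
  - by move=> w; exact: expeR_ge0.
  - apply: filterS BtE => w BtE; rewrite lee_expeR /Y integral_uniform//; last exact: mgw.
    rewrite muleA -EFinM mulfK ?gt_eqF// -ge0_integralZl_EFin//; last first.
      by apply: measurable_funTS; exact: mgw.
    rewrite integral_mkcond [leRHS]integral_mkcond; apply: le_lower_integral => s _.
      by rewrite erestrict_ge0// => y _; rewrite mule_ge0.
    rewrite !patchE; case: ifPn => [|_]; last by case: ifP => _ //; rewrite lee_fin mulr_ge0.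
    rewrite inE/= in_itv/= => /andP[s1 st].
    have s0 : 0 <= s by lra.
    rewrite mem_set/= ?in_itv/= ?s0// -EFinM lee_fin !indicE.
    suff -> : ((w, s) \in S) = (B s w \in good_set) by [].
    suff e : \row_i Bt i (w, s) = B s w by rewrite /S; apply/idP/idP; rewrite !inE/= e.
    by apply/rowP => i; rewrite mxE BtE.
have mSs (s : R) : measurable [set w | S (w, s)].
  by rewrite -[X in measurable X]setTI; exact: (pair2_measurable s measurableT mS).
set mu := K * ((1 - eps) * (t - 1)).
have mu0 : 0 <= mu by rewrite !mulr_ge0 ?subr_ge0// ltW.
have emu : 0 <= expR mu by exact: expR_ge0.
pose I w : \bar R := (\1_E w)%:E.
have Iw0 w : (0 <= I w)%E by rewrite lee_fin.
have mIE : measurable_fun setT I by apply/measurable_EFinP; exact: measurable_indic.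
have intI : (\int[P]_w I w = P E)%E by rewrite integral_indic// setIT.
have fE : P E \is a fin_num by exact: fin_num_measure.
have muPE : (mu%:E * P E <= \int[P]_w (I w * Y w))%E.
  have -> : (\int[P]_w (I w * Y w) = (K * (t - 1))%:E * \int[P]_w \int[U]_s (I w * g (w, s)))%E.
    rewrite -ge0_integralZl_EFin//; last 2 first.
    - by move=> w _; apply: integral_ge0 => s _; rewrite mule_ge0.
    - rewrite (_ : (fun w => _) = (fun w => I w * \int[U]_s g (w, s))%E); first exact: emeasurable_funM.
      by apply/funext => w; rewrite ge0_integralZl_EFin//; exact: mgw.
    apply: eq_integral => w _; rewrite ge0_integralZl_EFin ?lee_fin//; last exact: mgw.
    by rewrite /Y muleCA.
  have mIg : measurable_fun setT (fun z : O * R => I z.1 * g z)%E.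
    apply: emeasurable_funM => //; exact: (measurableT_comp mIE).
  have Ig0 z : (0 <= I z.1 * g z)%E by rewrite mule_ge0.
  rewrite (@fubini_tonelli _ _ _ _ _ P U (fun z : O * R => I z.1 * g z)%E mIg Ig0).
  rewrite integral_uniform//; last 2 first.
  - exact: (measurable_fun_fubini_tonelli_G (m1 := P) (fun z : O * R => I z.1 * g z)%E).
  - by move=> s; apply: integral_ge0.
  rewrite muleA -EFinM mulfK ?gt_eqF//.
  rewrite /mu EFinM -muleA; apply: lee_wpmul2l => //.
  apply: (@le_trans _ _ (\int[lebesgue_measure]_(s in `[1%R, t]) ((1 - eps)%:E * P E))%E).
    rewrite integral_cst//= lebesgue_measure_itv/= lte_fin t1 -EFinB.
    by rewrite EFinM muleAC.
  apply: le_lower_integral => s /=; first by rewrite mule_ge0// lee_fin subr_ge0.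
  rewrite in_itv/= => st.
  have -> : (\int[P]_w (I w * g (w, s)) = P (E `&` [set w | S (w, s)]))%E.
    transitivity (\int[P]_w (\1_(E `&` [set w | S (w, s)]) w)%:E)%E.
      apply: eq_integral => w _; rewrite /I /g -EFinM indicI; congr (_ * _)%:E.
    rewrite integral_indic ?setIT//; apply: measurableI => //.
  apply: (confined_visit (s := s)) => //.
  apply: filterS BtE => w BtE gw; rewrite /S/= (_ : \row_i _ = B s w)//.
  by apply/rowP => i; rewrite mxE BtE//; case/andP: st; lra.
have fm : ((expR mu * mu)%:E * P E)%E \is a fin_num by exact: fin_numM.
rewrite -(@leeD2rE _ ((expR mu * mu)%:E * P E)%E)//.
have Ie0 w : (0 <= expeR (Y w) + (expR mu * mu)%:E * I w)%E.
  by rewrite adde_ge0 ?expeR_ge0// mule_ge0// lee_fin mulr_ge0.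
have -> : (\int[P]_w expeR (Y w) + (expR mu * mu)%:E * P E =
    \int[P]_w (expeR (Y w) + (expR mu * mu)%:E * I w))%E.
  rewrite ge0_integralD//; last 3 first.
  - by move=> w _; exact: expeR_ge0.
  - by move=> w _; rewrite mule_ge0// lee_fin mulr_ge0.
  - exact: measurable_funeM.
  by rewrite ge0_integralZl_EFin ?intI// mulr_ge0.
apply: (@le_trans _ _ (\int[P]_w ((expR mu)%:E * (I w + I w * Y w)))%E).
  rewrite ge0_integralZl_EFin//; last 2 first.
  - by move=> w _; rewrite adde_ge0 ?mule_ge0.
  - by apply: emeasurable_funD => //; exact: emeasurable_funM.
  rewrite ge0_integralD//; last 2 first.
  - by move=> w _; rewrite mule_ge0.
  - exact: emeasurable_funM.
  rewrite intI [(expR mu * mu)%:E]EFinM -muleA -ge0_muleDr//; last by rewrite mule_ge0.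
  by rewrite lee_wpmul2l// leeD2l.
apply: le_lower_integral => w _; first by rewrite mule_ge0// adde_ge0 ?mule_ge0.
rewrite /I indicE; case: (w \in E); last first.
  by rewrite mul0e adde0 !mule0 adde0 expeR_ge0.
rewrite !mul1e mule1 -(fineK (Yfin w)) -EFinD -EFinM /= -EFinD lee_fin.
set y := fine _; have := expR_ge1Dx (y - mu).
rewrite expRD expRN => hh.
have : expR mu * (1 + (y - mu)) <= expR mu * (expR y * (expR mu)^-1) by rewrite ler_wpM2l.
rewrite [X in _ <= X](_ : _ = expR y); last by field; rewrite gt_eqF// expR_gt0.
lra.
Qed.

End exponential_occupation.

(** * Choice of the scales of confinement *)

Section confinement_scales.
Context {R : realType} (d : nat).
Variables (r eps : R) (b : nat).
Hypotheses (r01 : 0 < r <= 1) (eps01 : 0 < eps <= 1).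

(** Here x is the inverse mesh m, y the number n of steps, and r / (4 y) = h / 2;
    the right-hand side is eps times a lower bound of the probability of one
    step. *)
Lemma exp_beats_power : exists T : R, forall x : R, 1 <= x -> T <= x -> forall y : R,
  1 <= y <= 2 * x ^+ b.+1 ->
  d%:R * (2 * expR (- (r ^+ 2 * x / 16))) <= eps * (r / (4 * y) * expR (- 1)) ^+ d.
Proof.
have /andP[r0 r1] := r01; have /andP[eps0 eps1] := eps01.
pose c := r ^+ 2 / 16; have c0 : 0 < c by rewrite divr_gt0// exprn_gt0.
pose a : R := (b.+1 * d).+1%:R; have a0 : 0 < a by rewrite ltr0n.
have c20 : 0 < c / 2 by rewrite divr_gt0.
pose Ka := (a / (c / 2)) `^ a; have Ka0 : 0 <= Ka by exact: powR_ge0.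
pose kap := eps * (r / 8 * expR (- 1)) ^+ d.
have kap0 : 0 < kap by rewrite mulr_gt0// exprn_gt0// !mulr_gt0 ?expR_gt0.
exists (2 * (2 * d%:R * Ka / kap) / c) => x x1 Tx y /andP[y1 yx].
have x0 : 0 < x by lra.
have y0 : 0 < y by lra.
have pow : x ^+ (b.+1 * d) <= Ka * expR (c / 2 * x).
  apply: le_trans (powR_le_expR a0 c20 (ltW x0)).
  rewrite /a powR_mulrn ?(ltW x0)// exprS ler_peMl// exprn_ge0// ltW//.
have big : 2 * d%:R * Ka <= kap * expR (c / 2 * x).
  rewrite [leRHS]mulrC -ler_pdivrMr//.
  apply: le_trans (_ : c / 2 * x <= _); last by apply: le_trans (expR_ge1Dx _); rewrite lerDr.
  have : 2 * (2 * d%:R * Ka / kap) <= x * c by rewrite -ler_pdivrMr.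
  by lra.
have main : d%:R * (2 * expR (- (c * x))) * x ^+ (b.+1 * d) <= kap.
  have -> : expR (- (c * x)) = (expR (c / 2 * x))^-1 * (expR (c / 2 * x))^-1.
    by rewrite -!expRN -expRD; congr expR; lra.
  set z := expR (c / 2 * x) in pow big *; have z0 : 0 < z by exact: expR_gt0.
  apply: (@le_trans _ _ (d%:R * (2 * (z^-1 * z^-1)) * (Ka * z))).
    by rewrite ler_wpM2l// !mulr_ge0 ?invr_ge0 ?(ltW z0).
  have -> : d%:R * (2 * (z^-1 * z^-1)) * (Ka * z) = (2 * d%:R * Ka) / z.
    by field; rewrite gt_eqF.
  by rewrite ler_pdivrMr.
have xb0 : 0 < x ^+ b.+1 by rewrite exprn_gt0.
rewrite [r ^+ 2 * x / 16](_ : _ = c * x); last by rewrite /c; ring.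
apply: (@le_trans _ _ (eps * (r / (8 * x ^+ b.+1) * expR (- 1)) ^+ d)); last first.
  rewrite ler_wpM2l ?(ltW eps0)// lerXn2r ?nnegrE ?mulr_ge0 ?invr_ge0 ?expR_ge0 ?mulr_ge0 ?(ltW r0) ?(ltW xb0) ?(ltW y0)//.
  rewrite ler_wpM2r ?expR_ge0// ler_wpM2l ?(ltW r0)// lef_pV2 ?posrE ?mulr_gt0//; lra.
have -> : eps * (r / (8 * x ^+ b.+1) * expR (- 1)) ^+ d = kap / x ^+ (b.+1 * d).
  have -> : r / (8 * x ^+ b.+1) * expR (- 1) = (r / 8 * expR (- 1)) / x ^+ b.+1 by field; rewrite gt_eqF.
  by rewrite /kap exprMn exprVn exprM mulrA.
by rewrite ler_pdivlMr// exprn_gt0.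
Qed.

Lemma step_width_ge : exists2 c : R, 0 <= c & forall x y : R, 1 <= x -> 1 <= y <= 2 * x ^+ b.+1 ->
  expR (- (c * x)) <= r / (4 * y).
Proof.
have /andP[r0 r1] := r01.
have l0 : 0 <= - ln (r / 8) by rewrite oppr_ge0 -ln1 ler_ln ?posrE ?divr_gt0//; lra.
exists (- ln (r / 8) + b.+1%:R); first by rewrite addr_ge0.
move=> x y x1 /andP[y1 yx].
have x0 : 0 < x by lra.
have y0 : 0 < y by lra.
have e1 : expR (- ln (r / 8) * - x) <= r / 8.
  rewrite mulrNN; apply: (@le_trans _ _ (expR (ln (r / 8)))); last by rewrite lnK// posrE divr_gt0.
  rewrite ler_expR; have : 0 <= - ln (r / 8) * (x - 1) by rewrite mulr_ge0 ?subr_ge0.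
  lra.
have e2 : x ^+ b.+1 <= expR (b.+1%:R * x).
  rewrite expRM_natl lerXn2r ?nnegrE ?expR_ge0 ?(ltW x0)//.
  by apply: le_trans (expR_ge1Dx _); rewrite lerDr.
have xb0 : 0 < x ^+ b.+1 by rewrite exprn_gt0.
have -> : - ((- ln (r / 8) + b.+1%:R) * x) = - ln (r / 8) * - x + - (b.+1%:R * x) by ring.
rewrite expRD expRN; apply: (@le_trans _ _ (r / 8 / x ^+ b.+1)).
  apply: ler_pM; rewrite ?expR_ge0 ?invr_ge0 ?expR_ge0//.
  by rewrite lef_pV2 ?posrE ?expR_gt0.
have -> : r / 8 / x ^+ b.+1 = r / (8 * x ^+ b.+1) by field; rewrite gt_eqF.
by rewrite ler_wpM2l ?(ltW r0)// lef_pV2 ?posrE ?mulr_gt0//; lra.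
Qed.

End confinement_scales.

Section occupation_growth.
Context {R : realType} {d : nat}.
Variables (r eps beta : R).
Hypotheses (r01 : 0 < r <= 1) (eps01 : 0 < eps <= 1) (beta1 : 1 < beta).

(** The mesh is 1/m with m of order t^(1/b), where 2 / b <= beta - 1.  There are
    n of order t m steps, each of probability at least e^(- c' m), hence a total
    cost of order n m, at most a multiple of t^(1 + 2/b). *)
Lemma exp_occupation_growth : exists2 C : R, 0 <= C & \forall t \near +oo,
  forall (dO : measure_display) (O : measurableType dO) (P : probability O R)
    (B : R -> O -> 'rV[R]_d) (x0 : 'rV[R]_d) ab (K : R),
  brownian_motion P x0 B -> unit_cube x0 -> null_cover ab -> 0 <= K ->
  ((expR (K * ((1 - eps) * (t - 1)) - C * t `^ beta))%:E <=
   \int[P]_w expeR (\int[lebesgue_measure]_(s in `[0%R, t]) (K * \1_(good_set r ab) (B s w))%:E))%E.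
Proof.
have /andP[r0 r1] := r01; have /andP[eps0 eps1] := eps01.
have bt0 : 0 < beta - 1 by rewrite subr_gt0.
pose b := (Num.truncn (2 / (beta - 1))).+1.
have bR : 0 < b%:R :> R by rewrite ltr0n.
have bbeta : 1 + 2 / b%:R <= beta.
  have : 2 / (beta - 1) < b%:R by rewrite truncnS_gt.
  rewrite ltr_pdivrMr// => h; have : 2 / b%:R < beta - 1 by rewrite ltr_pdivrMr// mulrC.
  lra.
have [c c0 cP] := step_width_ge b r01.
have [T TP] := exp_beats_power d b r01 eps01.
exists (8 * d%:R * (c + 1)); first by rewrite !mulr_ge0// addr_ge0.
have pinf (y : R) : \forall t \near +oo, y < t by apply: nbhs_pinfty_gt; exact: num_real.
have near1 := pinf 1; have near2 := pinf ((Num.max 1 T) ^+ b).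
move: near1 near2; apply: filterS2 => t t1 tT dO O P B x0 ab K bm x0c null K0.
have t0 : 0 < t by lra.
pose a := t `^ b%:R^-1.
have a1 : 1 <= a by rewrite -[leLHS](powRr0 t) /a ler_powR ?(ltW t1) ?invr_ge0.
have a0 : 0 < a by lra.
have ab_ : a ^+ b = t.
  by rewrite /a -powR_mulrn ?powR_ge0// -powRrM mulVf ?gt_eqF// powRr1// ltW.
have aT : Num.max 1 T <= a.
  have M1 : 1 <= Num.max 1 T by rewrite le_max lexx.
  rewrite leNgt; apply/negP => aM; have : a ^+ b < Num.max 1 T ^+ b.
    by rewrite ltrXn2r ?nnegrE//; lra.
  by rewrite ab_ ltNge (ltW tT).
pose m := (Num.truncn a).+1.
have m0 : (0 < m)%N by [].
have am : a <= m%:R by rewrite ltW// truncnS_gt.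
have ma : m%:R <= 2 * a.
  have : (Num.truncn a)%:R <= a by rewrite truncn_le ltW.
  rewrite /m -natr1; lra.
have mR1 : 1 <= m%:R :> R by rewrite ler1n.
have tmb : t <= m%:R ^+ b by rewrite -ab_ lerXn2r ?nnegrE ?(ltW a0)//; lra.
pose n := (Num.truncn (t * m%:R)).+1.
have tm1 : 1 <= t * m%:R by rewrite mulr_ege1// ltW.
have tn : t * m%:R < n%:R by rewrite truncnS_gt.
have n2 : n%:R <= 2 * (t * m%:R).
  have : (Num.truncn (t * m%:R))%:R <= t * m%:R by rewrite truncn_le mulr_ge0// ltW.
  rewrite /n -natr1; lra.
have nR : 1 <= n%:R :> R by rewrite ler1n.
have nm : 1 <= (n%:R : R) <= 2 * m%:R ^+ b.+1.
  rewrite nR/=; apply: le_trans n2 _; rewrite ler_wpM2l// exprSr ler_wpM2r//; lra.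
pose h : R := r / (2 * n%:R).
have h0 : 0 <= h by rewrite divr_ge0 ?mulr_ge0 ?(ltW r0).
have nh : n%:R * h <= r / 2.
  by rewrite /h le_eqVlt; apply/orP; left; apply/eqP; field; rewrite gt_eqF//; lra.
have h2 : h / 2 = r / (4 * n%:R) by rewrite /h; field; rewrite gt_eqF//; lra.
have hm : h * m%:R <= 1 / 2.
  have nR0 : 0 < n%:R :> R by lra.
  rewrite /h mulrAC ler_pdivrMr ?mulr_gt0//.
  have : m%:R <= n%:R :> R.
    by apply: le_trans (ltW tn); rewrite ler_peMl// ltW.
  have : r * m%:R <= 1 * m%:R by rewrite ler_wpM2r.
  lra.
have h12 : h <= 1 / 2 by apply: le_trans hm; rewrite ler_peMr.
have mRi : 0 < m%:R :> R by lra.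
have gap j : j.+1%:R / m%:R - j%:R / m%:R = m%:R^-1 :> R.
  by rewrite -mulrBl -natr1 addrC addKr mul1r.
have tau_lt j : j%:R / m%:R < j.+1%:R / m%:R :> R by rewrite ltr_pM2r ?invr_gt0// ltr_nat.
have tau0 j : 0 <= j%:R / m%:R :> R by rewrite divr_ge0.
have gap1 j : j.+1%:R / m%:R - j%:R / m%:R <= 1 :> R by rewrite gap invf_le1.
have sqE (z : R) : z ^+ 2 / (2 * m%:R^-1) = z * (z * m%:R) / 2 by field; rewrite gt_eqF.
pose q := (h / 2 * expR (- 1)) ^+ d.
have hp : 0 < h by rewrite divr_gt0 ?mulr_gt0//; lra.
have qp j : (1 <= j)%N ->
    (q%:E <= P (increment B (j%:R / m%:R) (j.+1%:R / m%:R) @^-1` step_box x0 h j))%E.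
  case: j => // j _; apply: (increment_box_ge bm) => // i.
  rewrite gap /step_center mxE normr0 add0r sqE.
  have : h * (h * m%:R) <= 1 / 2 * (1 / 2) by rewrite ler_pM// mulr_ge0.
  lra.
have p0 j : (((h / 2 * expR (- m%:R)) ^+ d)%:E <=
    P (increment B (j%:R / m%:R) (j.+1%:R / m%:R) @^-1` step_box x0 h j))%E.
  apply: (increment_box_ge bm) => // i.
  rewrite gap; have : `|(step_center x0 j) 0 i| <= 1 / 2.
    case: j => [|j] /=; rewrite mxE; last by rewrite normr0.
    by have := x0c i; rewrite normrN ler_norml div1r.
  set cc := `|_| => cc2; have cc0 : 0 <= cc by exact: normr_ge0.
  rewrite sqE ler_pdivrMr//.
  have cch : cc + h <= 1 by apply: le_trans (lerD cc2 h12) _; lra.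
  have : (cc + h) * (cc + h) <= 1 * 1 by apply: ler_pM => //; exact: addr_ge0.
  by move=> /(ler_wpM2r (ltW mRi)); lra.
have small : d%:R * (2 * expR (- (r ^+ 2 * m%:R / 16))) <= eps * q.
  rewrite /q h2; apply: TP => //.
  by apply: le_trans am; apply: le_trans aT; rewrite le_max lexx orbT.
have eps01' : 0 <= eps <= 1 by rewrite (ltW eps0).
apply: le_trans (exp_occupation_ge bm m0 h0 r0 nh t1 tn eps01' qp small null K0).
rewrite expRD EFinM lee_wpmul2l ?lee_fin ?expR_ge0//.
rewrite (confined_prob bm)//.
apply: (@le_trans _ _ (\prod_(j <- iota 0 n) (((h / 2 * expR (- m%:R)) ^+ d)%:E))%E); last first.
  have k0 : (0 <= ((h / 2 * expR (- m%:R)) ^+ d)%:E)%E.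
    by rewrite lee_fin exprn_ge0// mulr_ge0 ?expR_ge0// divr_ge0.
  set F := (\prod_(j <- _) P _)%E; set G := (\prod_(j <- _) _)%E.
  suff H : (0 <= G)%E /\ (G <= F)%E by case: H.
  rewrite /G /F.
  apply: (big_ind2 (fun x y : \bar R => (0 <= x)%E /\ (x <= y)%E)) => //.
  by move=> x1 x2 y1 y2 [? ?] [? ?]; split; [exact: mule_ge0|exact: lee_pmul].
rewrite prodEFin lee_fin big_const_seq count_predT size_iota iter_mulr_1.
have e1 : expR (- (c * m%:R)) <= h / 2 by rewrite h2; exact: cP.
have e2 : expR (- ((c + 1) * m%:R)) <= h / 2 * expR (- m%:R).
  rewrite mulrDl mul1r opprD expRD ler_wpM2r ?expR_ge0//.
apply: (@le_trans _ _ ((expR (- ((c + 1) * m%:R)) ^+ d) ^+ n)); last first.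
  have k0 : 0 <= h / 2 * expR (- m%:R) by rewrite mulr_ge0 ?expR_ge0// divr_ge0.
  by rewrite !lerXn2r ?nnegrE ?exprn_ge0 ?expR_ge0.
rewrite -!expRM_natl ler_expR.
have mm : m%:R * n%:R <= 8 * t `^ beta.
  apply: (@le_trans _ _ (8 * (t * (a * a)))).
    apply: (@le_trans _ _ (2 * t * (m%:R * m%:R))).
      by rewrite mulrC; apply: le_trans (ler_wpM2r (ltW mRi) n2) _; lra.
    have : m%:R * m%:R <= (2 * a) * (2 * a) by apply: ler_pM => //; exact: ltW.
    move=> /(ler_wpM2l (ltW t0)); lra.
  rewrite ler_wpM2l// /a -powRD ?gt_eqF ?implybT//.
  rewrite -[t in t * _]powRr1 ?(ltW t0)// -powRD ?gt_eqF ?implybT//.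
  apply: ler_powR; first exact: ltW.
    by apply: le_trans bbeta; rewrite lerD2l -mulr2n -[leLHS]mulr_natl.
  by rewrite addr_gt0 ?invr_gt0.
have dc0 : 0 <= d%:R * (c + 1) by rewrite mulr_ge0// addr_ge0.
have := ler_wpM2l dc0 mm; lra.
Qed.

End occupation_growth.

(** * Lower bound of the moments *)

Section lower_bound.
Context {R : realType} {d : nat} {dX : measure_display} {X : measurableType dX}.
Variables (theta : R) (u : 'rV[R]_d -> R).
Hypotheses (d1 : (1 <= d)%N) (theta0 : 0 < theta).
Hypothesis u_le0 : forall x, u x <= 0.
Hypothesis u_esssup : forall eps : R, 0 < eps ->
  exists2 r : R, 0 < r & (ess_sup_on (eball r) u <= (u 0 + eps)%:E)%E.

(** An upper bound y < u 0 + e of u that holds outside a null part of a ball is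
    provided by the infimum which defines the essential supremum. *)
Lemma near_minimum (e : R) : 0 < e -> exists r ab,
  [/\ 0 < r <= 1, null_cover ab & forall x, good_set r ab x -> u x <= u 0 + e].
Proof.
move=> e0; have [rho rho0 rhoP] := u_esssup (divr_gt0 e0 (ltr0n _ 2)).
have : (ess_sup_on (eball rho) u < (u 0 + e)%:E)%E.
  by apply: le_lt_trans rhoP _; rewrite lte_fin; lra.
move=> /ereal_inf_lt [y /= yN ye].
have [ab abN abP] := lebesgue_outer_null yN.
pose r := Num.min 1 (rho / (d.+1)%:R).
have d0 : 0 < d.+1%:R :> R by rewrite ltr0n.
have r0 : 0 < r by rewrite lt_min ltr01 divr_gt0.
exists r, ab; split=> //; first by rewrite r0 ge_min lexx.
move=> x [xr xN]; rewrite -lee_fin; apply: le_trans (ltW ye).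
rewrite leNgt; apply/negP => yx; apply: xN; apply: abP; split=> //.
rewrite /eball/=.
have xc i : `|x 0 i| <= r by have := xr i; rewrite !mxE ler_norml.
apply: le_lt_trans (enorm_le_coord (ltW r0) xc) _.
have : r * d.+1%:R <= rho by rewrite -ler_pdivlMr// ge_min lexx orbT.
rewrite -natr1; lra.
Qed.

Variables (Pt : probability X R) (xi : 'rV[int]_d -> X -> 'rV[int]_d).
Hypothesis law : lattice_perturbation Pt theta xi.

Local Notation Z := (@partition_function R d theta).

Lemma neg_potential_gathered (F : seq 'rV[int]_d) (z : 'rV[int]_d -> 'rV[int]_d) x :
  uniq F -> (forall q, q \in F -> z q = - q) ->
  (((size F)%:R * - u x)%:E <= neg_potential u z x)%E.
Proof.
move=> uF zF; apply: le_trans (sum_le_esum _ uF).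
rewrite sumEFin lee_fin big_seq (eq_bigr (fun=> - u x)) => [|q qF].
  by rewrite -big_seq big_const_seq count_predT iter_addr_0 mulr_natl.
congr (- u _); rewrite (zF _ qF); apply/rowP => i; rewrite !mxE rmorphN/=; ring.
Qed.

Lemma gather_prob (F : seq 'rV[int]_d) : uniq F ->
  Pt (\bigcap_(q in [set` [fset q in F]%fset]) (xi q @^-1` [set - q])) =
  (expR (- (\sum_(q <- F) qnorm q `^ theta + (size F)%:R * ln Z)))%:E.
Proof.
move=> uF; have Z0 : 0 < Z by apply: lt_le_trans (partition_function_ge1 d1 theta0).
transitivity (\prod_(q <- [fset q in F]%fset) Pt (xi q @^-1` [set (- q)%R]))%E.
  exact: (lp_independent law).
transitivity (\prod_(q <- F) Pt (xi q @^-1` [set (- q)%R]))%E.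
  by apply: perm_big; apply: uniq_perm => [||i]; [exact: fset_uniq|exact: uF|rewrite !inE].
transitivity (\prod_(q <- F) (expR (- (qnorm q `^ theta + ln Z)))%:E)%E.
  apply: eq_bigr => q _; transitivity ((Z^-1 * @lattice_weight R d theta (- q))%:E).
    exact: (lp_law law).
  have -> : @lattice_weight R d theta (- q) = expR (- (qnorm q `^ theta)).
    rewrite lattice_weightE mul1r /qnorm.
    have -> : lattice_point (- q) = - lattice_point q :> 'rV[R]_d.
      by apply/rowP => i; rewrite !mxE rmorphN.
    by rewrite enormN.
  congr EFin; rewrite opprD expRD mulrC; congr (_ * _); by rewrite expRN lnK.
rewrite prodEFin -expR_sum; congr (expR _)%:E.
by rewrite sumrN big_split/= big_const_seq count_predT iter_addr_0 mulr_natl.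
Qed.

(** The second bound, which controls the normalizing constants Z of the chosen
    points, holds since each of these points adds at least L to excess (2 L). *)
Lemma excess_attained (L : R) : 0 < L -> exists2 F : seq 'rV[int]_d, uniq F &
  @excess R d theta L - 1 <= \sum_(q <- F) (L - qnorm q `^ theta) /\
  (size F)%:R * L <= @excess R d theta (2 * L).
Proof.
move=> L0; pose f q := Num.max 0 (L - @qnorm R d q `^ theta).
have f0 q : (0 <= (f q)%:E)%E by rewrite lee_fin le_max lexx.
have [E _] := excess_scale theta0 L0 (d := d).
have [E2 _] := @excess_scale R d theta theta0 (2 * L) (mulr_gt0 (ltr0n _ 2) L0).
have cv := cvg_enumeration f0; rewrite E in cv.
have [n nP] : exists n, @excess R d theta L - 1 < \sum_(q <- enumeration 'rV[int]_d n) f q.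
  have lt1 : (((@excess R d theta L - 1)%:E) < (@excess R d theta L)%:E)%E by rewrite lte_fin; lra.
  have := cv _ (open_ereal_gt_ereal lt1 : nbhs _ _).
  move=> [n _ nP]; exists n; have := nP n (leqnn n); rewrite /= sumEFin lte_fin//.
(* the points that are filtered out contribute nothing to the excess of L *)
pose F := [seq q <- enumeration 'rV[int]_d n | qnorm q `^ theta <= L].
have uF : uniq F by rewrite filter_uniq// enumeration_uniq.
exists F => //; split.
  apply: le_trans (ltW nP) _; rewrite /F big_filter [leRHS]big_mkcond/=.
  apply: ler_sum => q _; rewrite /f; case: ifPn => h; first by rewrite max_r// subr_ge0.
  by rewrite max_l// subr_le0 ltW// ltNge.
rewrite -lee_fin -E2; apply: le_trans (sum_le_esum _ uF).
rewrite sumEFin lee_fin mulr_natl -iter_addr_0 -count_predT -big_const_seq.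
rewrite big_seq [leRHS]big_seq; apply: ler_sum => q; rewrite mem_filter => /andP[qL _].
by rewrite le_max; apply/orP; right; lra.
Qed.

Lemma fk_moment_ge (e eps beta : R) : 0 < e < - u 0 -> 0 < eps < 1 -> 1 < beta ->
  exists2 C : R, 0 <= C & \forall t \near +oo,
  forall (dO : measure_display) (O : measurableType dO) (P : probability O R)
    (B : R -> O -> 'rV[R]_d) (x0 : 'rV[R]_d) (p : R),
  brownian_motion P x0 B -> unit_cube x0 -> 1 <= p ->
  let L := p * (- u 0 - e) * (1 - eps) * (t - 1) in
  ((expR (@excess R d theta L - 1 - @excess R d theta (2 * L) / L * ln Z - p * (C * t `^ beta)))%:E
   <= \int[Pt]_w (feynman_kac P B (potential u (xi ^~ w)) t `^ p))%E.
Proof.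
move=> /andP[e0 eM] /andP[eps0 eps1] beta1.
have [r [ab [r01 nab abP]]] := near_minimum e0.
have eps01 : 0 < eps <= 1 by rewrite eps0 ltW.
have [C C0 CP] := @exp_occupation_growth R d r eps beta r01 eps01 beta1.
have Z1 := partition_function_ge1 d1 theta0.
have lnZ : 0 <= ln Z by rewrite ln_ge0.
pose M' := - u 0 - e; have M'0 : 0 < M' by rewrite subr_gt0.
exists C => //; have : \forall t \near +oo, (1 : R) < t by apply: nbhs_pinfty_gt; exact: num_real.
move: CP; apply: filterS2 => t CP t1 dO O P B x0 p bm x0c p1.
set L := p * _ * _ * _.
have p0 : 0 < p by lra.
have L0 : 0 < L by rewrite !mulr_gt0 ?subr_gt0.
have [F uF [FL F2L]] := excess_attained L0.
pose K := (size F)%:R * M'; have K0 : 0 <= K by rewrite mulr_ge0// ltW.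
pose A := \bigcap_(q in [set` [fset q in F]%fset]) (xi q @^-1` [set - q]).
have mA : measurable A.
  by apply: fin_bigcap_measurable => // q _; exact: (lp_measurable law).
pose k := expR (K * ((1 - eps) * (t - 1)) - C * t `^ beta).
have fkA w : A w -> (k%:E <= feynman_kac P B (potential u (xi ^~ w)) t)%E.
  move=> Aw; rewrite feynman_kacE//.
  apply: le_trans (CP _ _ P B x0 ab K bm x0c nab K0) _.
  apply: le_lower_integral => o _; first exact: expeR_ge0.
  rewrite lee_expeR; apply: le_lower_integral => s _; first by rewrite lee_fin mulr_ge0.
  rewrite indicE; have [sg|_] := boolP (_ \in _); last by rewrite mulr0 neg_potential_ge0.
  rewrite mulr1; apply: le_trans (neg_potential_gathered (F := F) _ uF _); last first.
    by move=> q qF; apply: Aw; rewrite /= !inE.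
  rewrite lee_fin /K ler_wpM2l//; move: sg; rewrite inE => /abP; rewrite /M'; lra.
apply: (@le_trans _ _ (\int[Pt]_w ((k `^ p)%:E * (\1_A w)%:E))%E); last first.
  apply: le_lower_integral => w _; first by rewrite mule_ge0 ?lee_fin ?powR_ge0.
  rewrite indicE; have [wA|_] := boolP (w \in A); last by rewrite mule0 poweR_ge0.
  rewrite mule1 -poweR_EFin; apply: gt0_ler_poweR; rewrite ?(ltW p0)// ?in_itv/= ?leey ?andbT//.
  - by rewrite lee_fin expR_ge0.
  - by apply: integral_ge0 => o _; exact: expeR_ge0.
  - by apply: fkA; move: wA; rewrite inE.
rewrite ge0_integralZl_EFin ?powR_ge0//; last first.
  by apply/measurable_EFinP; exact: measurable_indic.
have -> : (\int[Pt]_x (\1_A x)%:E = Pt A)%E by rewrite integral_indic// setIT.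
have -> : Pt A = _ := gather_prob uF.
rewrite -EFinM lee_fin /k -expRM -expRD ler_expR.
have SL : \sum_(q <- F) (L - qnorm q `^ theta) = (size F)%:R * L - \sum_(q <- F) qnorm q `^ theta.
  by rewrite sumrB big_const_seq count_predT iter_addr_0 mulr_natl.
have h1 : (size F)%:R * ln Z <= @excess R d theta (2 * L) / L * ln Z.
  by rewrite ler_wpM2r// ler_pdivlMr.
have -> : (K * ((1 - eps) * (t - 1)) - C * t `^ beta) * p = (size F)%:R * L - p * (C * t `^ beta).
  by rewrite /K /L /M'; ring.
rewrite SL in FL; lra.
Qed.

End lower_bound.

(** * Passage to the limit *)

Section asymptotics.
Context {R : realType} (d : nat) (theta : R).
Hypotheses (d1 : (1 <= d)%N) (theta0 : 0 < theta).

Local Notation g := (1 + d%:R / theta).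
Local Notation e := (@excess R d theta).
Local Notation c := (@excess_constant R d theta).

Let g1 : 1 < g.
Proof. by rewrite ltrDl divr_gt0// ltr0n. Qed.

Lemma cvg_powRN_pinfty (s : R) : 0 < s -> t `^ (- s) @[t --> +oo] --> (0 : R).
Proof.
move=> s0; apply/cvgrPdist_lt => r r0; near=> t.
have t0 : 0 < t by near: t; exact: nbhs_pinfty_gt.
have rt : (r^-1) `^ s^-1 < t by near: t; apply: nbhs_pinfty_gt; exact: num_real.
rewrite sub0r normrN gtr0_norm ?powR_gt0// powRN invf_plt ?posrE ?powR_gt0//.
have -> : r^-1 = (r^-1 `^ s^-1) `^ s.
  by rewrite -powRrM mulVf ?gt_eqF// powRr1// invr_ge0 ltW.
by rewrite gt0_ltr_powR// nnegrE ?powR_ge0// ltW.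
Unshelve. all: by end_near. Qed.

Lemma cvg_affine_pinfty (a b : R) : 0 < a -> a * t + b @[t --> +oo] --> +oo.
Proof.
move=> a0; apply/cvgryPgt => A; near=> t.
have : (A - b) / a < t by near: t; apply: nbhs_pinfty_gt; exact: num_real.
by rewrite ltr_pdivrMr//; lra.
Unshelve. all: by end_near. Qed.

Lemma cvg_inv_pinfty : (t : R)^-1 @[t --> +oo] --> (0 : R).
Proof.
apply: cvg_trans (cvg_powRN_pinfty ltr01); apply: near_eq_cvg; near=> t.
have t0 : 0 < t by near: t; exact: nbhs_pinfty_gt.
by rewrite powR_inv1// ltW.
Unshelve. all: by end_near. Qed.

Lemma cvg_excess_affine (a b : R) : 0 < a ->
  e (a * t + b) / t `^ g @[t --> +oo] --> c * a `^ g.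
Proof.
move=> a0.
have h1 : e (a * t + b) / (a * t + b) `^ g @[t --> +oo] --> c.
  exact: (@cvg_comp _ _ _ (fun t : R => a * t + b) (fun L => e L / L `^ g) _ _ _ (cvg_affine_pinfty b a0) (cvg_excess d1 theta0)).
have h2 : (a + b * t^-1) `^ g @[t --> +oo] --> a `^ g.
  have h : a + b * t^-1 @[t --> +oo] --> (a + b * 0 : R).
    by apply: cvgD; [exact: cvg_cst|apply: cvgM; [exact: cvg_cst|exact: cvg_inv_pinfty]].
  rewrite mulr0 addr0 in h.
  by apply: (cvg_comp (fun t : R => a + b * t^-1) (fun x => x `^ g) h); exact: continuous_powR_pos.
apply: cvg_trans (cvgM h1 h2); apply: near_eq_cvg; near=> t.
have t0 : 0 < t by near: t; exact: nbhs_pinfty_gt.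
have L0 : 0 < a * t + b.
  have : - b / a < t by near: t; apply: nbhs_pinfty_gt; exact: num_real.
  by rewrite ltr_pdivrMr//; lra.
rewrite /=; have -> : a + b * t^-1 = (a * t + b) / t by field; rewrite gt_eqF.
have tV : t^-1 `^ g = (t `^ g)^-1 by rewrite -powR_inv1 ?(ltW t0)// -powRrM mulN1r powRN.
rewrite powRM ?invr_ge0 ?(ltW L0) ?(ltW t0)// tV.
by rewrite mulrA divfK// gt_eqF// powR_gt0.
Unshelve. all: by end_near. Qed.

Lemma upper_rate (p M k S D : R) : 0 < p * M -> 0 < k ->
  t `^ (- g) * (p * t * S + (k * e (p * t * M / k) + D)) @[t --> +oo] --> k * (c * (p * M / k) `^ g).
Proof.
move=> pM0 k0; have pMk : 0 < p * M / k by rewrite divr_gt0.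
have E := cvg_excess_affine 0 pMk.
have g0 : 0 < g by exact: lt_trans g1.
have gm : 0 < g - 1 by rewrite subr_gt0.
have {}l1 : p * S * t `^ (- (g - 1)) @[t --> +oo] --> (p * S * 0 : R).
  by apply: cvgM; [exact: cvg_cst|exact: cvg_powRN_pinfty].
have l2 : k * (e (p * M / k * t + 0) / t `^ g) @[t --> +oo] --> k * (c * (p * M / k) `^ g).
  by apply: cvgM; [exact: cvg_cst|exact: E].
have l3 : D * t `^ (- g) @[t --> +oo] --> (D * 0 : R).
  by apply: cvgM; [exact: cvg_cst|exact: cvg_powRN_pinfty].
have := cvgD (cvgD l1 l2) l3; rewrite !mulr0 add0r addr0 => H.
apply: cvg_trans (H _ _); apply: near_eq_cvg; near=> t.
have t0 : 0 < t by near: t; exact: nbhs_pinfty_gt.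
have tE : t `^ (- (g - 1)) = t * t `^ (- g).
  by rewrite opprB powRD ?(gt_eqF t0) ?implybT// powRr1 ?(ltW t0).
rewrite !fctE addr0 tE -powRN [p * M / k * t](_ : _ = p * t * M / k); last by ring.
ring.
Unshelve. all: by end_near. Qed.

Lemma lower_rate (a p C z beta : R) : 0 < a -> beta < g ->
  t `^ (- g) * (e (a * (t - 1)) - 1 - e (2 * (a * (t - 1))) / (a * (t - 1)) * z - p * (C * t `^ beta))
    @[t --> +oo] --> c * a `^ g.
Proof.
move=> a0 bg; have a20 : 0 < 2 * a by rewrite mulr_gt0.
have g0 : 0 < g by exact: lt_trans g1.
have l1 := cvg_excess_affine (- a) a0.
have l2 := cvg_excess_affine (- (2 * a)) a20.
have l3 : (a * t + - a)^-1 @[t --> +oo] --> (0 : R).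
  exact: (@cvg_comp _ _ _ (fun t : R => a * t + - a) (fun L => L^-1) _ _ _ (cvg_affine_pinfty (- a) a0) cvg_inv_pinfty).
have l4 : z * ((e (2 * a * t + - (2 * a)) / t `^ g) * (a * t + - a)^-1) @[t --> +oo]
    --> z * (c * (2 * a) `^ g * 0).
  by apply: cvgM; [exact: cvg_cst|exact: cvgM].
have bg' : 0 < g - beta by rewrite subr_gt0.
have l5 : p * C * t `^ (- (g - beta)) @[t --> +oo] --> (p * C * 0 : R).
  by apply: cvgM; [exact: cvg_cst|exact: cvg_powRN_pinfty].
have := cvgB (cvgB (cvgB l1 (cvg_powRN_pinfty g0)) l4) l5; rewrite !mulr0 !subr0 => H.
apply: cvg_trans (H _ _ _); apply: near_eq_cvg; near=> t.
have t0 : 0 < t by near: t; exact: nbhs_pinfty_gt.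
have tE : t `^ (- (g - beta)) = t `^ beta * t `^ (- g).
  by rewrite opprB powRD ?(gt_eqF t0) ?implybT.
rewrite !fctE tE -!powRN [a * t + - a](_ : _ = a * (t - 1)); last by ring.
rewrite [2 * a * t + _](_ : _ = 2 * (a * (t - 1))); last by ring.
ring.
Unshelve. all: by end_near. Qed.

Lemma cvg_at_right_ex (f : R -> R) (l b eta : R) : f x @[x --> (0 : R)^'+] --> l ->
  0 < b -> 0 < eta -> exists2 x : R, 0 < x < b & `|l - f x| < eta.
Proof.
move=> fl b0 eta0; have /cvgrPdist_lt/(_ _ eta0) h := fl.
near (0 : R)^'+ => x; exists x.
  by apply/andP; split; near: x; [exact: nbhs_right_gt|exact: nbhs_right_lt].
by near: x.
Unshelve. all: by end_near. Qed.

Lemma upper_rate_limit (K : R) : 0 < K ->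
  (1 - x) `^ (2 + theta) * (c * (K / (1 - x) `^ (2 + theta)) `^ g) @[x --> (0 : R)^'+] --> c * K `^ g.
Proof.
move=> K0; apply: cvg_within_filter.
have k1 : (1 - x) `^ (2 + theta) @[x --> (0 : R)] --> (1 : R).
  have h : 1 - x @[x --> (0 : R)] --> (1 - 0 : R) by apply: cvgB; [exact: cvg_cst|exact: cvg_id].
  rewrite subr0 in h.
  have := cvg_comp (fun x : R => 1 - x) (fun x => x `^ (2 + theta)) h.
  by move=> /(_ _ (@continuous_powR_pos R (2 + theta) 1 ltr01)); rewrite powR1.
have kV : ((1 - x) `^ (2 + theta))^-1 @[x --> (0 : R)] --> (1 : R).
  have H := cvgV (oner_neq0 R) k1; rewrite invr1 in H; exact: H.
have h : K / (1 - x) `^ (2 + theta) @[x --> (0 : R)] --> (K * 1 : R).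
  by apply: cvgM; [exact: cvg_cst|].
rewrite mulr1 in h.
have hg := cvg_comp (fun x : R => K / (1 - x) `^ (2 + theta)) (fun x => x `^ g) h (@continuous_powR_pos R g _ K0).
have H : (1 - x) `^ (2 + theta) * (c * (K / (1 - x) `^ (2 + theta)) `^ g) @[x --> (0 : R)] --> (1 * (c * K `^ g) : R).
  by apply: cvgM => //; apply: cvgM; [exact: cvg_cst|exact: hg].
by rewrite mul1r in H.
Qed.

Lemma lower_rate_limit (p M : R) : 0 < p -> 0 < M ->
  c * (p * (M - x) * (1 - x)) `^ g @[x --> (0 : R)^'+] --> c * (p * M) `^ g.
Proof.
move=> p0 M0; apply: cvg_within_filter; apply: cvgM; first exact: cvg_cst.
have h : p * (M - x) * (1 - x) @[x --> (0 : R)] --> (p * (M - 0) * (1 - 0) : R).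
  apply: cvgM; last by apply: cvgB; [exact: cvg_cst|exact: cvg_id].
  by apply: cvgM; [exact: cvg_cst|apply: cvgB; [exact: cvg_cst|exact: cvg_id]].
rewrite !subr0 mulr1 in h.
exact: (cvg_comp (fun x : R => p * (M - x) * (1 - x)) (fun x => x `^ g) h (@continuous_powR_pos R g _ (mulr_gt0 p0 M0))).
Qed.

End asymptotics.

Section sandwich.
Context {R : realType}.

Lemma lne_sandwich (E : \bar R) (x y a l eps : R) : 0 <= a ->
  ((expR y)%:E <= E)%E -> (E <= (expR x)%:E)%E -> l - eps < a * y -> a * x < l + eps ->
  (`| a%:E * lne E - l%:E | < eps%:E)%E.
Proof.
move=> a0 yE Ex ly xl.
have E0 : (0 <= E)%E by apply: le_trans yE; rewrite lee_fin expR_ge0.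
have lx : (lne E <= x%:E)%E.
  by rewrite -(expeRK x%:E) lee_lne// in_itv/= ?E0 ?leey ?lee_fin ?expR_ge0.
have ly' : (y%:E <= lne E)%E.
  by rewrite -(expeRK y%:E) lee_lne// in_itv/= ?E0 ?leey ?lee_fin ?expR_ge0.
case: (lne E) lx ly' => [r||]//; rewrite !lee_fin => rx yr.
rewrite -EFinM -EFinB abse_EFin lte_fin ltr_distl.
apply/andP; split; [apply: lt_le_trans ly _|apply: le_lt_trans xl]; exact: ler_wpM2l.
Qed.

Lemma two_step_distance (x y z eps : R) : `|x - y| < eps / 2 -> `|y - z| < eps / 2 ->
  x - eps < z < x + eps.
Proof.
by rewrite !ltr_distl => /andP[h1 h2] /andP[h3 h4]; apply/andP; split; lra.
Qed.

End sandwich.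

Unset Implicit Arguments.

Theorem proposition3p5 (R : realType) (d : nat) (theta alpha C0 : R)
    (u : 'rV[R]_d -> R)
    (dX : measure_display) (X : measurableType dX) (Ptheta : probability X R)
    (xi : 'rV[int]_d -> X -> 'rV[int]_d)
    (dO : measure_display) (O : measurableType dO)
    (P : 'rV[R]_d -> probability O R) (B : R -> O -> 'rV[R]_d)
    (d_ge1 : (1 <= d)%N) (theta_gt0 : 0 < theta)
    (alpha_gtd : d%:R < alpha) (C0_lt0 : C0 < 0)
    (u_meas : lebesgue_measurable_fun u)
    (u_le0 : forall x, u x <= 0)
    (u_tail : u x / (C0 * enorm x `^ (- alpha)) @[x --> enorm_infty] --> (1 : R))
    (xi_law : lattice_perturbation Ptheta theta xi)
    (B_bm : forall x0, brownian_motion (P x0) x0 B)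
    (u_inf : ereal_inf [set (u x)%:E | x in [set: 'rV[R]_d]] = (u 0)%:E)
    (u_esssup : forall eps : R, 0 < eps ->
       exists2 r : R, 0 < r & (ess_sup_on (eball r) u <= (u 0 + eps)%:E)%E) :
  forall p : R, 1 <= p ->
  forall eps : R, 0 < eps ->
    \forall t \near +oo, forall x0, unit_cube x0 ->
      (`| (t `^ (- (1 + d%:R / theta)))%:E *
          lne (\int[Ptheta]_w
                 (feynman_kac (P x0) B (potential u (xi ^~ w)) t `^ p))
          - (c_minus d theta (p * u 0))%:E | < eps%:E)%E.
Proof.
move=> p p1 eps eps0; pose M := - u 0.
have u_ge x : - M <= u x.
  by rewrite opprK -lee_fin -u_inf; apply: ereal_inf_lbound; exists x.
have M0 : 0 < M := u_minimum_neg d_ge1 C0_lt0 u_ge u_tail.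
have p0 : 0 < p by exact: lt_le_trans p1.
pose g := 1 + d%:R / theta.
have g1 : 1 < g by rewrite ltrDl divr_gt0// ltr0n.
have -> : c_minus d theta (p * u 0) = @excess_constant R d theta * (p * M) `^ g.
  have -> : p * M = `|p * u 0| by rewrite normrM (gtr0_norm p0) (ler0_norm (u_le0 0)).
  by rewrite /c_minus /excess_constant -!mulrA; do 3 congr (_ * _); rewrite mulrC.
set l := @excess_constant R d theta * _.
have eps2 : 0 < eps / 2 by rewrite divr_gt0.
have pM0 : 0 < p * M by exact: mulr_gt0.
have [dl dl01 dlP] := cvg_at_right_ex (@upper_rate_limit R d theta _ pM0) ltr01 eps2.
have b0 : 0 < Num.min 1 M by rewrite lt_min ltr01.
have [e /andP[e0 eb] eP] := cvg_at_right_ex (@lower_rate_limit R d theta _ _ p0 M0) b0 eps2.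
have /andP[e1 eM] : (e < 1) && (e < M) by rewrite -lt_min.
pose beta := (1 + g) / 2.
have beta1 : 1 < beta by rewrite /beta; lra.
have betag : beta < g by rewrite /beta; lra.
have e01 : 0 < e < 1 by rewrite e0.
have eM0 : 0 < e < - u 0 by rewrite e0.
have [S [D SD]] := fk_moment_le d_ge1 theta_gt0 alpha_gtd C0_lt0 u_ge u_le0 u_tail xi_law dl01.
have [C _ CP] := fk_moment_ge d_ge1 theta_gt0 u_le0 u_esssup xi_law eM0 e01 beta1.
have a0 : 0 < p * (M - e) * (1 - e) by rewrite !mulr_gt0 ?subr_gt0.
have k0 : 0 < (1 - dl) `^ (2 + theta).
  by rewrite powR_gt0// subr_gt0; case/andP: dl01.
have /cvgrPdist_lt/(_ _ eps2) up := upper_rate d_ge1 theta_gt0 S D pM0 k0.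
have /cvgrPdist_lt/(_ _ eps2) low :=
  lower_rate d_ge1 theta_gt0 p C (ln (@partition_function R d theta)) a0 betag.
have t1 : \forall t \near +oo, (0 : R) < t by apply: nbhs_pinfty_gt; exact: num_real.
apply: filter_app t1; move: CP up low; apply: filterS3 => t CPt upt lowt t0 x0 x0c.
have tg : 0 <= t `^ (- g) by exact: powR_ge0.
have ub := SD _ _ (P x0) B x0 p t (B_bm x0) p1 t0.
have lb := CPt _ _ (P x0) B x0 p (B_bm x0) x0c p1.
have /andP[low_rate _] := two_step_distance eP lowt.
have /andP[_ up_rate] := two_step_distance dlP upt.
exact: (lne_sandwich tg lb ub low_rate up_rate).
Qed.
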